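(* Let $\lambda\in(0,1]$, $\beta\in(0,1)$ and $b\in\mathbb{R}$. Then the minimum $$\min_{z\in\mathbb{H}}\big(\theta(\lambda;z)-b\,\theta(\beta\lambda;z)\big)$$ is achieved at $z=e^{i\pi/3}$ if $b\le\sqrt\beta$, and does not exist if $b>\sqrt\beta$.
   Context: $\mathbb{H}=\{z=x+iy\in\mathbb{C}:y>0\}$. For $s>0$ and $z\in\mathbb{H}$ with $y=\Im(z)$, $$\theta(s;z)=\sum_{(m,n)\in\mathbb{Z}^2}e^{-\frac{\pi s}{y}|mz+n|^2}.$$ *)

(* Defs.v *)
From HB Require Import structures.
From mathcomp Require Export all_boot all_order all_algebra.
From mathcomp Require Export all_classical all_reals all_analysis.
From mathcomp Require Export complex.

Set Implicit Arguments.
Unset Strict Implicit.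
Unset Printing Implicit Defensive.

Import Order.TTheory GRing.Theory Num.Theory.
Local Open Scope classical_set_scope.
Local Open Scope ring_scope.

Definition upper_half_plane (R : realType) : set R[i] :=
  [set z | 0 < complex.Im z].

(* The norm `|z| on R[i] takes values in R[i] itself; Normc.normc z : R is the
   modulus as an element of R. The terms are nonnegative, so esum is the
   unconditional sum over Z^2. It is finite for s > 0 and z in the upper
   half-plane, hence fine loses nothing there. *)
Definition theta (R : realType) (s : R) (z : R[i]) : R :=
  fine (\esum_(p in [set: int * int])
    (expR (- (pi * s / complex.Im z) *
             Normc.normc (p.1%:~R * z + p.2%:~R) ^+ 2))%:E).

Definition expi (R : realType) (t : R) : R[i] := Complex (cos t) (sin t).

Definition is_minimizer (R : realType) (T : Type) (D : set T) (f : T -> R)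
    (x0 : T) : Prop :=
  D x0 /\ forall x, D x -> f x0 <= f x.

(* Main.v *)
Require Import Defs.
From mathcomp Require Import finmap.
From mathcomp Require Import ring lra zify.

(** The theorem is a statement about the normalised theta function
    F(s; z) = sqrt s * theta(s; z). Put z = x + i y and let h = e^(i pi/3) be
    the hexagonal point.

    Poisson summation in one variable rewrites F as
    sqrt y * sum_(m, k) e^(- pi y (s m^2 + k^2 / s)) cos (2 pi m k x), and this
    dual form shows that F(1/s; z) = F(s; z) ([ntheta_inv]). As
    sqrt lambda * (theta(lambda) - b theta(beta lambda)) is
    F(lambda) - c F(beta lambda) with c = b / sqrt beta, only the function
    s |-> F(s; z) on [1, oo[ matters.

    Everything rests on one inequality ([slope_min]): for s >= 1 the slope
    f(s; z) = - s dF/ds is smallest at h, for z in the half fundamental domain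
    0 <= x <= 1/2, |z| >= 1. Hence the gap F(s; z) - F(s; h) is nonincreasing
    on [1, oo[. It tends to 0 at infinity, so it is nonnegative
    ([hexgap_anti], [hexgap_ge0]). With 1 <= 1/lambda <= 1/(beta lambda) the
    gap D satisfies D(1/lambda) >= D(1/(beta lambda)) >= 0, so
    D(lambda) - c D(beta lambda) >= 0 as soon as c <= 1: h is a minimiser
    ([comb_min]). Every point of the half plane has the same theta values as a
    point of the half fundamental domain ([reduce]). If c > 1, the dual form
    on the imaginary axis gives
    F(lambda; iy) - c F(beta lambda; iy) <= sqrt y * (1 + o(1) - c), which
    tends to - oo ([comb_unbounded]): there is no minimum.

    The slope inequality is proved in two ranges of s.

    For s >= 19/10, f = sqrt s * sum Psi (pi s |m z + n|^2 / y) with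
    Psi t = (t - 1/2) e^(-t), and f(s; h) is dominated by its seven smallest
    terms. If y <= 9/8 the terms are compared orbit by orbit under the
    rotation of order 3 of the hexagonal lattice: on each orbit the values of
    the form, divided by the hexagonal value, satisfy
    sum (x_i - 1)(x_i - 2) >= 0, and Psi (a x) lies above the parabola
    Psi a + a (a - 3/2) e^(-a) (x - 1)(x - 2) ([slope_near]). If y >= 9/8, the
    two terms (0, 1) and (0, -1) alone beat the hexagonal value
    ([slope_far]), unless pi y >= 4 s, where the dual form shows that f is
    almost nonnegative while f(s; h) is not ([slope_dualfar]).

    For 1 <= s <= 19/10, the dual form gives, with a = pi y / s and z = s^2,
    that f is proportional to
    a^(3/2) sum (m^2 z - k^2) cos (2 pi m k x) e^(- a (m^2 z + k^2)). For
    pi y >= 67/25 it is smallest at x = 1/2 ([slope_horiz]): the terms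
    (+-1, +-1) outweigh the others once (m, k) and (k, m) are paired, because
    each pair carries a factor z - 1. On the line x = 1/2 the sign of the
    derivative in y is that of a function of a which is nondecreasing
    ([vsign_mono]), so f decreases and then increases. The inversion
    z |-> 1 / conj z maps 1/2 + i y to a point of height y / (1/4 + y^2), and
    with [slope_horiz] this forces f to be nondecreasing above h
    ([slope_half_min]). *)

Set Implicit Arguments.
Unset Strict Implicit.
Unset Printing Implicit Defensive.

Import Order.TTheory GRing.Theory Num.Theory.
Import numFieldNormedType.Exports.

Local Open Scope classical_set_scope.
Local Open Scope ring_scope.

(** * Unconditional sums *)

Definition nsum (R : realType) (I : choiceType) (g : I -> R) : R :=
  fine (\esum_(i in [set: I]) (g i)%:E).

(** Sums are taken with respect to all finite sets of indices, so that
    reindexing and exchange of summations need no convergence bookkeeping. *)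
Definition asummable (R : realType) (I : choiceType) (u : I -> R) : Prop :=
  exists B, forall s : seq I, uniq s -> \sum_(i <- s) `|u i| <= B.

(** Both series have nonnegative terms, hence are values of the library sum
    over a set. *)
Definition asum (R : realType) (I : choiceType) (u : I -> R) : R :=
  nsum (fun i => `|u i| + u i) - nsum (fun i => `|u i|).

Lemma esum_le_seq (R : realType) (I : choiceType) (g : I -> R) (B : R) :
  (forall s : seq I, uniq s -> \sum_(i <- s) g i <= B) ->
  (\esum_(i in [set: I]) (g i)%:E <= B%:E)%E.
Proof.
move=> H; apply: ge_ereal_sup => _ /= [X [finX _] <-].
by rewrite fsbig_finite// sumEFin lee_fin; apply: H.
Qed.

Lemma seq_le_esum (R : realType) (I : choiceType) (g : I -> R) (s : seq I) :
  uniq s ->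
  ((\sum_(i <- s) g i)%:E <= \esum_(i in [set: I]) (g i)%:E)%E.
Proof.
move=> us; apply: esum_ge; exists [set` s]; first by split.
by rewrite -fsbig_seq// sumEFin.
Qed.

Section nsum.
Variables (R : realType) (I : choiceType).
Implicit Types g u v : I -> R.

Lemma fineK_esum g : (forall i, 0 <= g i) -> asummable g ->
  (\esum_(i in [set: I]) (g i)%:E = (nsum g)%:E)%E.
Proof.
move=> g0 [B HB]; rewrite fineK// fin_numElt; apply/andP; split.
  by rewrite (lt_le_trans (ltNyr 0))//; apply: esum_ge0 => i _; rewrite lee_fin.
apply: le_lt_trans (ltry B); apply: esum_le_seq => s us.
by apply: le_trans (HB s us); apply: ler_sum => i _; rewrite ler_norm.
Qed.

Lemma nsum_ge_seq g s : (forall i, 0 <= g i) -> asummable g -> uniq s ->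
  \sum_(i <- s) g i <= nsum g.
Proof. by move=> g0 sg us; rewrite -lee_fin -fineK_esum//; exact: seq_le_esum. Qed.

Lemma nsum_le g B : (forall i, 0 <= g i) -> asummable g ->
  (forall s : seq I, uniq s -> \sum_(i <- s) g i <= B) -> nsum g <= B.
Proof. by move=> g0 sg H; rewrite -lee_fin -fineK_esum//; exact: esum_le_seq. Qed.

Lemma nsum_ge0 g : (forall i, 0 <= g i) -> 0 <= nsum g.
Proof. by move=> g0; apply: fine_ge0; apply: esum_ge0 => i _; rewrite lee_fin. Qed.

Lemma asummable_le u v : (forall i, `|u i| <= v i) -> asummable v -> asummable u.
Proof.
move=> H [B HB]; exists B => s us; apply: le_trans (HB s us).
by apply: ler_sum => i _; apply: le_trans (H i) (ler_norm _).
Qed.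

Lemma asummable_norm u : asummable u -> asummable (fun i => `|u i|).
Proof. by move=> [B HB]; exists B => s us; under eq_bigr do rewrite normr_id; exact: HB. Qed.

Lemma asummableD u v : asummable u -> asummable v -> asummable (fun i => u i + v i).
Proof.
move=> [B HB] [C HC]; exists (B + C) => s us.
apply: le_trans (lerD (HB s us) (HC s us)); rewrite -big_split/=.
by apply: ler_sum => i _; exact: ler_normD.
Qed.

Lemma asummableZ c u : asummable u -> asummable (fun i => c * u i).
Proof.
move=> [B HB]; exists (`|c| * B) => s us.
under eq_bigr do rewrite normrM.
by rewrite -mulr_sumr ler_wpM2l// HB.
Qed.

Lemma asummableN u : asummable u -> asummable (fun i => - u i).
Proof. by move=> [B HB]; exists B => s us; under eq_bigr do rewrite normrN; exact: HB. Qed.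

Lemma asummableB u v : asummable u -> asummable v -> asummable (fun i => u i - v i).
Proof. by move=> su sv; apply: asummableD => //; exact: asummableN. Qed.

Lemma nsumD u v : (forall i, 0 <= u i) -> (forall i, 0 <= v i) ->
  asummable u -> asummable v -> nsum (fun i => u i + v i) = nsum u + nsum v.
Proof.
move=> u0 v0 su sv; apply: EFin_inj; rewrite EFinD -!fineK_esum//.
- by rewrite -esumD// => i _; rewrite lee_fin.
- by move=> i; rewrite addr_ge0.
- exact: asummableD.
Qed.

Lemma eq_nsum u v : u =1 v -> nsum u = nsum v.
Proof. by move=> /funext ->. Qed.

(** The value does not depend on the majorant used to make the terms
    nonnegative. *)
Lemma asumE u g : (forall i, `|u i| <= g i) -> asummable g ->
  asum u = nsum (fun i => g i + u i) - nsum g.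
Proof.
move=> ug sg.
have su : asummable u by apply: asummable_le sg.
have g0 i : 0 <= g i by exact: le_trans (ug i).
have p0 i : 0 <= `|u i| + u i.
  by have := ler_norm (- u i); rewrite normrN; lra.
have q0 i : 0 <= g i + u i.
  by have := ug i; have := ler_norm (- u i); rewrite normrN; lra.
rewrite /asum.
have : nsum (fun i => `|u i| + u i) + nsum g
    = nsum (fun i => g i + u i) + nsum (fun i => `|u i|).
  rewrite -!nsumD//; try exact: asummable_norm.
  - by apply: eq_nsum => i; ring.
  - exact: asummableD.
  - by apply: asummableD => //; exact: asummable_norm.
by move=> E; lra.
Qed.

Lemma asum_nsum u : (forall i, 0 <= u i) -> asummable u -> asum u = nsum u.
Proof.
move=> u0 su; rewrite /asum.
have -> : (fun i => `|u i| + u i) = (fun i => u i + u i).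
  by apply/funext => i; rewrite ger0_norm.
have -> : (fun i => `|u i|) = u by apply/funext => i; rewrite ger0_norm.
by rewrite nsumD//; lra.
Qed.

Lemma eq_asum u v : u =1 v -> asum u = asum v.
Proof. by move=> /funext ->. Qed.

Lemma asumD u v : asummable u -> asummable v ->
  asum (fun i => u i + v i) = asum u + asum v.
Proof.
move=> su sv.
have sa := asummable_norm su; have sb := asummable_norm sv.
rewrite (@asumE _ (fun i => `|u i| + `|v i|)); last 2 first.
- by move=> i; exact: ler_normD.
- exact: asummableD.
have -> : nsum (fun i => `|u i| + `|v i| + (u i + v i)) =
   nsum (fun i => `|u i| + u i) + nsum (fun i => `|v i| + v i).
  rewrite -nsumD; [|move=> i|move=> i|exact: asummableD|exact: asummableD].
  - by apply: eq_nsum => i; ring.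
  - by have := ler_norm (- u i); rewrite normrN; lra.
  - by have := ler_norm (- v i); rewrite normrN; lra.
by rewrite [X in _ - X]nsumD// /asum; ring.
Qed.

Lemma asum0 : asum (fun _ : I => 0 : R) = 0.
Proof.
rewrite /asum (_ : (fun=> `|0 : R| + 0) = (fun=> `|0 : R|)) ?subrr//.
by apply/funext => i; rewrite addr0.
Qed.

Lemma asumN u : asummable u -> asum (fun i => - u i) = - asum u.
Proof.
move=> su; have : asum (fun i => u i + - u i) = asum u + asum (fun i => - u i).
  by apply: asumD => //; exact: asummableN.
rewrite (@eq_asum _ (fun _ : I => 0)) ?asum0 => [|i]; last by rewrite subrr.
by move=> E; lra.
Qed.

Lemma asumB u v : asummable u -> asummable v ->
  asum (fun i => u i - v i) = asum u - asum v.
Proof. by move=> su sv; rewrite asumD ?asumN//; exact: asummableN. Qed.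

Lemma asum_ge0 u : asummable u -> (forall i, 0 <= u i) -> 0 <= asum u.
Proof. by move=> su u0; rewrite asum_nsum// nsum_ge0. Qed.

Lemma ler_asum u v : asummable u -> asummable v -> (forall i, u i <= v i) ->
  asum u <= asum v.
Proof.
move=> su sv uv; rewrite -subr_ge0 -asumB//; apply: asum_ge0 => [|i].
  exact: asummableB.
by rewrite subr_ge0.
Qed.

Lemma asum_norm u v : asummable v -> (forall i, `|u i| <= v i) -> `|asum u| <= asum v.
Proof.
move=> sv uv; have su : asummable u by exact: asummable_le sv.
have svN := asummableN sv.
rewrite ler_norml -asumN//; apply/andP; split; apply: ler_asum => // i.
- by have := uv i; rewrite ler_norml => /andP[].
- by have := uv i; rewrite ler_norml => /andP[].
Qed.

Lemma nsumZ c u : 0 < c -> (forall i, 0 <= u i) -> asummable u ->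
  nsum (fun i => c * u i) = c * nsum u.
Proof.
move=> c0 u0 su; have scu := asummableZ c su.
have cu0 i : 0 <= c * u i by rewrite mulr_ge0// ltW.
apply/eqP; rewrite eq_le; apply/andP; split.
  apply: nsum_le => // s us; rewrite -mulr_sumr ler_pM2l//.
  exact: nsum_ge_seq.
rewrite -ler_pdivlMl//; apply: nsum_le => // s us.
rewrite ler_pdivlMl// mulr_sumr.
exact: (@nsum_ge_seq (fun i => c * u i)).
Qed.

Lemma asumZ c u : asummable u -> asum (fun i => c * u i) = c * asum u.
Proof.
have pos d v : 0 < d -> asummable v -> asum (fun i => d * v i) = d * asum v.
  move=> d0 sv; rewrite /asum mulrBr -!nsumZ//.
  - congr (_ - _); apply: eq_nsum => i; rewrite normrM (gtr0_norm d0); ring.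
  - exact: asummable_norm.
  - by move=> i; have := ler_norm (- v i); rewrite normrN; lra.
  - by apply: asummableD => //; exact: asummable_norm.
move=> su; have [c0|c0|<-] := ltgtP 0 c.
- exact: pos.
- rewrite (@eq_asum _ (fun i => - (- c * u i))); last by move=> i; rewrite mulNr opprK.
  rewrite asumN; last exact: asummableZ.
  by rewrite pos ?oppr_gt0//; ring.
- by rewrite (@eq_asum _ (fun _ : I => 0)) ?asum0 ?mul0r// => i; rewrite mul0r.
Qed.

Lemma asummable_fin u (s : seq I) : (forall i, i \notin s -> u i = 0) -> asummable u.
Proof.
move=> H; exists (\sum_(i <- undup s) `|u i|) => t ut.
rewrite (bigID (mem s))/= [X in _ + X]big1 ?addr0; last first.
  by move=> i /H ->; rewrite normr0.
rewrite -big_filter.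
have -> : \sum_(i <- undup s) `|u i| = \sum_(i <- undup s | i \in t) `|u i| + \sum_(i <- undup s | i \notin t) `|u i|.
  by rewrite (bigID (mem t)).
rewrite -(big_filter (undup s) (mem t)).
rewrite (perm_big (seq.filter (mem t) (undup s))); last first.
  apply: uniq_perm; rewrite ?filter_uniq ?undup_uniq// => i.
  by rewrite !mem_filter mem_undup andbC.
by rewrite lerDl sumr_ge0.
Qed.

Lemma nsum_fin u (s : seq I) : (forall i, 0 <= u i) -> uniq s ->
  (forall i, i \notin s -> u i = 0) -> nsum u = \sum_(i <- s) u i.
Proof.
move=> u0 us H; have su := asummable_fin H.
apply/eqP; rewrite eq_le; apply/andP; split; last exact: nsum_ge_seq.
apply: nsum_le => // t ut.
rewrite (bigID (mem s))/= [X in _ + X]big1 ?addr0; last by move=> i /H ->.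
rewrite [leRHS](bigID (mem t))/=.
rewrite -big_filter -[X in _ <= X + _]big_filter.
rewrite (perm_big (seq.filter (mem t) s)) ?lerDl ?sumr_ge0//.
apply: uniq_perm; rewrite ?filter_uniq// => i.
by rewrite !mem_filter andbC.
Qed.

Lemma asum_fin u (s : seq I) : uniq s ->
  (forall i, i \notin s -> u i = 0) -> asum u = \sum_(i <- s) u i.
Proof.
move=> us H; rewrite /asum (@nsum_fin _ s)//.
- rewrite (@nsum_fin _ s)//; first by rewrite big_split/=; ring.
  by move=> i /H ->; rewrite normr0.
- by move=> i; have := ler_norm (- u i); rewrite normrN; lra.
- by move=> i /H ->; rewrite normr0 addr0.
Qed.

Lemma asum_split u (s : seq I) : asummable u -> uniq s ->
  asum u = \sum_(i <- s) u i + asum (fun i => if i \in s then 0 else u i).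
Proof.
move=> su us.
have s1 : asummable (fun i => if i \in s then u i else 0).
  by apply: (@asummable_fin _ s) => i /negPf ->.
have s2 : asummable (fun i => if i \in s then 0 else u i).
  by apply: asummable_le (asummable_norm su) => i; case: ifP => // _; rewrite normr0.
rewrite (@eq_asum _ (fun i => (if i \in s then u i else 0) + (if i \in s then 0 else u i))).
  rewrite asumD//; congr (_ + _); rewrite (@asum_fin _ s)//.
    by rewrite !big_seq; apply: eq_bigr => i ->.
  by move=> i /negPf ->.
by move=> i; case: ifP; rewrite ?addr0 ?add0r.
Qed.

Lemma asum_ge_seq u s : (forall i, 0 <= u i) -> asummable u -> uniq s ->
  \sum_(i <- s) u i <= asum u.
Proof. by move=> u0 su us; rewrite asum_nsum// nsum_ge_seq. Qed.

Lemma asum_tail g e : (forall i, 0 <= g i) -> asummable g -> 0 < e ->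
  exists2 s : seq I, uniq s & asum (fun i => if i \in s then 0 else g i) < e.
Proof.
move=> g0 sg e0; apply: contrapT => H.
have HB : nsum g <= nsum g - e.
  apply: nsum_le => // s us.
  rewrite lerBrDr -asum_nsum// (asum_split sg us) lerD2l leNgt.
  by apply/negP => K; apply: H; exists s.
by lra.
Qed.

(** Tannery: away from a finite set the majorant has a small sum, and on that
    finite set the limit is taken term by term. *)
Lemma cvg_asum (T : Type) (F : set_system T) {FF : ProperFilter F}
    (u : T -> I -> R) (v g : I -> R) :
  asummable g -> (\forall t \near F, forall i, `|u t i| <= g i) ->
  (forall i, u t i @[t --> F] --> v i) ->
  asum (u t) @[t --> F] --> asum v.
Proof.
move=> sg ug uv.
have g0 i : 0 <= g i.
  by have [t /(_ i)] := filter_ex ug; exact: le_trans.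
have vg i : `|v i| <= g i.
  rewrite leNgt; apply/negP => gv.
  have e0 : 0 < `|v i| - g i by rewrite subr_gt0.
  have /cvgrPdist_lt /(_ _ e0) H := uv i.
  have [t [/= Ht /(_ i) Ht2]] := filter_ex (filterI H ug).
  have := lerB_dist (v i) (u t i); move: Ht Ht2; lra.
have sv : asummable v by exact: asummable_le sg.
apply/cvgrPdist_le => e e0.
have e4 : 0 < e / 4 by lra.
have [s us Hs] := asum_tail g0 sg e4.
have gs0 i : 0 <= (if i \in s then 0 else g i) by case: ifP.
have sgs : asummable (fun i => if i \in s then 0 else g i).
  by apply: asummable_le sg => i; rewrite ger0_norm//; case: ifP.
have small (w : I -> R) : (forall i, `|w i| <= g i) ->
    `|asum (fun i => if i \in s then 0 else w i)| <= e / 4.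
  move=> wg; apply: le_trans (ltW Hs); apply: asum_norm => // i.
  by case: ifP => // _; rewrite normr0.
have : \sum_(i <- s) u t i @[t --> F] --> \sum_(i <- s) v i.
  elim: s {us Hs gs0 sgs small} => [|i s IHs].
    under eq_fun do rewrite big_nil; rewrite big_nil; exact: cvg_cst.
  under eq_fun do rewrite big_cons; rewrite big_cons; apply: cvgD => //; exact: uv.
move=> /cvgrPdist_le /(_ (e / 2)) Hsum.
have e2 : 0 < e / 2 by lra.
move: Hsum => /(_ e2) Hsum.
near=> t.
have ut : forall i, `|u t i| <= g i by near: t.
have sut : asummable (u t) by exact: asummable_le sg.
rewrite (asum_split sv us) (asum_split sut us).
have h1 : `|\sum_(i <- s) v i - \sum_(i <- s) u t i| <= e / 2 by near: t.
have h2 := small _ vg; have h3 := small _ ut.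
set A := asum (fun i => if i \in s then 0 else v i) in h2 *.
set B := asum _ in h3 *.
rewrite (_ : _ - _ = (\sum_(i <- s) v i - \sum_(i <- s) u t i) + (A - B)); last by ring.
apply: le_trans (ler_normD _ _) _.
have := ler_normB A B; lra.
Unshelve. all: by end_near. Qed.

End nsum.

Lemma reindex_asummable (R : realType) (I J : choiceType) (e : I -> J) (u : J -> R) :
  injective e -> asummable u -> asummable (fun i => u (e i)).
Proof.
move=> ei [B HB]; exists B => s us.
by rewrite -(big_map e xpredT (fun j => `|u j|)); apply: HB; rewrite map_inj_uniq.
Qed.

Lemma reindex_asum (R : realType) (I J : choiceType) (e : I -> J) (u : J -> R) :
  bijective e -> asum u = asum (fun i => u (e i)).
Proof.
move=> be; have se : set_bij [set: I] [set: J] e.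
  by rewrite setTT_bijective.
by rewrite /asum /nsum; congr (fine _ - fine _); exact: (reindex_esum _ _ se).
Qed.

(** * Sums over products *)

Section fubini.
Variables (R : realType) (I J : choiceType).

Lemma asummable_prod (u : I * J -> R) (v : I -> R) :
  (forall i, asummable (fun j => u (i, j))) ->
  (forall i, asum (fun j => `|u (i, j)|) <= v i) -> asummable v -> asummable u.
Proof.
move=> su uv sv.
exists (asum v) => s us.
have su2 i : asummable (fun j => `|u (i, j)|) by exact: asummable_norm.
have v0 i : 0 <= v i by apply: le_trans (uv i); exact: asum_ge0.
apply: (@le_trans _ _ (\sum_(i <- undup (map fst s)) asum (fun j => `|u (i, j)|))).
  apply: (@le_trans _ _ (\sum_(i <- undup (map fst s)) \sum_(j <- undup (map snd s)) `|u (i, j)|)).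
    rewrite -(big_allpairs_dep (F := fun p => `|u p|) (r2 := fun=> undup (map snd s))) /=.
    rewrite [leRHS](bigID (mem s))/= -[X in _ <= X + _]big_filter.
    rewrite (perm_big (seq.filter (mem s) [seq (i, j) | i <- undup (map fst s), j <- undup (map snd s)])) ?lerDl ?sumr_ge0//.
    apply: uniq_perm => //.
      rewrite filter_uniq// allpairs_uniq ?undup_uniq// => -[a b] [c d] _ _ /= [-> ->] //.
    move=> [i j]; rewrite mem_filter.
    apply/idP/idP; last by case/andP.
    move=> ijs; apply/andP; split => //.
    apply/allpairsP; exists (i, j); split => //=; rewrite mem_undup; apply/mapP; by exists (i, j).
  by apply: ler_sum => i _; apply: asum_ge_seq => //; exact: undup_uniq.
apply: (@le_trans _ _ (\sum_(i <- undup (map fst s)) v i)); first exact: ler_sum.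
by apply: asum_ge_seq => //; exact: undup_uniq.
Qed.

Lemma asummable_prod2 (u : I -> R) (v : J -> R) :
  asummable u -> asummable v -> asummable (fun p : I * J => u p.1 * v p.2).
Proof.
move=> su sv; apply: (@asummable_prod _ (fun i => `|u i| * asum (fun j => `|v j|))).
- by move=> i /=; exact: asummableZ.
- move=> i /=; under eq_asum do rewrite normrM.
  by rewrite asumZ//; exact: asummable_norm.
- apply: asummable_le (asummableZ (asum (fun j => `|v j|)) (asummable_norm su)) => i.
  rewrite normrM normr_id mulrC ger0_norm//; apply: asum_ge0 => //.
  exact: asummable_norm.
Qed.

Lemma asummable_row (u : I * J -> R) i : asummable u -> asummable (fun j => u (i, j)).
Proof. by apply: reindex_asummable => a b []. Qed.

(** Obtained from the Fubini theorem for sums of nonnegative extended reals.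
    *)
Lemma nsum_fubini (u : I * J -> R) : (forall p, 0 <= u p) -> asummable u ->
  nsum u = nsum (fun i => nsum (fun j => u (i, j))) /\
  asummable (fun i => nsum (fun j => u (i, j))).
Proof.
move=> u0 su.
have E : (\esum_(i in [set: I]) (nsum (fun j => u (i, j)))%:E =
    \esum_(p in [set: I * J]) (u p)%:E)%E.
  have -> : [set: I * J] = [set: I] `*`` (fun=> [set: J]) by apply/seteqP; split.
  rewrite (@eq_esum _ _ _ (fun p => (u p)%:E) (fun p => (u (p.1, p.2))%:E)); last by move=> [].
  rewrite -(@esum_esum _ _ _ [set: I] (fun=> [set: J]) (fun i j => (u (i, j))%:E)).
    apply: eq_esum => i _; rewrite fineK_esum//; exact: asummable_row.
  by move=> i j _ _; rewrite lee_fin.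
split; first by rewrite /nsum E.
exists (nsum u) => s us.
rewrite -lee_fin -fineK_esum// -E.
under eq_bigr do rewrite ger0_norm ?nsum_ge0//.
exact: seq_le_esum.
Qed.

Lemma asum_fubini (u : I * J -> R) : asummable u ->
  asum u = asum (fun i => asum (fun j => u (i, j))).
Proof.
move=> su.
have p0 p : 0 <= `|u p| + u p by have := ler_norm (- u p); rewrite normrN; lra.
have sn := asummable_norm su.
have [E1 S1] := nsum_fubini p0 (asummableD sn su).
have [E2 S2] := nsum_fubini (fun p => normr_ge0 (u p)) sn.
rewrite {1}/asum E1 E2 -!asum_nsum//; last 2 first.
- by move=> i; apply: nsum_ge0.
- by move=> i; apply: nsum_ge0.
by rewrite -asumB.
Qed.
End fubini.

(** * Mean value inequalities and differentiation under the sum *)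

Section deriv.
Variable R : realType.

Lemma is_derive_continuous (f : R -> R) (x d : R) : is_derive x 1 f d -> {for x, continuous f}.
Proof.
by move=> H; apply: differentiable_continuous; apply/derivable1_diffP; case: H.
Qed.

Lemma is_derive_within (f df : R -> R) (l r : R) :
  (forall x, l <= x <= r -> is_derive x 1 f (df x)) -> {within `[l, r], continuous f}.
Proof.
move=> H; apply: continuous_in_subspaceT => x /set_mem; rewrite /= in_itv/= => lxr.
exact: is_derive_continuous (H x lxr).
Qed.

Lemma mvt (f df : R -> R) (a b : R) : a <= b ->
  (forall x, a <= x <= b -> is_derive x 1 f (df x)) ->
  exists2 c, a <= c <= b & f b - f a = df c * (b - a).
Proof.
move=> ab H.
have H' x : x \in `]a, b[%R -> is_derive x 1 f (df x).
  by rewrite in_itv/= => /andP[ax xb]; apply: H; rewrite !ltW.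
have [c] := MVT_segment ab H' (is_derive_within H).
by rewrite in_itv/= => ??; exists c.
Qed.

Lemma derive_ge0_le (f df : R -> R) (a b : R) : a <= b ->
  (forall x, a <= x <= b -> is_derive x 1 f (df x)) ->
  (forall x, a <= x <= b -> 0 <= df x) -> f a <= f b.
Proof.
move=> ab H d0; have [c cab E] := mvt ab H.
by rewrite -subr_ge0 E mulr_ge0 ?subr_ge0// d0.
Qed.

Lemma derive_gt0_lt (f df : R -> R) (a b : R) : a < b ->
  (forall x, a <= x <= b -> is_derive x 1 f (df x)) ->
  (forall x, a <= x <= b -> 0 < df x) -> f a < f b.
Proof.
move=> ab H d0; have [c cab E] := mvt (ltW ab) H.
by rewrite -subr_gt0 E mulr_gt0 ?subr_gt0// d0.
Qed.

Lemma derive_bound (f df : R -> R) (a b G : R) : 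
  (forall x, a <= x <= b -> is_derive x 1 f (df x)) ->
  (forall x, a <= x <= b -> `|df x| <= G) -> 
  forall x y, a <= x <= b -> a <= y <= b -> `|f y - f x| <= G * `|y - x|.
Proof.
move=> H d0 x y; wlog xy : x y / x <= y.
  move=> W hx hy; have [xy|/ltW yx] := leP x y; first exact: W.
  by rewrite distrC (distrC y); exact: W.
move=> /andP[ax xb] /andP[ay yb].
have H' z : x <= z <= y -> is_derive z 1 f (df z).
  by move=> /andP[xz zy]; apply: H; rewrite (le_trans ax xz) (le_trans zy yb).
have [c /andP[xc cy] ->] := mvt xy H'.
by rewrite normrM ler_wpM2r// d0// (le_trans ax xc) (le_trans cy yb).
Qed.

(** By the mean value inequality the majorant of the derivatives bounds the
    difference quotients, so dominated convergence applies. *)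
Lemma is_derive_asum (I : choiceType) (u v : R -> I -> R) (g : I -> R) (x0 l r : R) :
  l < x0 < r -> asummable g ->
  (forall x, l <= x <= r -> asummable (u x)) ->
  (forall x i, l <= x <= r -> is_derive x 1 (u ^~ i) (v x i)) ->
  (forall x i, l <= x <= r -> `|v x i| <= g i) ->
  is_derive x0 1 (fun x => asum (u x)) (asum (v x0)).
Proof.
move=> /andP[lx xr] sg su du vg.
have x0lr : l <= x0 <= r by rewrite !ltW.
have near_lr : \forall h \near (0 : R)^', l <= h + x0 <= r.
  exists (Num.min (x0 - l) (r - x0)) => /=; first by rewrite lt_min !subr_gt0 lx.
  move=> h /=; rewrite sub0r normrN lt_min ltr_norml => /andP[/andP[h1 h2]].
  rewrite ltr_norml => /andP[h3 h4] _; lra.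
suff C : h^-1 *: (asum (u (h *: 1 + x0)) - asum (u x0)) @[h --> 0^'] --> asum (v x0).
  apply: DeriveDef; first by apply/cvg_ex; exists (asum (v x0)).
  exact: cvg_lim C.
have C : asum (fun i => h^-1 *: (u (h *: 1 + x0) i - u x0 i)) @[h --> 0^'] --> asum (v x0).
  apply: (cvg_asum sg) => [|i].
    near=> h => i.
    have h0 : h != 0 by near: h; exact: nbhs_dnbhs_neq.
    have hl : l <= h + x0 <= r by near: h.
    rewrite -[h *: 1]/(h * 1) mulr1 normrZ normfV ler_pdivrMl ?normr_gt0//.
    rewrite mulrC; have := @derive_bound (u ^~ i) (v ^~ i) l r (g i) (fun x => du x i) (fun x => vg x i) x0 (h + x0) x0lr hl.
    by rewrite addrK.
  by have [D <-] := du x0 i x0lr; exact: D.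
apply: cvg_trans C; apply: near_eq_cvg; near=> h.
have hl : l <= h + x0 <= r by near: h.
have -> : h *: 1 + x0 = h + x0 :> R by rewrite -[h *: 1]/(h * 1) mulr1.
rewrite asumZ; last by apply: asummableB; exact: su.
by rewrite asumB//; exact: su.
Unshelve. all: by end_near. Qed.
End deriv.

(** * A derivative calculus on explicit expressions *)

Section dcalc.
Variable R : realType.
Implicit Types (f g : R -> R) (x a b : R).

(** The lemmas below are stated for functions written as explicit
    abstractions, so that the tactic can recurse on the syntax of the
    function; [deq] leaves the comparison of the computed derivative with the
    wanted one. *)
Lemma deq f x a b : is_derive x 1 f a -> a = b -> is_derive x 1 f b.
Proof. by move=> H <-. Qed.
Lemma dcst (c x : R) : is_derive x 1 (fun=> c) 0.
Proof. exact: is_derive_cst. Qed.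
Lemma did (x : R) : is_derive x 1 (fun t => t) 1.
Proof. exact: is_derive_id. Qed.
Lemma dadd f g x a b : is_derive x 1 f a -> is_derive x 1 g b ->
  is_derive x 1 (fun t => f t + g t) (a + b).
Proof. by move=> ??; exact: is_deriveD. Qed.
Lemma dopp f x a : is_derive x 1 f a -> is_derive x 1 (fun t => - f t) (- a).
Proof. by move=> ?; exact: is_deriveN. Qed.
Lemma dmul f g x a b : is_derive x 1 f a -> is_derive x 1 g b ->
  is_derive x 1 (fun t => f t * g t) (a * g x + f x * b).
Proof.
move=> H1 H2; have := is_deriveM H1 H2.
rewrite (_ : f x *: b + g x *: a = a * g x + f x * b)//.
by rewrite addrC; congr (_ + _); rewrite mulrC.
Qed.
Lemma dcomp f g x a b : is_derive x 1 f a -> is_derive (f x) 1 g b ->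
  is_derive x 1 (fun t => g (f t)) (b * a).
Proof.
move=> H1 H2; exact: (is_derive1_comp H2 H1).
Qed.
Lemma dexp f x a : is_derive x 1 f a ->
  is_derive x 1 (fun t => expR (f t)) (expR (f x) * a).
Proof. by move=> H; apply: dcomp => //; exact: is_derive_expR. Qed.
Lemma dcos f x a : is_derive x 1 f a ->
  is_derive x 1 (fun t => cos (f t)) (- sin (f x) * a).
Proof. by move=> H; apply: dcomp => //; exact: is_derive_cos. Qed.
Lemma dsin f x a : is_derive x 1 f a ->
  is_derive x 1 (fun t => sin (f t)) (cos (f x) * a).
Proof. by move=> H; apply: dcomp => //; exact: is_derive_sin. Qed.
Lemma dexpn f x a n : is_derive x 1 f a ->
  is_derive x 1 (fun t => f t ^+ n) (n%:R * f x ^+ n.-1 * a).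
Proof.
move=> H; elim: n => [|n IH].
  by rewrite !mul0r; exact: dcst.
rewrite (_ : (fun t => _) = (fun t => f t * f t ^+ n)); last by apply/funext => t; rewrite exprS.
have := dmul H IH.
suff -> : a * f x ^+ n + f x * (n%:R * f x ^+ n.-1 * a) = n.+1%:R * f x ^+ n.+1.-1 * a by [].
case: n {IH} => [|n]; first by rewrite /= !expr0; ring.
rewrite /= exprS -(addn1 n.+1) natrD; ring.
Qed.
Lemma dinv f x a : f x != 0 -> is_derive x 1 f a ->
  is_derive x 1 (fun t => (f t)^-1) (- (f x) ^- 2 * a).
Proof. by move=> h H; exact: is_deriveV. Qed.
End dcalc.

Ltac dstep := first [notypeclasses refine (dcst _ _) | notypeclasses refine (did _)
  | notypeclasses refine (dexp _) | notypeclasses refine (dexpn _ _)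
  | notypeclasses refine (dcos _) | notypeclasses refine (dsin _)
  | notypeclasses refine (dinv _ _) | notypeclasses refine (dopp _)
  | notypeclasses refine (dadd _ _) | notypeclasses refine (dmul _ _)].
Ltac dsolve := notypeclasses refine (deq _ _); [repeat dstep |].

(** * Sums over the integers *)

Section intsums.
Variable R : realType.

Lemma ler_sum_subset (I : eqType) (f : I -> R) (s t : seq I) :
  (forall i, 0 <= f i) -> uniq s -> uniq t -> {subset s <= t} ->
  \sum_(i <- s) f i <= \sum_(i <- t) f i.
Proof.
move=> f0 us ut st; rewrite [leRHS](bigID (mem s))/= -[X in _ <= X + _]big_filter.
rewrite (perm_big (seq.filter (mem s) t)) ?lerDl ?sumr_ge0//.
apply: uniq_perm; rewrite ?filter_uniq// => i.
by rewrite mem_filter/=; case: (boolP (i \in s)) => //= /st ->.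
Qed.

Lemma geom_bound (r : R) (s : seq nat) : 0 <= r < 1 -> uniq s ->
  \sum_(i <- s) r ^+ i <= (1 - r)^-1.
Proof.
move=> /andP[r0 r1] us.
pose N := (\max_(i <- s) i).+1.
apply: (@le_trans _ _ (\sum_(i <- iota 0 N) r ^+ i)).
  apply: ler_sum_subset => // [i||i si]; rewrite ?exprn_ge0 ?iota_uniq//.
  by rewrite mem_iota add0n /N ltnS (big_rem i)//= leq_maxl.
have -> : \sum_(i <- iota 0 N) r ^+ i = (1 - r ^+ N) / (1 - r).
  apply: (mulIf (x := 1 - r)); first by rewrite subr_eq0 gt_eqF.
  rewrite mulfVK ?subr_eq0 ?gt_eqF//.
  elim: N => [|n IH]; first by rewrite big_nil mul0r expr0 subrr.
  rewrite -addn1 iotaD big_cat/= big_seq1 mulrDl IH add0n exprD expr1; ring.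
rewrite ler_pdivrMr ?subr_gt0// mulVf ?subr_eq0 ?gt_eqF//.
by rewrite gerBl exprn_ge0.
Qed.

Lemma asummable_geom (r : R) : 0 <= r < 1 -> asummable (fun n : nat => r ^+ n).
Proof.
move=> r01; exists (1 - r)^-1 => s us.
have r0 : 0 <= r by case/andP: r01.
by under eq_bigr do rewrite ger0_norm ?exprn_ge0//; exact: geom_bound.
Qed.

Lemma asum_geom_le (r : R) : 0 <= r < 1 -> asum (fun n : nat => r ^+ n) <= (1 - r)^-1.
Proof.
move=> r01; have r0 : 0 <= r by case/andP: r01.
rewrite asum_nsum => [|i|]; rewrite ?exprn_ge0//; last exact: asummable_geom.
apply: nsum_le => [i||s us]; rewrite ?exprn_ge0//; first exact: asummable_geom.
exact: geom_bound.
Qed.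

(** The integers as two copies of the natural numbers, to sum geometric series
    over them. *)
Definition intb (p : nat * bool) : int := if p.2 then Posz p.1 else Negz p.1.
Definition bint (i : int) : nat * bool :=
  match i with Posz n => (n, true) | Negz n => (n, false) end.

Lemma intb_bij : bijective intb.
Proof. by exists bint => [[n []]|[]]. Qed.

Lemma asummable_int (u : int -> R) :
  asummable (fun n : nat => u (Posz n)) -> asummable (fun n : nat => u (Negz n)) ->
  asummable u.
Proof.
move=> sp sn.
have sb (f : bool -> R) : asummable f.
  by apply: (@asummable_fin _ _ _ [:: true; false]) => -[].
suff : asummable (fun p => u (intb p)).
  move=> [B HB]; exists B => s us.
  have -> : s = map intb (map bint s).
    by rewrite -map_comp map_id_in// => -[].
  rewrite big_map; apply: HB; rewrite map_inj_uniq// => -[?|?] [?|?] []//.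
    by move=> ->.
  by move=> ->.
apply: (@asummable_prod _ _ _ _ (fun n => `|u (Posz n)| + `|u (Negz n)|)) => //.
- move=> n; rewrite (@asum_fin _ _ _ [:: true; false])//=; last by case.
  by rewrite big_cons big_seq1.
- by apply: asummableD; exact: asummable_norm.
Qed.

Lemma asum_int (u : int -> R) : asummable u ->
  asum u = asum (fun n : nat => u (Posz n) + u (Negz n)).
Proof.
move=> su; rewrite (reindex_asum _ intb_bij) asum_fubini.
  apply: eq_asum => n; rewrite (@asum_fin _ _ _ [:: true; false])//=; last by case.
  by rewrite big_cons big_seq1.
by apply: reindex_asummable su; exact: bij_inj intb_bij.
Qed.

Lemma asummable_geomz (r : R) : 0 <= r < 1 -> asummable (fun i : int => r ^+ `|i|%N).
Proof.
move=> r01; have /andP[r0 r1] := r01.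
apply: asummable_int => /=; first exact: asummable_geom.
apply: asummable_le (asummable_geom r01) => n.
by rewrite /= ger0_norm ?exprn_ge0// exprS ler_piMl ?exprn_ge0// ltW.
Qed.

Lemma asum_geomz_le (r : R) : 0 <= r < 1 ->
  asum (fun i : int => r ^+ `|i|%N) <= (1 + r) / (1 - r).
Proof.
move=> r01; have /andP[r0 r1] := r01.
rewrite asum_int; last exact: asummable_geomz.
rewrite (@eq_asum _ _ _ (fun n => (1 + r) * r ^+ n)); last first.
  by move=> n; rewrite /= exprS; ring.
rewrite asumZ; last exact: asummable_geom.
by rewrite ler_wpM2l ?asum_geom_le// addr_ge0.
Qed.

Lemma expRZ_lt1 (c : R) : 0 < c -> 0 <= expR (- c) < 1.
Proof. by move=> c0; rewrite expR_ge0 expR_lt1 oppr_lt0. Qed.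

Lemma normr_int_le_sqr (i : int) : (`|i|%N%:R : R) <= i%:~R ^+ 2.
Proof.
rewrite natr_absz -rmorphXn/= ler_int expr2.
by have [] := leP 0 i; nia.
Qed.
End intsums.

(** * The simple random walk and its central binomial asymptotics *)

Section walk.
Variable R : realType.

(** The probability that a walk of 2M fair steps ends at 2i. *)
Definition walk (M : nat) (i : int) : R :=
  'C(M.*2, M + `|i|%N)%:R / 4 ^+ M.

Lemma natr_dblS (n : nat) : (n.*2.+1)%:R = 2 * n%:R + 1 :> R.
Proof. by rewrite -muln2 -addn1 natrD natrM mulrC. Qed.

Lemma natr_dblSS (n : nat) : (n.*2.+2)%:R = 2 * n%:R + 2 :> R.
Proof. by rewrite -addn1 natrD natr_dblS; ring. Qed.

Lemma natrS (n : nat) : (n.+1)%:R = n%:R + 1 :> R.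
Proof. by rewrite -addn1 natrD. Qed.

Lemma walk0 i : walk 0 i = (i == 0)%:R.
Proof.
rewrite /walk add0n expr0 divr1 bin0n.
by case: i => [[|n]|n].
Qed.

Lemma pascal2 n k : ('C(n.+2, k.+2) = 'C(n, k.+2) + 2 * 'C(n, k.+1) + 'C(n, k))%N.
Proof. by rewrite !binS; lia. Qed.

Lemma walkS_nat M (n : nat) :
  'C(M.+1.*2, M.+1 + n.+1) = ('C(M.*2, M + n.+2) + 2 * 'C(M.*2, M + n.+1) + 'C(M.*2, M + n))%N.
Proof.
by rewrite doubleS (_ : M.+1 + n.+1 = (M + n).+2)%N ?pascal2 ?addnS// addSn.
Qed.

Lemma walkS_0 M : 'C(M.+1.*2, M.+1) = (2 * 'C(M.*2, M + 1) + 2 * 'C(M.*2, M))%N.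
Proof.
case: M => [|M]; first by [].
rewrite (doubleS M.+1) pascal2 addn1.
rewrite -(@bin_sub M.+1.*2 M); last by lia.
by rewrite (_ : (M.+1.*2 - M = M.+2)%N); lia.
Qed.

Lemma walkN M i : walk M (- i) = walk M i.
Proof. by rewrite /walk abszN. Qed.

(** Two more steps of the walk. *)
Lemma walkS M i : walk M.+1 i = (walk M (i - 1) + 2 * walk M i + walk M (i + 1)) / 4.
Proof.
have nz : 4 ^+ M != 0 :> R by rewrite expf_neq0// pnatr_eq0.
have pos (n : nat) : walk M.+1 (Posz n.+1) =
   (walk M (Posz n.+1 - 1) + 2 * walk M (Posz n.+1) + walk M (Posz n.+1 + 1)) / 4.
  rewrite (_ : Posz n.+1 - 1 = Posz n); last by lia.
  rewrite (_ : Posz n.+1 + 1 = Posz n.+2); last by lia.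
  rewrite /walk !absz_nat walkS_nat 2!natrD natrM exprS; field; exact: nz.
case: i => [[|n]|n].
- rewrite -[Posz 0]/(0 : int) !add0r walkN /walk !absz_nat /= !addn0 walkS_0 natrD 2!natrM exprS.
  by field; exact: nz.
- exact: pos.
- rewrite NegzE (_ : - Posz n.+1 - 1 = - (Posz n.+1 + 1)); last by lia.
  rewrite (_ : - Posz n.+1 + 1 = - (Posz n.+1 - 1)); last by lia.
  by rewrite !walkN pos; ring.
Qed.

Lemma walk_out M (i : int) : (M < `|i|)%N -> walk M i = 0.
Proof. by move=> H; rewrite /walk bin_small ?mul0r//; lia. Qed.

Lemma walk_ge0 M i : 0 <= walk M i.
Proof. by rewrite /walk divr_ge0// exprn_ge0. Qed.

(** Ratio of consecutive binomial coefficients; it yields the Gaussian shape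
    of [walk] by multiplication. *)
Lemma walk_step M (n : nat) : (M + n.+1)%:R * walk M n.+1 = (M%:R - n%:R) * walk M n.
Proof.
rewrite /walk !absz_nat !mulrA; congr (_ / _).
have [nM|Mn] := leqP n M.
  rewrite -natrB// -!natrM; congr (_%:R).
  have := mul_bin_left M.*2 (M + n); rewrite addnS => ->.
  by congr (_ * _)%N; lia.
by rewrite !bin_small ?mulr0//; lia.
Qed.

(** Each ratio (M - n) / (M + n + 1) is at most e^(- (2 n + 1) / (M + K)), and
    the first n odd numbers add up to n^2. *)
Lemma walk_le M (n K : nat) : (n <= K)%N -> (n <= M)%N -> (K <= M)%N -> (0 < M)%N ->
  walk M n <= walk M 0 * expR (- (n%:R ^+ 2 / (M + K)%:R)).
Proof.
move=> nK nM KM M0; elim: n nK nM => [|n IH] nK nM.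
  by rewrite expr0n/= mul0r oppr0 expR0 mulr1.
have nK' := ltnW nK; have nM' := ltnW nM.
have p1 : 0 < (M + n.+1)%:R :> R by rewrite ltr0n; lia.
have p2 : 0 < (M + K)%:R :> R by rewrite ltr0n; lia.
have E : walk M n.+1 = (M%:R - n%:R) / (M + n.+1)%:R * walk M n.
  by rewrite mulrAC -walk_step mulrAC divff ?mul1r ?gt_eqF.
rewrite E.
have e1 : (M%:R - n%:R) / (M + n.+1)%:R <= expR (- ((n.*2.+1)%:R / (M + K)%:R)) :> R.
  apply: le_trans (expR_ge1Dx _).
  rewrite ler_pdivrMr// mulrDl mul1r mulNr mulrAC.
  have : (n.*2.+1)%:R * (M + n.+1)%:R / (M + K)%:R <= (n.*2.+1)%:R :> R.
    rewrite ler_pdivrMr// ler_wpM2l// ler_nat; lia.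
  rewrite natr_dblS natrD natrS; lra.
apply: le_trans (ler_pM _ (walk_ge0 _ _) e1 (IH nK' nM')) _.
  by rewrite divr_ge0 ?subr_ge0 ?ler_nat// ltW.
rewrite mulrCA -expRD ler_wpM2l ?walk_ge0// ler_expR -opprD lerN2.
rewrite -mulrDl ler_pM2r ?invr_gt0// natr_dblS natrS; lra.
Qed.

Lemma walk_ge M (n K : nat) : (n <= K)%N -> (K < M)%N ->
  walk M 0 * expR (- (n%:R ^+ 2 / (M - K)%:R)) <= walk M n.
Proof.
move=> nK KM; elim: n nK => [|n IH] nK.
  by rewrite expr0n/= mul0r oppr0 expR0 mulr1.
have nK' := ltnW nK.
have p1 : 0 < (M + n.+1)%:R :> R by rewrite ltr0n; lia.
have p2 : 0 < (M - K)%:R :> R by rewrite ltr0n; lia.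
have p3 : 0 < (M%:R - n%:R) :> R by rewrite subr_gt0 ltr_nat; lia.
have E : walk M n.+1 = (M%:R - n%:R) / (M + n.+1)%:R * walk M n.
  by rewrite mulrAC -walk_step mulrAC divff ?mul1r ?gt_eqF.
rewrite E.
have e1 : expR (- ((n.*2.+1)%:R / (M - K)%:R)) <= (M%:R - n%:R) / (M + n.+1)%:R :> R.
  rewrite expRN -[leRHS]invrK lef_pV2 ?posrE ?expR_gt0 ?invr_gt0 ?divr_gt0//.
  rewrite invf_div; apply: le_trans (expR_ge1Dx _).
  rewrite ler_pdivrMr// mulrDl mul1r mulrAC.
  have : (n.*2.+1)%:R <= (n.*2.+1)%:R * (M%:R - n%:R) / (M - K)%:R :> R.
    rewrite ler_pdivlMr// ler_wpM2l// -natrB; last by lia.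
    by rewrite ler_nat; lia.
  rewrite natr_dblS natrD natrS; lra.
apply: le_trans (ler_pM _ _ e1 (IH nK')); rewrite ?expR_ge0 ?mulr_ge0 ?walk_ge0 ?expR_ge0//.
rewrite mulrCA -expRD ler_wpM2l ?walk_ge0// ler_expR -opprD lerN2.
rewrite -mulrDl ler_pM2r ?invr_gt0// natr_dblS natrS; lra.
Qed.

Lemma walk_le2 M (i : int) : (0 < M)%N ->
  walk M i <= walk M 0 * expR (- (i%:~R ^+ 2 / (2 * M%:R))).
Proof.
move=> M0; have [iM|Mi] := leqP `|i|%N M; last first.
  by rewrite walk_out// mulr_ge0 ?walk_ge0 ?expR_ge0.
have E : (`|i|%N)%:R ^+ 2 = i%:~R ^+ 2 :> R.
  by rewrite natr_absz intr_norm real_normK// num_real.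
have := @walk_le M `|i|%N M iM iM (leqnn _) M0.
have -> : walk M `|i|%N = walk M i by rewrite /walk absz_nat.
by rewrite E addnn -mul2n natrM.
Qed.

Lemma walk00 M : walk M.+1 0 = walk M 0 * (M.*2.+1)%:R / (M.*2.+2)%:R.
Proof.
have := @walk_step M 0; rewrite subr0 => W.
have E : walk M 1 = M%:R / (M + 1)%:R * walk M 0.
  have p1 : (M + 1)%:R != 0 :> R by rewrite pnatr_eq0; lia.
  by rewrite mulrAC -W mulrAC divff ?mul1r.
rewrite walkS !add0r walkN E natr_dblS natr_dblSS natrD.
have h : 0 <= M%:R :> R by [].
field; rewrite !gt_eqF//=; lra.
Qed.

Lemma walk0_gt0 M : 0 < walk M 0.
Proof. by rewrite /walk addn0 divr_gt0 ?exprn_gt0// ltr0n bin_gt0; lia. Qed.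

Definition wl M : R := M%:R * walk M 0 ^+ 2.

(** M * walk M 0 ^ 2 is a bounded monotone sequence, so that walk M 0 is
    equivalent to A / sqrt M; its limit A is identified only at the end, by
    consistency of the Poisson formula. *)
Lemma wl_nd : nondecreasing_seq wl.
Proof.
apply/nondecreasing_seqP => M; rewrite /wl walk00.
set w := walk M 0; have h : 0 <= M%:R :> R by [].
have -> : M.+1%:R * (w * M.*2.+1%:R / M.*2.+2%:R) ^+ 2 =
   w ^+ 2 * ((2 * M%:R + 1) ^+ 2 / (4 * (M%:R + 1))) :> R.
  rewrite natr_dblS natr_dblSS natrS.
  by field; rewrite !gt_eqF//=; lra.
rewrite mulrC ler_wpM2l ?sqr_ge0// ler_pdivlMr; nra.
Qed.

Lemma wl_ub M : wl M <= 1.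
Proof.
suff : (2 * M%:R + 1) * walk M 0 ^+ 2 <= 1.
  by rewrite /wl; have := sqr_ge0 (walk M 0); have h : 0 <= M%:R :> R by []; nra.
elim: M => [|M IH]; first by rewrite walk0/= mulr0 add0r mul1r expr1n.
apply: le_trans IH; rewrite walk00; set w := walk M 0; have h : 0 <= M%:R :> R by [].
have -> : (2 * M.+1%:R + 1) * (w * M.*2.+1%:R / M.*2.+2%:R) ^+ 2 =
   w ^+ 2 * ((2 * M%:R + 3) * (2 * M%:R + 1) ^+ 2 / (4 * (M%:R + 1) ^+ 2)) :> R.
  rewrite natr_dblS natr_dblSS natrS.
  by field; rewrite !gt_eqF//=; lra.
rewrite [leRHS]mulrC ler_wpM2l ?sqr_ge0// ler_pdivrMr; nra.
Qed.

Lemma wl_cvg : exists2 A : R, 0 < A & Num.sqrt M%:R * walk M 0 @[M --> \oo] --> A.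
Proof.
have C : cvgn wl.
  by apply: nondecreasing_is_cvgn; [exact: wl_nd|exists 1 => _ [n _ <-]; exact: wl_ub].
exists (Num.sqrt (limn wl)).
  rewrite sqrtr_gt0; apply: (@lt_le_trans _ _ (wl 1)).
    by rewrite /wl mul1r exprn_gt0// walk0_gt0.
  exact: nondecreasing_cvgn_le wl_nd C 1%N.
rewrite (_ : (fun M => _) = (fun M => Num.sqrt (wl M))).
  by apply: (continuous_cvg _ _ C); exact: sqrt_continuous.
apply/funext => M; rewrite /wl sqrtrM// sqrtr_sqr ger0_norm//; exact: walk_ge0.
Qed.
End walk.

(** * Trigonometric sums over a period *)

Section trig.
Variable R : realType.
Implicit Type (x : R) (k : int).

Lemma sin_pi_int k : sin (pi * k%:~R) = 0 :> R.
Proof.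
have H (n : nat) : sin (pi * n%:R) = 0 :> R.
  elim: n => [|n IH]; first by rewrite mulr0 sin0.
  by rewrite natrS mulrDr mulr1 sinDpi IH oppr0.
case: k => n; first exact: H.
by rewrite NegzE rmorphN/= mulrN sinN (H n.+1) oppr0.
Qed.

Lemma sin_2pi_int k : sin (2 * pi * k%:~R) = 0 :> R.
Proof. by rewrite (_ : 2 * pi * k%:~R = pi * (2 * k)%:~R) ?sin_pi_int// intrM; ring. Qed.

Lemma cos_2pi_int k : cos (2 * pi * k%:~R) = 1 :> R.
Proof.
rewrite (_ : 2 * pi * k%:~R = (pi * k%:~R) *+ 2) ?cos_mulr2n; last by ring.
by rewrite cos2sin2 sin_pi_int; ring.
Qed.

Lemma cosD2pik x k : cos (x + 2 * pi * k%:~R) = cos x.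
Proof. by rewrite cosD cos_2pi_int sin_2pi_int; ring. Qed.

Definition box (L : nat) (j : int) : R := (`|j|%N <= L)%N%:R.
Definition boxs (L : nat) : seq int := map (@intb) (allpairs pair (iota 0 L.+1) [:: true; false]).

Lemma box_out (L : nat) (j : int) : j \notin boxs L -> (L < `|j|)%N.
Proof.
apply: contraR; rewrite -leqNgt => jL; apply/mapP; exists (bint j); last by case: j {jL}.
have H n : (n <= L)%N -> n \in iota 0 L.+1 by rewrite mem_iota; lia.
apply/allpairsP; exists (bint j); case: j jL => n h; split; rewrite ?inE//; apply: H; move: h; rewrite /=; lia.
Qed.

Lemma asummable_box L (f : int -> R) : asummable (fun j => box L j * f j).
Proof.
apply: (@asummable_fin _ _ _ (boxs L)) => j /box_out; rewrite /box ltnNge => /negPf ->.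
by rewrite mul0r.
Qed.

Lemma asum_box0 (f : int -> R) : asum (fun j => box 0 j * f j) = f 0.
Proof.
rewrite (@asum_fin _ _ _ [:: 0])// ?big_seq1 /box ?absz0 ?mul1r//.
by move=> j; rewrite inE leqn0 absz_eq0 => /negPf ->; rewrite mul0r.
Qed.

Lemma asum_boxS L (f : int -> R) : asum (fun j => box L.+1 j * f j) =
  asum (fun j => box L j * f j) + (f (Posz L.+1) + f (- Posz L.+1)).
Proof.
have E : (fun j => box L.+1 j * f j) =
    (fun j => box L j * f j + ((`|j|%N == L.+1)%:R * f j)).
  apply/funext => j; rewrite -mulrDl; congr (_ * _); rewrite /box -natrD; congr (_%:R).
  by case: (ltngtP `|j|%N L.+1) => h; rewrite ?eqxx; lia.
have Z j : j \notin [:: Posz L.+1; - Posz L.+1] -> (`|j|%N == L.+1)%:R * f j = 0.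
  rewrite !inE => h; suff -> : (`|j|%N == L.+1) = false by rewrite mul0r.
  by apply/negP => /eqP e; move/negP: h; apply; apply/orP; lia.
rewrite E asumD; last 2 first.
- exact: asummable_box.
- exact: asummable_fin Z.
congr (_ + _); rewrite (@asum_fin _ _ _ [:: Posz L.+1; - Posz L.+1])//.
by rewrite big_cons big_seq1 abszN absz_nat eqxx !mul1r.
Qed.

(** Passing from L to L + 1 adds 2 sin (x/2) cos (x (L + 1)), a difference of
    two sines. *)
Lemma dirichlet L x : sin (x / 2) * asum (fun j => box L j * cos (x * j%:~R)) =
  sin ((2 * L%:R + 1) * (x / 2)).
Proof.
elim: L => [|L IH]; first by rewrite asum_box0 mulr0 cos0 mulr1 mulr0 add0r mul1r.
rewrite asum_boxS mulrDr IH rmorphN/= mulrN cosN.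
rewrite -[(Posz L.+1)%:~R]/(L.+1%:R) (natrS _ L).
have -> : (2 * L%:R + 1) * (x / 2) = x * (L%:R + 1) - x / 2 by field.
have -> : (2 * (L%:R + 1) + 1) * (x / 2) = x * (L%:R + 1) + x / 2 by field.
by rewrite sinB sinD; ring.
Qed.

Lemma asum_box1 L : asum (fun j => box L j * 1) = 2 * L%:R + 1.
Proof.
elim: L => [|L IH]; first by rewrite asum_box0 mulr0 add0r.
by rewrite asum_boxS IH (natrS _ L); ring.
Qed.

(** An odd period, so that the residues form a symmetric interval. *)
Definition nn (L : nat) : nat := L.*2.+1.

Lemma nnR L : (nn L)%:R = 2 * L%:R + 1 :> R.
Proof. exact: natr_dblS. Qed.

Lemma asummable_walk L M (nu : int) : asummable (fun l : int => walk R M (nu + l * Posz (nn L))).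
Proof.
apply: (@asummable_fin _ _ _ (boxs (M + `|nu|%N))) => l /box_out h.
rewrite walk_out//; have : leq (absz l) (absz (l * Posz (nn L))).
  by rewrite abszM absz_nat leq_pmulr.
lia.
Qed.

(** Orthogonality of the characters of the cyclic group of order nn L. *)
Lemma orth_base L (nu : int) :
  (nn L)%:R * asum (fun l : int => walk R 0 (nu + l * Posz (nn L))) =
  asum (fun j => box L j * cos (2 * pi * nu%:~R / (nn L)%:R * j%:~R)).
Proof.
have n0 : (nn L)%:R != 0 :> R by rewrite pnatr_eq0.
have [/dvdzP[k hk]|ndv] := boolP (Posz (nn L) %| nu)%Z.
- rewrite (@asum_fin _ _ _ [:: - k])//; last first.
    move=> l; rewrite inE walk0 hk => h; rewrite (_ : (_ == _) = false)//.
    apply/negP => /eqP; rewrite -mulrDl => /eqP; rewrite mulf_eq0 => /orP[]; last by [].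
    by move=> e; move: h; lia.
  rewrite big_seq1 walk0 hk mulNr subrr eqxx mulr1 [LHS]nnR -[LHS]asum_box1.
  apply: eq_asum => j; congr (_ * _).
  rewrite intrM -[(Posz _)%:~R]/((nn L)%:R) (_ : 2 * pi * _ / _ * _ = 2 * pi * (k * j)%:~R).
    by rewrite cos_2pi_int.
  by rewrite intrM; field.
- rewrite (@eq_asum _ _ _ (fun _ : int => 0)); last first.
    move=> l; rewrite walk0 (_ : (_ == _) = false)//; apply/negP => /eqP e.
    move/negP: ndv; apply; apply/dvdzP; exists (- l); move: e; lia.
  rewrite asum0 mulr0.
  set x := 2 * pi * _ / _.
  have := dirichlet L x; rewrite -nnR.
  have -> : (nn L)%:R * (x / 2) = pi * nu%:~R by rewrite /x; field.
  rewrite sin_pi_int => /eqP; rewrite mulf_eq0 => /orP[|/eqP ->//].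
  rewrite (_ : x / 2 = pi * (nu%:~R / (nn L)%:R)); last by rewrite /x; field.
  (* sin (pi nu / nn L) is not 0, as the multiple of nn L next to nu differs from it *)
  pose q := (nu %/ nn L)%Z; pose r := (nu %% nn L)%Z.
  have hr0 : 0 < r.
    have : 0 <= r by apply: modz_ge0.
    rewrite le_eqVlt => /orP[/eqP r0|//]; move/negP: ndv; case; apply/dvdzP.
    by exists q; rewrite {1}(divz_eq nu (nn L)) -/r -r0 addr0.
  have hrN : r < Posz (nn L) by exact: ltz_pmod.
  have -> : pi * (nu%:~R / (nn L)%:R) = pi * (r%:~R / (nn L)%:R) + pi * q%:~R :> R.
    rewrite {1}(divz_eq nu (nn L)) -/q -/r rmorphD rmorphM/= -[(Posz _)%:~R]/((nn L)%:R).
    by field.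
  have [cs|cs] : cos (pi * q%:~R) = 1 :> R \/ cos (pi * q%:~R) = -1 :> R.
    have := cos2sin2 (pi * q%:~R : R); rewrite sin_pi_int expr0n/= subr0 => /eqP.
    by rewrite sqrf_eq1 => /orP[] /eqP; [left|right].
  all: rewrite sinD sin_pi_int cs mulr0 addr0 ?mulr1 ?mulrN1 ?oppr_eq0.
  all: suff : 0 < sin (pi * (r%:~R / (nn L)%:R)) :> R by move=> /gt_eqF ->.
  all: apply: sin_gt0_pi; rewrite mulr_gt0 ?pi_gt0 ?divr_gt0 ?ltr0z ?ltr0n//=.
  all: rewrite -[ltRHS]mulr1 ltr_pM2l ?pi_gt0// ltr_pdivrMr ?ltr0n// mul1r.
  all: by rewrite -[(nn L)%:R]/((Posz (nn L))%:~R) ltr_int.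
Qed.

(** Wrapping the walk around a circle of nn L sites: both sides satisfy the
    same recursion in M. This finite identity becomes the Poisson formula in
    the limit. *)
Lemma walk_fourier L M (nu : int) :
  (nn L)%:R * asum (fun l : int => walk R M (nu + l * Posz (nn L))) =
  asum (fun j => box L j * (cos (pi * j%:~R / (nn L)%:R) ^+ M.*2 *
                            cos (2 * pi * nu%:~R / (nn L)%:R * j%:~R))).
Proof.
elim: M nu => [|M IH] nu.
  by rewrite orth_base; apply: eq_asum => j; rewrite expr0 mul1r.
have n0 : (nn L)%:R != 0 :> R by rewrite pnatr_eq0.
rewrite (@eq_asum _ _ _ (fun l => 1/4 * walk R M ((nu - 1) + l * Posz (nn L)) +
   (1/2 * walk R M (nu + l * Posz (nn L)) + 1/4 * walk R M ((nu + 1) + l * Posz (nn L))))); last first.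
  by move=> l; rewrite walkS [nu - 1 + _]addrAC [nu + 1 + _]addrAC; field.
have sw m : asummable (fun l : int => walk R M (m + l * Posz (nn L))) by exact: asummable_walk.
rewrite asumD; [|exact: asummableZ|by apply: asummableD; exact: asummableZ].
rewrite asumD; [|exact: asummableZ|exact: asummableZ].
have alg (n A B C : R) : n * (1 / 4 * A + (1 / 2 * B + 1 / 4 * C)) =
  1 / 4 * (n * A) + (1 / 2 * (n * B) + 1 / 4 * (n * C)) by ring.
rewrite !asumZ// alg (IH (nu - 1)) (IH nu) (IH (nu + 1)).
rewrite -!asumZ; try exact: asummable_box.
rewrite -asumD; [|apply: asummableZ; exact: asummable_box|apply: asummableZ; exact: asummable_box].
rewrite -asumD; [|apply: asummableZ; exact: asummable_box|apply: asummableD; apply: asummableZ; exact: asummable_box].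
apply: eq_asum => j.
set N : R := (nn L)%:R; set al := pi * j%:~R / N.
rewrite !intrD.
have -> : 2 * pi * (nu%:~R + (-1)%:~R) / N * j%:~R = 2 * pi * nu%:~R / N * j%:~R - 2 * al.
  by rewrite /al rmorphN; field.
have -> : 2 * pi * (nu%:~R + 1) / N * j%:~R = 2 * pi * nu%:~R / N * j%:~R + 2 * al.
  by rewrite /al; field.
rewrite cosB cosD (_ : 2 * al = al *+ 2); last by ring.
rewrite cos_mulr2n doubleS -(addn2 M.*2) exprD.
by set w := cos al ^+ M.*2; field.
Qed.
End trig.

(** * Gaussian sums *)

Section gauss.
Variable R : realType.

Lemma asummable_gauss0 (c : R) : 0 < c -> asummable (fun i : int => expR (- (c * i%:~R ^+ 2))).
Proof.
move=> c0; apply: asummable_le (asummable_geomz (expRZ_lt1 c0)) => i.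
rewrite ger0_norm ?expR_ge0// -expRM_natl ler_expR mulrN lerN2 mulrC.
by rewrite ler_pM2l// normr_int_le_sqr.
Qed.

Lemma asummable_gauss (c v : R) : 0 < c ->
  asummable (fun i : int => expR (- (c * (v + i%:~R) ^+ 2))).
Proof.
move=> c0; have c2 : 0 < c / 2 by lra.
apply: asummable_le (asummableZ (expR (c * v ^+ 2)) (asummable_gauss0 c2)) => i.
rewrite ger0_norm ?expR_ge0// -expRD ler_expR.
by have := sqr_ge0 (i%:~R + 2 * v); nra.
Qed.
End gauss.

(** * Gaussian comparison for the cosine *)

Section trigbounds.
Variable R : realType.

Lemma sin_le_id (x : R) : 0 <= x -> sin x <= x.
Proof.
move=> x0; rewrite -subr_ge0.
have D (t : R) : is_derive t 1 (fun t => t - sin t) (1 - cos t).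
  by dsolve; rewrite mulr1.
have := derive_ge0_le x0 (fun t _ => D t).
rewrite sin0 subr0; apply => t _.
by rewrite subr_ge0 cos_le1.
Qed.

Lemma cos_ge_quad (x : R) : 1 - x ^+ 2 / 2 <= cos x.
Proof.
wlog x0 : x / 0 <= x.
  move=> W; have [/W//|/ltW xn] := leP 0 x.
  by rewrite -cosN -sqrrN; apply: W; rewrite oppr_ge0.
rewrite -subr_ge0.
have D (t : R) : is_derive t 1 (fun t => cos t - (1 - t ^+ 2 / 2)) (t - sin t).
  by dsolve; rewrite /=; field.
have := derive_ge0_le x0 (fun t _ => D t).
rewrite cos0 expr0n/= mul0r subr0 subrr; apply => t /andP[t0 _].
by rewrite subr_ge0 sin_le_id.
Qed.

Lemma sin_ge_xcos (x : R) : 0 <= x <= pi -> x * cos x <= sin x.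
Proof.
move=> /andP[x0 xp]; rewrite -subr_ge0.
have D (t : R) : is_derive t 1 (fun t => sin t - t * cos t) (t * sin t).
  by dsolve; rewrite /=; ring.
have := derive_ge0_le x0 (fun t _ => D t).
rewrite sin0 mul0r subrr; apply => t /andP[t0 tx].
by rewrite mulr_ge0// sin_ge0_pi// t0 (le_trans tx).
Qed.

(** The derivative of e^(x^2/2) cos x is e^(x^2/2) (x cos x - sin x), which is
    not positive. *)
Lemma cos_le_gauss (x : R) : `|x| <= pi / 2 -> cos x <= expR (- (x ^+ 2 / 2)).
Proof.
rewrite -(cos_norm x) -[x ^+ 2]real_normK ?num_real//; move: `|x| (normr_ge0 x) => {}x x0 xp.
rewrite expRN -[_^-1]mul1r ler_pdivlMr ?expR_gt0// -subr_ge0.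
have D (t : R) : is_derive t 1 (fun t => 1 - cos t * expR (t ^+ 2 / 2))
    (expR (t ^+ 2 / 2) * (sin t - t * cos t)).
  by dsolve; rewrite /=; field.
have := derive_ge0_le x0 (fun t _ => D t).
rewrite cos0 expr0n/= mul0r expR0 mulr1 subrr; apply => t /andP[t0 tx].
rewrite mulr_ge0 ?expR_ge0// subr_ge0 sin_ge_xcos// t0/=.
have := pi_gt0 R; lra.
Qed.
End trigbounds.

(** * Poisson summation up to a constant *)

Section limit.
Variable R : realType.
Implicit Types (c v K : R) (L : nat).

Definition period (L : nat) : R := (nn L)%:R.
Definition mesh (L : nat) : R := (period L)^-1.
Definition steps c (L : nat) : nat := Num.truncn (c * period L ^+ 2).
Definition site v (L : nat) : nat := Num.truncn (v * period L).

Lemma period_gt0 L : 0 < period L. Proof. by rewrite /period ltr0n. Qed.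
Lemma period_mesh L : period L * mesh L = 1. Proof. by rewrite /mesh divff// gt_eqF// period_gt0. Qed.
Lemma mesh_gt0 L : 0 < mesh L. Proof. by rewrite /mesh invr_gt0 period_gt0. Qed.

Lemma cvg_mesh : mesh L @[L --> \oo] --> 0.
Proof.
apply: (@squeeze_cvgr _ _ _ _ (cst 0) harmonic); last 2 first.
- exact: cvg_cst.
- exact: cvg_harmonic.
apply: nearW => L; rewrite (ltW (mesh_gt0 L))/= /mesh /period lef_pV2 ?posrE ?ltr0n// ler_nat /nn; lia.
Qed.

Lemma steps_itv c L : 0 < c -> c * period L ^+ 2 - 1 < (steps c L)%:R <= c * period L ^+ 2.
Proof.
move=> c0.
have h : 0 <= c * period L ^+ 2 by rewrite mulr_ge0 ?sqr_ge0// ltW.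
have /andP[h1 h2] := truncn_itv h.
by rewrite /steps h1 andbT ltrBlDr; move: h2; rewrite (natrS R).
Qed.

Lemma cvg_steps_mesh c : 0 < c -> (steps c L)%:R * mesh L ^+ 2 @[L --> \oo] --> c.
Proof.
move=> c0.
apply: (@squeeze_cvgr _ _ _ _ (fun L => c - mesh L * mesh L) (cst c)); last 2 first.
- rewrite -[X in _ --> X](_ : c - 0 * 0 = c); last by rewrite mulr0 subr0.
  by apply: cvgB; [exact: cvg_cst|apply: cvgM; exact: cvg_mesh].
- exact: cvg_cst.
apply: nearW => L; have /andP[h1 h2] := steps_itv L c0.
have dd : 0 < mesh L ^+ 2 by rewrite exprn_gt0// mesh_gt0.
have e : period L ^+ 2 * mesh L ^+ 2 = 1 by rewrite -exprMn period_mesh expr1n.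
have e2 : c * (period L ^+ 2 * mesh L ^+ 2) = c by rewrite e mulr1.
have k1 : 0 <= ((steps c L)%:R - (c * period L ^+ 2 - 1)) * mesh L ^+ 2 by rewrite mulr_ge0 ?subr_ge0// ltW.
have k2 : 0 <= (c * period L ^+ 2 - (steps c L)%:R) * mesh L ^+ 2 by rewrite mulr_ge0 ?subr_ge0// ltW.
by apply/andP; split; rewrite /cst; lra.
Qed.

Lemma cvg_site v : 0 <= v -> (site v L)%:R * mesh L @[L --> \oo] --> v.
Proof.
move=> v0.
apply: (@squeeze_cvgr _ _ _ _ (fun L => v - mesh L) (cst v)); last 2 first.
- rewrite -[X in _ --> X]subr0; by apply: cvgB; [exact: cvg_cst|exact: cvg_mesh].
- exact: cvg_cst.
apply: nearW => L; have h : 0 <= v * period L by rewrite mulr_ge0// ltW// period_gt0.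
have /andP[h1 h2] := truncn_itv h; rewrite (natrS R) in h2.
rewrite -/(site v L) in h1 h2.
have e2 : v * (period L * mesh L) = v by rewrite period_mesh mulr1.
have k1 : 0 <= ((site v L)%:R + 1 - v * period L) * mesh L by rewrite mulr_ge0 ?subr_ge0 // ltW// ?mesh_gt0.
have k2 : 0 <= (v * period L - (site v L)%:R) * mesh L by rewrite mulr_ge0 ?subr_ge0 // ltW// ?mesh_gt0.
by apply/andP; split; rewrite /cst; lra.
Qed.

Lemma cvg_steps c : 0 < c -> steps c L @[L --> \oo] --> \oo.
Proof.
move=> c0.
apply/cvgnyPge => A; near=> L.
have /andP[h1 _] := steps_itv L c0.
suff : A%:R <= (steps c L)%:R :> R by rewrite ler_nat.
apply: le_trans (ltW h1).
have hL : (A%:R + 1) / c <= period L.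
  apply: le_trans (ltW (truncnS_gt _)) _.
  rewrite /period ler_nat; apply: (@leq_trans L); last by rewrite /nn; lia.
  by near: L; exists (Num.truncn ((A%:R + 1) / c)).+1.
have h1N : 1 <= period L by rewrite /period ler1n.
rewrite ler_pdivrMr// in hL.
have k : 0 <= (period L * c) * (period L - 1) by rewrite !mulr_ge0 ?subr_ge0// ltW// period_gt0.
by rewrite lerBrDr; lra.
Unshelve. all: by end_near. Qed.

Lemma cvg_walk0_mesh c (A : R) : 0 < c -> Num.sqrt M%:R * walk R M 0 @[M --> \oo] --> A ->
  period L * walk R (steps c L) 0 @[L --> \oo] --> A / Num.sqrt c.
Proof.
move=> c0 HA.
have H1 : Num.sqrt (steps c L)%:R * walk R (steps c L) 0 @[L --> \oo] --> A.
  exact: (cvg_comp _ _ (cvg_steps c0) HA).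
have H2 : Num.sqrt ((steps c L)%:R * mesh L ^+ 2) @[L --> \oo] --> Num.sqrt c.
  by apply: (continuous_cvg _ _ (cvg_steps_mesh c0)); exact: sqrt_continuous.
have sc : Num.sqrt c != 0 by rewrite gt_eqF// sqrtr_gt0.
have C : (Num.sqrt (steps c L)%:R * walk R (steps c L) 0) * (Num.sqrt ((steps c L)%:R * mesh L ^+ 2))^-1 @[L --> \oo] --> A / Num.sqrt c by exact: cvgM H1 (cvgV sc H2).
apply: cvg_trans C.
apply: near_eq_cvg; near=> L.
have ML : 0 < (steps c L)%:R :> R.
  rewrite ltr0n; near: L; have /cvgnyPge := cvg_steps c0; exact.
rewrite /= sqrtrM ?ler0n// sqrtr_sqr (ger0_norm (ltW (mesh_gt0 L))).
have s0 : Num.sqrt (steps c L)%:R != 0 :> R by rewrite gt_eqF// sqrtr_gt0.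
have d0 : mesh L != 0 by rewrite gt_eqF// mesh_gt0.
have -> : period L = (mesh L)^-1 by rewrite /mesh invrK.
by field; rewrite d0 s0.
Unshelve. all: by end_near. Qed.

(** Local central limit theorem: squeezed between the two binomial estimates.
    *)
Lemma cvg_walk c v K (l : int) : 0 < c -> 0 <= v ->
  period L * walk R (steps c L) 0 @[L --> \oo] --> K ->
  period L * walk R (steps c L) (Posz (site v L) + l * Posz (nn L)) @[L --> \oo] -->
  K * expR (- ((v + l%:~R) ^+ 2 / c)).
Proof.
move=> c0 v0 HK.
pose n L := absz (Posz (site v L) + l * Posz (nn L)).
have nE L : (n L)%:R * mesh L = `|(site v L)%:R * mesh L + l%:~R|.
  rewrite /n natr_absz intr_norm -[in LHS](ger0_norm (ltW (mesh_gt0 L))) -normrM.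
  by rewrite intrD intrM -![(Posz _)%:~R]/(_%:R) mulrDl -mulrA -/(period L) period_mesh mulr1.
have Hy : (n L)%:R * mesh L @[L --> \oo] --> `|v + l%:~R|.
  rewrite (_ : (fun L => _) = (fun L => `|(site v L)%:R * mesh L + l%:~R|)); last by apply/funext.
  by apply: cvg_norm; apply: cvgD; [exact: cvg_site|exact: cvg_cst].
have Hyd : (n L)%:R * mesh L * mesh L @[L --> \oo] --> (0 : R).
  by rewrite -[X in _ --> X](mulr0 `|v + l%:~R|); apply: cvgM => //; exact: cvg_mesh.
have cn : c != 0 by rewrite gt_eqF.
have lim (e : R) : period L * walk R (steps c L) 0 * expR (- (((n L)%:R * mesh L) * ((n L)%:R * mesh L) *
     ((steps c L)%:R * mesh L ^+ 2 + e * ((n L)%:R * mesh L * mesh L))^-1)) @[L --> \oo] -->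
     K * expR (- ((v + l%:~R) ^+ 2 / c)).
  apply: cvgM => //; apply: (continuous_cvg _ (@continuous_expR _ _)).
  apply: cvgN; rewrite -[(v + _) ^+ 2]real_normK ?num_real// expr2.
  apply: cvgM; first exact: cvgM.
  apply: cvgV => //; rewrite -[X in _ --> X](_ : c + e * 0 = c); last by rewrite mulr0 addr0.
  by apply: cvgD; [exact: cvg_steps_mesh|apply: cvgM => //; exact: cvg_cst].
apply: (squeeze_cvgr _ (lim (-1)) (lim 1)).
have Hpos : (steps c L)%:R * mesh L ^+ 2 - (n L)%:R * mesh L * mesh L @[L --> \oo] --> c.
  by rewrite -[X in _ --> X]subr0; apply: cvgB; [exact: cvg_steps_mesh|].
near=> L.
have hp : 0 < (steps c L)%:R * mesh L ^+ 2 - (n L)%:R * mesh L * mesh L.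
  by near: L; exact: (cvgr_gt _ Hpos).
have dL := mesh_gt0 L; have NL := period_gt0 L; have d2 : 0 < mesh L ^+ 2 by rewrite exprn_gt0.
have nM : (n L < steps c L)%N.
  have : 0 < ((steps c L)%:R - (n L)%:R) * mesh L ^+ 2 by apply: lt_le_trans hp _; rewrite le_eqVlt; apply/orP; left; apply/eqP; ring.
  by rewrite pmulr_lgt0// subr_gt0 ltr_nat.
have wE : walk R (steps c L) (Posz (site v L) + l * Posz (nn L)) = walk R (steps c L) (n L).
  by rewrite /walk absz_nat.
have M0 : (0 < steps c L)%N by lia.
have dn : mesh L != 0 by rewrite gt_eqF.
have g1 : 0 < (steps c L)%:R - (n L)%:R :> R by rewrite subr_gt0 ltr_nat.
have g2 : 0 < (steps c L)%:R + (n L)%:R :> R by rewrite ltr_wpDr// ltr0n.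
have E1 : ((n L)%:R * mesh L) * ((n L)%:R * mesh L) *
     ((steps c L)%:R * mesh L ^+ 2 + -1 * ((n L)%:R * mesh L * mesh L))^-1 = (n L)%:R ^+ 2 / (steps c L - n L)%:R.
  rewrite natrB; last exact: ltnW.
  have h : (steps c L)%:R * mesh L ^+ 2 + -1 * ((n L)%:R * mesh L * mesh L) = ((steps c L)%:R - (n L)%:R) * mesh L ^+ 2 by ring.
  by rewrite h; field; rewrite dn gt_eqF.
have E2 : ((n L)%:R * mesh L) * ((n L)%:R * mesh L) *
     ((steps c L)%:R * mesh L ^+ 2 + 1 * ((n L)%:R * mesh L * mesh L))^-1 = (n L)%:R ^+ 2 / (steps c L + n L)%:R.
  rewrite natrD.
  have h : (steps c L)%:R * mesh L ^+ 2 + 1 * ((n L)%:R * mesh L * mesh L) = ((steps c L)%:R + (n L)%:R) * mesh L ^+ 2 by ring.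
  by rewrite h; field; rewrite dn gt_eqF.
rewrite E1 E2 wE; apply/andP; split.
  by rewrite -[X in X <= _]mulrA; apply: ler_wpM2l; [exact: ltW|exact: walk_ge].
rewrite -[X in _ <= X]mulrA; apply: ler_wpM2l; first exact: ltW.
by apply: walk_le => //; exact: ltnW.
Unshelve. all: by end_near. Qed.

Lemma cvg_walk_sum c v K : 0 < c -> 0 <= v -> v < 1 ->
  period L * walk R (steps c L) 0 @[L --> \oo] --> K ->
  asum (fun l : int => period L * walk R (steps c L) (Posz (site v L) + l * Posz (nn L))) @[L --> \oo] -->
  K * asum (fun l : int => expR (- ((v + l%:~R) ^+ 2 / c))).
Proof.
move=> c0 v0 v1 HK.
have sg0 : asummable (fun l : int => expR (- (c^-1 / 4 * l%:~R ^+ 2))).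
  by apply: asummable_gauss0; rewrite divr_gt0 ?invr_gt0.
have sg := asummableZ ((K + 1) * expR (c^-1 / 2)) sg0.
have sv : asummable (fun l : int => expR (- ((v + l%:~R) ^+ 2 / c))).
  have := asummable_gauss v (_ : 0 < c^-1); rewrite invr_gt0 => /(_ c0).
  by apply: asummable_le => l; rewrite ger0_norm ?expR_ge0// mulrC.
rewrite -asumZ//; apply: (cvg_asum sg); last by move=> l; exact: cvg_walk.
near=> L => l.
have wK : period L * walk R (steps c L) 0 <= K + 1.
  by near: L; apply: (cvgr_le _ HK); rewrite ltrDl.
have M0 : (0 < steps c L)%N by near: L; have /cvgnyPge := cvg_steps c0; exact.
rewrite ger0_norm ?mulr_ge0 ?walk_ge0 ?(ltW (period_gt0 _))//.
apply: le_trans (ler_wpM2l (ltW (period_gt0 L)) (walk_le2 R _ M0)) _.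
rewrite [leLHS]mulrA -[leRHS]mulrA; apply: ler_pM => //.
  by rewrite mulr_ge0 ?walk_ge0 ?(ltW (period_gt0 _)).
rewrite -expRD ler_expR lerNl opprD [- - _]opprK.
have /andP[_ MN] := steps_itv L c0.
set i : R := (Posz _ + _)%:~R.
have iE : i = ((site v L)%:R * mesh L + l%:~R) * period L.
  by rewrite /i intrD intrM -![(Posz _)%:~R]/(_%:R) mulrDl -mulrA [mesh L * _]mulrC period_mesh mulr1.
have [a0 a1] : 0 <= (site v L)%:R * mesh L /\ (site v L)%:R * mesh L <= 1.
  have dL := mesh_gt0 L; split; first by rewrite mulr_ge0// ltW.
  have h : 0 <= v * period L by rewrite mulr_ge0// ltW// period_gt0.
  have /andP[h1 _] := truncn_itv h; rewrite -/(site v L) in h1.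
  rewrite /mesh ler_pdivrMr ?period_gt0// mul1r (le_trans h1)//.
  by rewrite ler_piMl ?(ltW (period_gt0 L))// ltW.
have i2 : i ^+ 2 / (2 * (steps c L)%:R) >= i ^+ 2 / (2 * (c * period L ^+ 2)).
  apply: ler_wpM2l; first exact: sqr_ge0.
  have MM : 0 < (steps c L)%:R :> R by rewrite ltr0n.
  rewrite lef_pV2 ?posrE ?mulr_gt0 ?exprn_gt0 ?period_gt0//.
  by rewrite ler_pM2l.
apply: le_trans i2.
rewrite iE; move: ((site v L)%:R * mesh L) (l%:~R) a0 a1 => a b a0 a1.
have -> : ((a + b) * period L) ^+ 2 / (2 * (c * period L ^+ 2)) = c^-1 * ((a + b) ^+ 2 / 2).
  by field; rewrite !gt_eqF// period_gt0.
have ci : 0 < c^-1 by rewrite invr_gt0.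
rewrite -subr_ge0.
have -> : c^-1 * ((a + b) ^+ 2 / 2) - (- (c^-1 / 2) + c^-1 / 4 * b ^+ 2) =
  c^-1 / 4 * ((b + 2 * a) ^+ 2 + 2 * (1 - a ^+ 2)) by field; rewrite gt_eqF.
rewrite mulr_ge0 ?(ltW (divr_gt0 _ _))// addr_ge0 ?sqr_ge0// mulr_ge0// subr_ge0.
by rewrite -[leRHS](expr1n _ 2) lerXn2r ?nnegrE.
Unshelve. all: by end_near. Qed.

(** The right side of [walk_fourier]: cos^(2M) is dominated by a Gaussian and
    converges to one. *)
Lemma cvg_cos c v : 0 < c -> 0 <= v ->
  asum (fun j => box R L j * (cos (pi * j%:~R / period L) ^+ (steps c L).*2 *
                            cos (2 * pi * (Posz (site v L))%:~R / period L * j%:~R))) @[L --> \oo] -->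
  asum (fun j : int => expR (- (pi ^+ 2 * c * j%:~R ^+ 2)) * cos (2 * pi * v * j%:~R)).
Proof.
move=> c0 v0.
have p0 : 0 < pi ^+ 2 :> R by rewrite exprn_gt0// pi_gt0.
have c2 : 0 < c / 2 by lra.
have sg : asummable (fun l : int => expR (- (pi ^+ 2 * (c / 2) * l%:~R ^+ 2))).
  by apply: asummable_gauss0; rewrite mulr_gt0.
have small L (j : int) : (`|j| <= L)%N -> `|pi * j%:~R / period L| <= pi / 2.
  move=> jL; rewrite normrM normfV normrM (gtr0_norm (period_gt0 L)) (gtr0_norm (pi_gt0 _)).
  rewrite ler_pdivrMr ?period_gt0// -mulrA ler_pM2l ?pi_gt0//.
  rewrite -intr_norm -natr_absz /period nnR.
  have : (`|j|%N)%:R <= L%:R :> R by rewrite ler_nat.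
  by lra.
apply: (cvg_asum sg) => [|j].
  near=> L => j.
  have hM : c / 2 <= (steps c L)%:R * mesh L ^+ 2.
    near: L; apply: (cvgr_ge _ (cvg_steps_mesh c0)); lra.
  rewrite normrM /box; have [jL|jL] := leqP `|j|%N L; last by rewrite normr0 mul0r expR_ge0.
  rewrite normr1 mul1r normrM -[leRHS]mulr1; apply: ler_pM => //; last exact: cos_max.
  have cx : 0 <= cos (pi * j%:~R / period L).
    apply: cos_ge0_pihalf; have := small _ _ jL; by rewrite ler_norml.
  rewrite ger0_norm ?exprn_ge0//.
  apply: le_trans (lerXn2r _ _ _ (cos_le_gauss (small _ _ jL))) _; rewrite ?nnegrE ?expR_ge0//.
  rewrite -expRM_natl ler_expR mulrN lerN2.
  have -> : (steps c L).*2%:R * ((pi * j%:~R / period L) ^+ 2 / 2) = pi ^+ 2 * j%:~R ^+ 2 * ((steps c L)%:R * mesh L ^+ 2).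
    by rewrite -mul2n natrM /mesh; field; rewrite gt_eqF// period_gt0.
  rewrite mulrAC ler_wpM2l// mulr_ge0 ?sqr_ge0//.
have Hx : pi * j%:~R * mesh L @[L --> \oo] --> (0 : R).
  by rewrite -[X in _ --> X](mulr0 (pi * j%:~R)); apply: cvgM; [exact: cvg_cst|exact: cvg_mesh].
have C1 : cos (2 * pi * ((site v L)%:R * mesh L) * j%:~R) @[L --> \oo] --> cos (2 * pi * v * j%:~R).
  apply: (continuous_cvg _ (@continuous_cos _ _)).
  apply: cvgM; last exact: cvg_cst.
  by apply: cvgM; [exact: cvg_cst|exact: cvg_site].
have C2 : expR (- (pi ^+ 2 * j%:~R ^+ 2 * ((steps c L)%:R * mesh L ^+ 2))) @[L --> \oo] -->
    expR (- (pi ^+ 2 * c * j%:~R ^+ 2)).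
  apply: (continuous_cvg _ (@continuous_expR _ _)).
  apply: cvgN; rewrite [pi ^+ 2 * c * _]mulrAC; apply: cvgM; first exact: cvg_cst.
  exact: cvg_steps_mesh.
have C3 : expR (- (pi ^+ 2 * j%:~R ^+ 2 * ((steps c L)%:R * mesh L ^+ 2) *
     (1 - (pi * j%:~R * mesh L) * (pi * j%:~R * mesh L) / 2)^-1)) @[L --> \oo] -->
    expR (- (pi ^+ 2 * c * j%:~R ^+ 2)).
  apply: (continuous_cvg _ (@continuous_expR _ _)).
  apply: cvgN; rewrite -[X in _ --> X]mulr1; apply: cvgM.
    by rewrite [pi ^+ 2 * c * _]mulrAC; apply: cvgM; [exact: cvg_cst|exact: cvg_steps_mesh].
  rewrite -[X in _ --> X]invr1; apply: cvgV; first exact: oner_neq0.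
  rewrite -[X in _ --> X](_ : 1 - 0 * 0 / 2 = 1); last by rewrite !mul0r subr0.
  apply: cvgB; first exact: cvg_cst.
  by apply: cvgM; [exact: cvgM|exact: cvg_cst].
have C4 : cos (pi * j%:~R / period L) ^+ (steps c L).*2 @[L --> \oo] --> expR (- (pi ^+ 2 * c * j%:~R ^+ 2)).
  apply: (squeeze_cvgr _ C3 C2); near=> L.
  have jL : (`|j| <= L)%N by near: L; exists `|j|%N.
  have x1 : `|pi * j%:~R * mesh L| < 1.
    near: L; have /cvgrPdist_lt/(_ 1 ltr01) := Hx; apply: filterS => L; by rewrite sub0r normrN.
  set x := pi * j%:~R * mesh L in x1 *.
  have cx : 0 <= cos x.
    apply: cos_ge0_pihalf; have := small _ _ jL; by rewrite ler_norml.
  have x2 : x * x < 1 by rewrite -expr2 -real_normK ?num_real// expr_lt1.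
  have e2 : pi ^+ 2 * j%:~R ^+ 2 * ((steps c L)%:R * mesh L ^+ 2) = (steps c L).*2%:R * (x ^+ 2 / 2).
    by rewrite -mul2n natrM /x; field.
  rewrite e2 -/x; apply/andP; split.
    have -> : - ((steps c L).*2%:R * (x ^+ 2 / 2) * (1 - x * x / 2)^-1) =
       (steps c L).*2%:R * - ((x ^+ 2 / 2) * (1 - x ^+ 2 / 2)^-1) by rewrite expr2; ring.
    rewrite expRM_natl; apply: lerXn2r; rewrite ?nnegrE ?expR_ge0//.
    apply: le_trans (cos_ge_quad x); set t := x ^+ 2 / 2.
    have t1 : t < 1 by rewrite /t expr2; lra.
    rewrite expRN -[leRHS]invrK lef_pV2 ?posrE ?expR_gt0 ?invr_gt0 ?subr_gt0//.
    apply: le_trans (expR_ge1Dx _).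
    rewrite -[leLHS]mul1r ler_pdivrMr ?subr_gt0// mulrDl mul1r mulfVK ?subr_eq0 ?gt_eqF//.
    by lra.
  rewrite -mulrN expRM_natl; apply: lerXn2r; rewrite ?nnegrE ?expR_ge0//.
  exact: cos_le_gauss (small _ _ jL).
have C : cos (pi * j%:~R / period L) ^+ (steps c L).*2 * cos (2 * pi * ((site v L)%:R * mesh L) * j%:~R) @[L --> \oo] -->
   expR (- (pi ^+ 2 * c * j%:~R ^+ 2)) * cos (2 * pi * v * j%:~R) by exact: cvgM C4 C1.
apply: cvg_trans C; apply: near_eq_cvg; near=> L.
have jL : (`|j| <= L)%N by near: L; exists `|j|%N.
by rewrite /box jL mul1r -[(Posz _)%:~R]/(_%:R) mulrA.
Unshelve. all: by end_near. Qed.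

(** The limit of [walk_fourier] when the number of steps is proportional to
    the square of the period. *)
Lemma poisson0 : exists2 A : R, 0 < A & forall c v, 0 < c -> 0 <= v -> v < 1 ->
  asum (fun j : int => expR (- (pi ^+ 2 * c * j%:~R ^+ 2)) * cos (2 * pi * v * j%:~R)) =
  A / Num.sqrt c * asum (fun l : int => expR (- ((v + l%:~R) ^+ 2 / c))).
Proof.
have [A A0 HA] := wl_cvg R; exists A => // c v c0 v0 v1.
have H1 := cvg_walk_sum c0 v0 v1 (cvg_walk0_mesh c0 HA).
have H2 := cvg_cos c0 v0.
have E : (fun L => asum (fun l : int => period L * walk R (steps c L) (Posz (site v L) + l * Posz (nn L)))) =
  (fun L => asum (fun j => box R L j * (cos (pi * j%:~R / period L) ^+ (steps c L).*2 *
                            cos (2 * pi * (Posz (site v L))%:~R / period L * j%:~R)))).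
  apply/funext => L; rewrite asumZ; last exact: asummable_walk.
  exact: walk_fourier.
rewrite E in H1; exact: (cvg_unique _ H2 H1).
Qed.

End limit.

(** * Poisson summation for Gaussians *)

Section poisson.
Variable R : realType.

(** At t = 1 and v = 0 both sides of [poisson0] are the same sum, which
    determines its constant. *)
Lemma poisson (t v : R) : 0 < t ->
  asum (fun l : int => expR (- (pi * (v + l%:~R) ^+ 2 / t))) =
  Num.sqrt t * asum (fun j : int => expR (- (pi * t * j%:~R ^+ 2)) * cos (2 * pi * v * j%:~R)).
Proof.
have p0 := pi_gt0 R; have pn : pi != 0 :> R by rewrite gt_eqF.
have [A A0 HA] := poisson0 R.
have base (c w : R) : 0 < c -> 0 <= w -> w < 1 ->
    asum (fun j : int => expR (- (pi * c * j%:~R ^+ 2)) * cos (2 * pi * w * j%:~R)) =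
    A * Num.sqrt pi / Num.sqrt c * asum (fun l : int => expR (- (pi * (w + l%:~R) ^+ 2 / c))).
  move=> c0 w0 w1; have cn : c != 0 by rewrite gt_eqF.
  have := HA (c / pi) w (divr_gt0 c0 p0) w0 w1.
  have -> : A / Num.sqrt (c / pi) = A * Num.sqrt pi / Num.sqrt c.
    by rewrite sqrtrM ?ltW// sqrtrV ?ltW// invfM invrK; ring.
  rewrite (_ : (fun j : int => _) = (fun j : int => expR (- (pi * c * j%:~R ^+ 2)) * cos (2 * pi * w * j%:~R))); last first.
    have E : pi ^+ 2 * (c / pi) = pi * c :> R by rewrite expr2 -mulrA [pi * (c / pi)]mulrC divfK.
    by apply/funext => j; rewrite E.
  move=> ->; congr (_ * _); apply: eq_asum => l; congr (expR (- _)).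
  by rewrite invf_div mulrA [_ * pi]mulrC.
have AE : A * Num.sqrt pi = 1.
  have := base 1 0 ltr01 (lexx _) ltr01.
  rewrite sqrtr1 divr1.
  rewrite (_ : (fun j : int => _) = (fun l : int => expR (- (pi * (0 + l%:~R) ^+ 2 / 1)))); last first.
    by apply/funext => j; rewrite mulr0 mul0r cos0 !mulr1 add0r divr1.
  set S := asum _ => E.
  have S0 : 0 < S.
    have su : asummable (fun l : int => expR (- (pi * (0 + l%:~R) ^+ 2 / 1)) : R).
      by rewrite (_ : (fun _ => _) = (fun l : int => expR (- (pi * (0 + l%:~R) ^+ 2)))); [exact: asummable_gauss|apply/funext => l; rewrite divr1].
    have := @asum_ge_seq _ _ _ [:: 0] (fun l => expR_ge0 _) su isT.
    by rewrite big_seq1; apply: lt_le_trans; exact: expR_gt0.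
  have Sn : S != 0 by rewrite gt_eqF.
  by apply: (mulIf Sn); rewrite mul1r -E.
move=> t0; have st : 0 < Num.sqrt t by rewrite sqrtr_gt0.
pose k := Num.floor v; pose w := v - k%:~R.
have w0 : 0 <= w by rewrite /w subr_ge0 floor_le.
have w1 : w < 1 by rewrite /w ltrBlDr addrC -[1]/(1%:~R) -intrD floorD1_gt.
have -> : asum (fun j : int => expR (- (pi * t * j%:~R ^+ 2)) * cos (2 * pi * v * j%:~R)) =
   asum (fun j : int => expR (- (pi * t * j%:~R ^+ 2)) * cos (2 * pi * w * j%:~R)).
  apply: eq_asum => j; congr (_ * _); rewrite -[RHS](cosD2pik _ (k * j)) intrM /w.
  by have -> : 2 * pi * (v - k%:~R) * j%:~R + 2 * pi * (k%:~R * j%:~R) = 2 * pi * v * j%:~R by ring.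
rewrite base// AE mul1r [RHS]mulrA divff ?gt_eqF// mul1r.
rewrite (@reindex_asum _ _ _ (fun l : int => l - k)); last first.
  by exists (fun l => l + k) => l; rewrite ?subrK ?addrK.
apply: eq_asum => l; rewrite intrB /w.
by have -> : v + (l%:~R - k%:~R) = v - k%:~R + l%:~R by ring.
Qed.
End poisson.

(** * The normalised theta function and its dual form *)

Section lattice.
Variable R : realType.
Implicit Types (s x y : R) (p : int * int).

Definition sqnorm p : R := p.1%:~R ^+ 2 + p.2%:~R ^+ 2.

(** The form |m z + n|^2 / y at p = (m, n). *)
Definition qform x y p : R :=
  ((p.1%:~R * x + p.2%:~R) ^+ 2 + (p.1%:~R * y) ^+ 2) / y.

Lemma sqnorm_ge0 p : 0 <= sqnorm p.
Proof. by rewrite addr_ge0 ?sqr_ge0. Qed.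

Lemma qform_ge0 x y p : 0 < y -> 0 <= qform x y p.
Proof. by move=> y0; rewrite divr_ge0 ?addr_ge0 ?sqr_ge0// ltW. Qed.

Lemma asummable_sqnorm (k : R) : 0 < k -> asummable (fun p => expR (- (k * sqnorm p))).
Proof.
move=> k0; have sg := asummable_gauss0 k0.
have := asummable_prod2 sg sg; apply: asummable_le => p.
by rewrite ger0_norm ?expR_ge0// -expRD -opprD -mulrDr.
Qed.

Lemma poly_exp_bound (k : R) (n : nat) : 0 < k ->
  exists2 C : R, 0 <= C & forall t, 0 <= t -> (1 + t) ^+ n * expR (- (k * t)) <= C.
Proof.
move=> k0; elim: n k k0 => [|n IH] k k0.
  by exists 1 => // t t0; rewrite expr0 !mul1r expR_le1; nra.
have k2 : 0 < k / 2 by lra.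
have [C C0 HC] := IH _ k2.
have c2 : 0 <= 1 + 2 / k by rewrite addr_ge0// divr_ge0// ltW.
exists ((1 + 2 / k) * C) => [|t t0]; first exact: mulr_ge0.
have -> : (1 + t) ^+ n.+1 * expR (- (k * t)) =
   ((1 + t) * expR (- (k / 2 * t))) * ((1 + t) ^+ n * expR (- (k / 2 * t))).
  rewrite exprS; have -> : expR (- (k * t)) = expR (- (k / 2 * t)) * expR (- (k / 2 * t)).
    by rewrite -expRD; congr expR; field.
  by ring.
apply: ler_pM => //.
- by rewrite mulr_ge0 ?expR_ge0// addr_ge0.
- by rewrite mulr_ge0 ?expR_ge0// exprn_ge0// addr_ge0.
- rewrite expRN ler_pdivrMr ?expR_gt0//.
  apply: le_trans (ler_wpM2l c2 (expR_ge1Dx (k / 2 * t))).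
  have -> : (1 + 2 / k) * (1 + k / 2 * t) = 1 + t + (2 / k + k / 2 * t) by field; rewrite gt_eqF.
  by rewrite lerDl addr_ge0 ?divr_ge0 ?mulr_ge0// ltW.
- exact: HC.
Qed.

Lemma asummable_poly (k : R) (n : nat) : 0 < k ->
  asummable (fun p => (1 + sqnorm p) ^+ n * expR (- (k * sqnorm p))).
Proof.
move=> k0; have k2 : 0 < k / 2 by lra.
have [C C0 HC] := poly_exp_bound n k2.
apply: asummable_le (asummableZ C (asummable_sqnorm k2)) => p.
have h := sqnorm_ge0 p.
rewrite ger0_norm; last by rewrite mulr_ge0 ?expR_ge0// exprn_ge0// ler_wpDl.
have -> : expR (- (k * sqnorm p)) = expR (- (k / 2 * sqnorm p)) * expR (- (k / 2 * sqnorm p)).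
  by rewrite -expRD; congr expR; field.
by rewrite mulrA ler_wpM2r ?expR_ge0// HC.
Qed.

(** A lower bound for the smallest eigenvalue of [qform]. *)
Definition qform_const x y : R := (2 + (2 * x ^+ 2 + 1) / y ^+ 2)^-1 / y.

Lemma qform_const_gt0 x y : 0 < y -> 0 < qform_const x y.
Proof.
move=> y0; rewrite /qform_const divr_gt0// invr_gt0 ltr_wpDr// divr_ge0 ?sqr_ge0//.
by rewrite addr_ge0// mulr_ge0// sqr_ge0.
Qed.

Lemma qform_ge_sqnorm x y p : 0 < y -> qform_const x y * sqnorm p <= qform x y p.
Proof.
move=> y0; rewrite /qform_const /qform mulrAC ler_pM2r ?invr_gt0//.
have y2 : 0 < y ^+ 2 by rewrite exprn_gt0.
set e := (2 * x ^+ 2 + 1) / y ^+ 2.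
have e0 : 0 <= e by apply: divr_ge0; rewrite ?(ltW y2)// addr_ge0// mulr_ge0// sqr_ge0.
have ey : e * y ^+ 2 = 2 * x ^+ 2 + 1 by rewrite /e mulfVK ?gt_eqF.
rewrite mulrC ler_pdivrMr /sqnorm; last by lra.
move: (p.1%:~R) (p.2%:~R) => m n.
have h1 := sqr_ge0 (m * x + n); have h2 := sqr_ge0 (m * y); have h3 := sqr_ge0 (2 * m * x + n).
have E2 : (m * y) ^+ 2 * e = m ^+ 2 * (2 * x ^+ 2 + 1) by rewrite -ey; ring.
have h4 : 0 <= (m * x + n) ^+ 2 * e by exact: mulr_ge0.
have -> : ((m * x + n) ^+ 2 + (m * y) ^+ 2) * (2 + e) =
  2 * (m * x + n) ^+ 2 + 2 * (m * y) ^+ 2 + (m * x + n) ^+ 2 * e + m ^+ 2 * (2 * x ^+ 2 + 1).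
  by rewrite -E2; ring.
nra.
Qed.

Lemma asummable_qform s x y : 0 < s -> 0 < y -> asummable (fun p => expR (- (s * qform x y p))).
Proof.
move=> s0 y0; have k0 := qform_const_gt0 x y0.
apply: asummable_le (asummable_sqnorm (mulr_gt0 s0 k0)) => p.
rewrite ger0_norm ?expR_ge0// ler_expR lerN2 -mulrA ler_pM2l//.
exact: qform_ge_sqnorm.
Qed.

Lemma normc_int x y p :
  Normc.normc (p.1%:~R * Complex x y + p.2%:~R) ^+ 2 = (p.1%:~R * x + p.2%:~R) ^+ 2 + (p.1%:~R * y) ^+ 2.
Proof.
have E (k : int) : k%:~R = Complex (k%:~R) 0 :> R[i].
  by rewrite -(rmorph_int (real_complex R)).
rewrite !E /= sqr_sqrtr ?addr_ge0 ?sqr_ge0//.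
by rewrite !mul0r subr0 !addr0.
Qed.

Lemma theta_asum s x y : 0 < s -> 0 < y ->
  theta s (Complex x y) = asum (fun p => expR (- (pi * s * qform x y p))).
Proof.
move=> s0 y0.
have ps : 0 < pi * s by rewrite mulr_gt0// pi_gt0.
rewrite asum_nsum; [|by move=> p; exact: expR_ge0|exact: asummable_qform].
rewrite /theta /nsum; congr fine; apply: eq_esum => p _; congr EFin.
by rewrite normc_int /= /qform mulNr mulrAC -mulrA.
Qed.

Definition ntheta s x y : R := Num.sqrt s * asum (fun p => expR (- (pi * s * qform x y p))).

(** Summand of the sum obtained from Poisson summation in the second
    coordinate. *)
Definition dual s x y p : R :=
  expR (- (pi * y * (s * p.1%:~R ^+ 2 + p.2%:~R ^+ 2 / s))) * cos (2 * pi * x * (p.1%:~R * p.2%:~R)).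

Lemma dual_ge (s y : R) p : 0 < s -> 0 < y ->
   Num.min s s^-1 * sqnorm p <= s * p.1%:~R ^+ 2 + p.2%:~R ^+ 2 / s.
Proof.
move=> s0 y0; rewrite /sqnorm mulrDr lerD//.
  by rewrite ler_wpM2r ?sqr_ge0// ge_min lexx.
by rewrite mulrC ler_wpM2l ?sqr_ge0// ge_min lexx orbT.
Qed.

Lemma min_gt0 s : 0 < s -> 0 < Num.min s s^-1.
Proof. by move=> s0; rewrite lt_min s0 invr_gt0. Qed.

Lemma asummable_dual s x y : 0 < s -> 0 < y -> asummable (dual s x y).
Proof.
move=> s0 y0.
have py : 0 < pi * y by rewrite mulr_gt0// pi_gt0.
apply: asummable_le (asummable_sqnorm (mulr_gt0 py (min_gt0 s0))) => p.
rewrite normrM ger0_norm ?expR_ge0// -[leRHS]mulr1 ler_pM ?expR_ge0 ?cos_max//.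
rewrite ler_expR lerN2 -[leLHS]mulrA ler_pM2l//; exact: dual_ge y0.
Qed.

(** Poisson summation in the inner variable of the double sum. *)
Lemma ntheta_dual s x y : 0 < s -> 0 < y -> ntheta s x y = Num.sqrt y * asum (dual s x y).
Proof.
move=> s0 y0; have ps : 0 < pi * s by rewrite mulr_gt0// pi_gt0.
rewrite /ntheta asum_fubini; last exact: asummable_qform.
rewrite [in RHS]asum_fubini; last exact: asummable_dual.
have ys : 0 < y / s by rewrite divr_gt0.
have E (m : int) : asum (fun n : int => expR (- (pi * s * qform x y (m, n)))) =
    Num.sqrt (y / s) * asum (fun k : int => dual s x y (m, k)).
  have := poisson (m%:~R * x) ys => H.
  rewrite (_ : (fun n : int => expR (- (pi * s * qform x y (m, n)))) =
    (fun n : int => expR (- (pi * s * m%:~R ^+ 2 * y)) * expR (- (pi * (m%:~R * x + n%:~R) ^+ 2 / (y / s))))); last first.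
    apply/funext => n; rewrite -expRD; congr expR; rewrite /qform/=.
    move: (pi) => q; field; by rewrite !gt_eqF.
  rewrite asumZ; last first.
    have := @asummable_gauss R (pi / (y / s)) (m%:~R * x); rewrite divr_gt0 ?pi_gt0// => /(_ isT).
    by apply: asummable_le => n; rewrite ger0_norm ?expR_ge0// ler_expR mulrAC.
  rewrite H mulrCA; congr (_ * _); rewrite -asumZ; last first.
    have := @asummable_gauss0 R (pi * (y / s)); rewrite mulr_gt0 ?pi_gt0// => /(_ isT).
    apply: asummable_le => n; rewrite normrM ger0_norm ?expR_ge0// -[leRHS]mulr1.
    by rewrite ler_pM ?expR_ge0 ?cos_max.
  apply: eq_asum => k; rewrite /dual /= mulrA -expRD; congr (expR _ * cos _).
    by move: (pi) => q; field; rewrite gt_eqF.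
  by move: (pi) => q; ring.
under eq_asum do rewrite E.
rewrite asumZ; last first.
  have := asummable_dual x s0 y0 => /asummable_norm su.
  have [_ S1] := nsum_fubini (fun p => normr_ge0 (dual s x y p)) su.
  apply: asummable_le S1 => m.
  have sr := asummable_row m (asummable_dual x s0 y0).
  rewrite -asum_nsum//; last exact: asummable_norm.
  by apply: asum_norm => //; exact: asummable_norm.
rewrite mulrA -sqrtrM ?ltW//; congr (Num.sqrt _ * _).
by field; rewrite gt_eqF.
Qed.

(** Replacing s by 1/s exchanges the two indices of the dual sum. *)
Lemma ntheta_inv s x y : 0 < s -> 0 < y -> ntheta s^-1 x y = ntheta s x y.
Proof.
move=> s0 y0; rewrite !ntheta_dual ?invr_gt0//; congr (_ * _).
pose swap p := (p.2, p.1).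
rewrite (@reindex_asum _ _ _ swap); last by exists swap => -[].
apply: eq_asum => p; rewrite /dual /swap /= invrK; congr (expR (- (_ * _)) * cos _); ring.
Qed.
End lattice.

(** * The slope in s, directly and in dual form *)

Section sderiv.
Variable R : realType.
Implicit Types (s x y a z : R) (p : int * int).

Lemma is_derive_uniq (f : R -> R) (x a b : R) : is_derive x 1 f a -> is_derive x 1 f b -> a = b.
Proof. by move=> [_ <-] [_ <-]. Qed.

Definition Psi (t : R) : R := (t - 1 / 2) * expR (- t).

Lemma mul_exp_le (k t : R) : 0 < k -> t * expR (- (k * t)) <= 2 / k * expR (- (k / 2 * t)).
Proof.
move=> k0.
have -> : expR (- (k * t)) = expR (- (k / 2 * t)) * expR (- (k / 2 * t)).
  by rewrite -expRD; congr expR; field.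
rewrite mulrA ler_wpM2r ?expR_ge0// expRN ler_pdivrMr ?expR_gt0//.
have := expR_ge1Dx (k / 2 * t).
have k1 : 0 < 2 / k by rewrite divr_gt0.
have E : 2 / k * (1 + k / 2 * t) = 2 / k + t by field; rewrite gt_eqF.
by move=> h; apply: le_trans (ler_wpM2l (ltW k1) h); rewrite E lerDr ltW.
Qed.

(** This is - s dF/ds; see [derive_ntheta]. *)
Definition slope s x y : R := Num.sqrt s * asum (fun p => Psi (pi * s * qform x y p)).

Lemma asummable_QQ s x y : 0 < s -> 0 < y ->
  asummable (fun p => qform x y p * expR (- (s * qform x y p))).
Proof.
move=> s0 y0; have s2 : 0 < s / 2 by lra.
apply: asummable_le (asummableZ (2 / s) (asummable_qform x s2 y0)) => p.
rewrite ger0_norm; first exact: mul_exp_le.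
by apply: mulr_ge0; [exact: qform_ge0|exact: expR_ge0].
Qed.

Lemma asummable_Psi s x y : 0 < s -> 0 < y -> asummable (fun p => Psi (pi * s * qform x y p)).
Proof.
move=> s0 y0; have ps : 0 < pi * s by rewrite mulr_gt0// pi_gt0.
have A := asummableZ (pi * s) (asummable_QQ x ps y0).
have B := asummableZ (1 / 2) (asummable_qform x ps y0).
rewrite (_ : (fun p => _) = (fun p => pi * s * (qform x y p * expR (- (pi * s * qform x y p))) -
   1 / 2 * expR (- (pi * s * qform x y p)))); first exact: asummableB.
by apply/funext => p; rewrite /Psi mulrBl mulrA.
Qed.

Lemma derive_ntheta s x y : 0 < s -> 0 < y ->
  is_derive s 1 (fun t => ntheta t x y) (- (slope s x y / s)).
Proof.
move=> s0 y0; have p0 := pi_gt0 R.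
have s2 : 0 < s / 2 by lra.
have ps : 0 < pi * s by rewrite mulr_gt0.
have ps2 : 0 < pi * (s / 2) by rewrite mulr_gt0.
have A : is_derive s 1 (fun t => asum (fun p => expR (- (pi * t * qform x y p))))
    (asum (fun p => - (pi * (qform x y p * expR (- (pi * s * qform x y p)))))).
  apply: (@is_derive_asum _ _ _ (fun t p => - (pi * (qform x y p * expR (- (pi * t * qform x y p)))))
     (fun p => pi * (qform x y p * expR (- (pi * (s / 2) * qform x y p)))) s (s / 2) (2 * s)).
  - by apply/andP; split; lra.
  - by apply: asummableZ; exact: asummable_QQ.
  - move=> t /andP[t1 _]; apply: asummable_qform => //.
    by rewrite mulr_gt0//; exact: lt_le_trans t1.
  - by move=> t p _; dsolve; rewrite /=; ring.
  - move=> t p /andP[t1 _]; have q0 := @qform_ge0 _ x y p y0.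
    rewrite normrN ger0_norm; last by apply: mulr_ge0; [exact: ltW|apply: mulr_ge0; rewrite ?expR_ge0].
    by rewrite ler_pM2l// ler_wpM2l// ler_expR lerN2 ler_wpM2r// ler_pM2l.
have B : is_derive s 1 (@Num.sqrt R) (2 * Num.sqrt s)^-1 by exact: is_derive1_sqrt.
suff -> : - (slope s x y / s) = (2 * Num.sqrt s)^-1 * asum (fun p => expR (- (pi * s * qform x y p))) +
   Num.sqrt s * asum (fun p => - (pi * (qform x y p * expR (- (pi * s * qform x y p))))) by exact: (dmul B A).
rewrite /slope.
have -> : asum (fun p => Psi (pi * s * qform x y p)) =
  - s * asum (fun p => - (pi * (qform x y p * expR (- (pi * s * qform x y p))))) -
  1 / 2 * asum (fun p => expR (- (pi * s * qform x y p))).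
  rewrite -asumZ; last by apply: asummableN; apply: asummableZ; exact: asummable_QQ.
  rewrite -asumZ; last exact: asummable_qform.
  rewrite -asumB; last 2 first.
  - by apply: asummableZ; apply: asummableN; apply: asummableZ; exact: asummable_QQ.
  - by apply: asummableZ; exact: asummable_qform.
  by apply: eq_asum => p; rewrite /Psi; ring.
move: (asum _) (asum _) => u v.
have r0 : Num.sqrt s != 0 by rewrite gt_eqF// sqrtr_gt0.
have sE : s = Num.sqrt s ^+ 2 by rewrite sqr_sqrtr// ltW.
move: (Num.sqrt s) r0 sE => r r0 ->.
by field.
Qed.

Definition dual_weight z p : R := p.1%:~R ^+ 2 * z - p.2%:~R ^+ 2.
Definition dual_form z p : R := p.1%:~R ^+ 2 * z + p.2%:~R ^+ 2.

Lemma dual_form_ge0 z p : 0 <= z -> 0 <= dual_form z p.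
Proof. by move=> z0; apply: addr_ge0; rewrite ?sqr_ge0//; apply: mulr_ge0; rewrite ?sqr_ge0. Qed.

Lemma dual_form_ge z p : 1 <= z -> sqnorm R p <= dual_form z p.
Proof.
move=> z1; rewrite /dual_form /sqnorm lerD2r; have := sqr_ge0 (p.1%:~R : R); nra.
Qed.

Lemma dual_weight_dual_form z p : 0 <= z -> `|dual_weight z p| <= dual_form z p.
Proof.
move=> z0; rewrite ler_norml /dual_weight /dual_form.
have h1 : 0 <= p.1%:~R ^+ 2 * z by rewrite mulr_ge0// sqr_ge0.
by have h2 := sqr_ge0 (p.2%:~R : R); apply/andP; split; lra.
Qed.

Definition phase x p : R := cos (2 * pi * x * (p.1%:~R * p.2%:~R)).

(** Summand of the dual form of the slope, for a = pi y / s and z = s^2. *)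
Definition dual_slope a z x p : R := dual_weight z p * expR (- (a * dual_form z p)) * phase x p.

Lemma dualE s x y p : 0 < s -> dual s x y p = expR (- (pi * y / s * dual_form (s ^+ 2) p)) * phase x p.
Proof.
move=> s0; rewrite /dual /phase /dual_form; congr (expR (- _) * _).
by move: (pi) => q; field; rewrite gt_eqF.
Qed.

Lemma asummable_dual_weight a z x : 0 < a -> 0 < z -> asummable (dual_slope a z x).
Proof.
move=> a0 z0; pose k := Num.min z 1.
have k0 : 0 < k by rewrite lt_min z0 ltr01.
have kc p : k * sqnorm R p <= dual_form z p.
  rewrite /sqnorm /dual_form mulrDr lerD//; first by rewrite mulrC ler_wpM2l ?sqr_ge0// ge_min lexx.
  by rewrite ler_piMl ?sqr_ge0// ge_min lexx orbT.
have a2 : 0 < a / 2 by lra.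
apply: asummable_le (asummableZ (2 / a) (asummable_sqnorm (mulr_gt0 a2 k0))) => p.
rewrite normrM normrM (ger0_norm (expR_ge0 _)).
apply: (@le_trans _ _ (dual_form z p * expR (- (a * dual_form z p)))).
  rewrite -[leRHS]mulr1; apply: ler_pM => //; last exact: cos_max.
  by rewrite ler_wpM2r ?expR_ge0// dual_weight_dual_form// ltW.
apply: le_trans (mul_exp_le _ a0) _.
by rewrite ler_wpM2l ?divr_ge0 ?(ltW a0)// ler_expR lerN2 -[leLHS]mulrA ler_pM2l.
Qed.

Lemma derive_ntheta_dual s x y : 0 < s -> 0 < y ->
  is_derive s 1 (fun t => ntheta t x y)
   (- (Num.sqrt y * (pi * y / s) * asum (dual_slope (pi * y / s) (s ^+ 2) x) / s)).
Proof.
move=> s0 y0; have p0 := pi_gt0 R; have py : 0 < pi * y by rewrite mulr_gt0.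
have s2 : 0 < s / 2 by lra.
have H : is_derive s 1 (fun t => Num.sqrt y * asum (dual t x y))
    (0 * asum (dual s x y) + Num.sqrt y * asum (fun p => - (pi * y * (p.1%:~R ^+ 2 - p.2%:~R ^+ 2 / s ^+ 2)) * dual s x y p)).
  apply: (@dmul _ (fun=> Num.sqrt y) (fun t => asum (dual t x y)) s 0 _ (dcst _ _)).
  pose k := Num.min (s / 2) (2 * s)^-1.
  have k0 : 0 < k by rewrite lt_min s2 invr_gt0 mulr_gt0.
  apply: (@is_derive_asum _ _ _ (fun t p => - (pi * y * (p.1%:~R ^+ 2 - p.2%:~R ^+ 2 / t ^+ 2)) * dual t x y p)
     (fun p => pi * y * (1 + 4 / s ^+ 2) * ((1 + sqnorm R p) ^+ 1 * expR (- (pi * y * k * sqnorm R p)))) s (s / 2) (2 * s)).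
  - by apply/andP; split; lra.
  - by apply: asummableZ; apply: asummable_poly; rewrite mulr_gt0.
  - move=> t /andP[t1 _]; apply: asummable_dual => //; exact: lt_le_trans t1.
  - move=> t p /andP[t1 _]; have t0 : 0 < t by exact: lt_le_trans t1.
    by rewrite /dual; dsolve; [rewrite gt_eqF|rewrite /=; move: (pi) => q; field; rewrite gt_eqF].
  - move=> t p /andP[t1 t2]; have t0 : 0 < t by exact: lt_le_trans t1.
    rewrite normrM normrN normrM (gtr0_norm py) -[leRHS]mulrA -[leLHS]mulrA ler_pM2l//.
    rewrite expr1 mulrA; apply: ler_pM => //.
      have ti : t ^-2 <= 4 / s ^+ 2.
        rewrite -[leRHS]invrK lef_pV2 ?posrE ?invr_gt0 ?exprn_gt0 ?divr_gt0//; last by rewrite exprn_gt0.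
        by rewrite invf_div ler_pdivrMr//; nra.
      have q0 : 0 < 4 / s ^+ 2 by rewrite divr_gt0// exprn_gt0.
      apply: le_trans (ler_normB _ _) _.
      rewrite !ger0_norm ?divr_ge0 ?sqr_ge0// /sqnorm.
      have m0 := sqr_ge0 (p.1%:~R : R); have n0 := sqr_ge0 (p.2%:~R : R).
      have := ler_wpM2l n0 ti; nra.
    rewrite /dual normrM ger0_norm ?expR_ge0// -[leRHS]mulr1 ler_pM ?expR_ge0 ?cos_max//.
    rewrite ler_expR lerN2 -[leLHS]mulrA ler_pM2l// /sqnorm mulrDr lerD//.
      by rewrite ler_wpM2r ?sqr_ge0// ge_min t1.
    rewrite mulrC ler_wpM2l ?sqr_ge0// ge_min; apply/orP; right.
    by rewrite lef_pV2 ?posrE ?mulr_gt0.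
have E : is_derive s 1 (fun t => ntheta t x y) (0 * asum (dual s x y) + Num.sqrt y * asum (fun p => - (pi * y * (p.1%:~R ^+ 2 - p.2%:~R ^+ 2 / s ^+ 2)) * dual s x y p)).
  apply: near_eq_is_derive H.
  near=> t; rewrite ntheta_dual//; near: t.
  exact: lt_nbhsr.
set e := - _.
rewrite (_ : e = 0 * asum (dual s x y) + Num.sqrt y * asum (fun p => - (pi * y * (p.1%:~R ^+ 2 - p.2%:~R ^+ 2 / s ^+ 2)) * dual s x y p))//.
have pys : 0 < pi * y / s by rewrite divr_gt0.
rewrite mul0r add0r /e; move: (asummable_dual_weight x pys (exprn_gt0 2 s0)) => sd.
have E2 : asum (fun p => - (pi * y * (p.1%:~R ^+ 2 - p.2%:~R ^+ 2 / s ^+ 2)) * dual s x y p) =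
   - (pi * y / s / s) * asum (dual_slope (pi * y / s) (s ^+ 2) x).
  rewrite -asumZ//; apply: eq_asum => p; rewrite dualE// /dual_slope /dual_weight.
  move: (expR _) (phase _ _) => u v; move: (pi : R) => q.
  by field; rewrite gt_eqF.
by rewrite E2; move: (asum (dual_slope _ _ _)) => u; move: (pi * y / s) => v; ring.
Unshelve. all: by end_near. Qed.

(** Both forms are the derivative of the same function. *)
Lemma slope_dual s x y : 0 < s -> 0 < y ->
  slope s x y = Num.sqrt y * (pi * y / s) * asum (dual_slope (pi * y / s) (s ^+ 2) x).
Proof.
move=> s0 y0; have := is_derive_uniq (derive_ntheta x s0 y0) (derive_ntheta_dual x s0 y0).
move/oppr_inj; apply: mulIf; by rewrite invr_eq0 gt_eqF.
Qed.
End sderiv.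

(** * Numerical bounds *)

Section numerics.
Variable R : realType.
Implicit Types (x t : R).

Lemma expR_ge_quad x : 0 <= x -> 1 + x + x ^+ 2 / 2 <= expR x.
Proof.
move=> x0; rewrite -subr_ge0.
have D t : is_derive t 1 (fun t => expR t - (1 + t + t ^+ 2 / 2)) (expR t - (1 + t)).
  by dsolve; rewrite /=; field.
have := derive_ge0_le x0 (fun t _ => D t).
rewrite expR0 expr0n/= mul0r !addr0 subrr; apply => t _.
by rewrite subr_ge0 expR_ge1Dx.
Qed.

Lemma expR_ge_cub x : 0 <= x -> 1 + x + x ^+ 2 / 2 + x ^+ 3 / 6 <= expR x.
Proof.
move=> x0; rewrite -subr_ge0.
have D t : is_derive t 1 (fun t => expR t - (1 + t + t ^+ 2 / 2 + t ^+ 3 / 6)) (expR t - (1 + t + t ^+ 2 / 2)).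
  by dsolve; rewrite /=; field.
have := derive_ge0_le x0 (fun t _ => D t).
rewrite expR0 !expr0n/= !mul0r !addr0 subrr; apply => t /andP[t0 _].
by rewrite subr_ge0 expR_ge_quad.
Qed.

Lemma expR_ge_quart x : 0 <= x -> 1 + x + x ^+ 2 / 2 + x ^+ 3 / 6 + x ^+ 4 / 24 <= expR x.
Proof.
move=> x0; rewrite -subr_ge0.
have D t : is_derive t 1 (fun t => expR t - (1 + t + t ^+ 2 / 2 + t ^+ 3 / 6 + t ^+ 4 / 24))
   (expR t - (1 + t + t ^+ 2 / 2 + t ^+ 3 / 6)).
  by dsolve; rewrite /=; field.
have := derive_ge0_le x0 (fun t _ => D t).
rewrite expR0 !expr0n/= !mul0r !addr0 subrr; apply => t /andP[t0 _].
by rewrite subr_ge0 expR_ge_cub.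
Qed.

Lemma expRN_le_quad x : 0 <= x -> expR (- x) <= 1 - x + x ^+ 2 / 2.
Proof.
move=> x0; rewrite -subr_ge0.
have D t : is_derive t 1 (fun t => (1 - t + t ^+ 2 / 2) - expR (- t)) (expR (- t) - (1 - t)).
  by dsolve; rewrite /=; field.
have := derive_ge0_le x0 (fun t _ => D t).
rewrite !oppr0 expR0 expr0n/= mul0r !addr0 subrr; apply => t _.
by rewrite subr_ge0 expR_ge1Dx.
Qed.

Lemma expRN_ge_cub x : 0 <= x -> 1 - x + x ^+ 2 / 2 - x ^+ 3 / 6 <= expR (- x).
Proof.
move=> x0; rewrite -subr_ge0.
have D t : is_derive t 1 (fun t => expR (- t) - (1 - t + t ^+ 2 / 2 - t ^+ 3 / 6))
   ((1 - t + t ^+ 2 / 2) - expR (- t)).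
  by dsolve; rewrite /=; field.
have := derive_ge0_le x0 (fun t _ => D t).
rewrite !expr0n/= !mul0r !oppr0 expR0 !addr0 subrr; apply => t /andP[t0 _].
by rewrite subr_ge0 expRN_le_quad.
Qed.

(** All numerical bounds of exponentials come from this one and from Taylor
    polynomials. *)
Lemma expR1_ge : 65 / 24 <= expR 1 :> R.
Proof. by apply: le_trans (expR_ge_quart ler01); rewrite !expr1n; lra. Qed.

Lemma expRN1_le : expR (- 1) <= 24 / 65 :> R.
Proof.
rewrite expRN -[leRHS]invrK lef_pV2 ?posrE ?expR_gt0 ?invr_gt0//.
by rewrite invf_div expR1_ge.
Qed.

Lemma cos_pi3 : cos (pi / 3) = 1 / 2 :> R.
Proof.
have p0 := pi_gt0 R.
have s0 : sin (pi / 3) != 0 :> R by rewrite gt_eqF// sin_gt0_pi//; apply/andP; split; lra.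
have : sin ((pi / 3) *+ 2) = sin (pi / 3) :> R.
  have -> : (pi / 3) *+ 2 = pi - pi / 3 :> R by move: (pi) => q; field.
  by rewrite sinB sinpi cospi; ring.
rewrite sin_mulr2n => E; apply: (mulIf s0); apply: (mulIf (x := 2)) => //; rewrite -[in RHS]E; by field.
Qed.

(** The value of sin (pi/3) follows from sin (2 pi/3) = sin (pi/3). *)
Lemma sin_pi3 : sin (pi / 3) = Num.sqrt 3 / 2 :> R.
Proof.
have p0 := pi_gt0 R.
have s0 : 0 <= sin (pi / 3) :> R by rewrite ltW// sin_gt0_pi//; apply/andP; split; lra.
have := sin2cos2 (pi / 3 : R); rewrite cos_pi3 => E.
rewrite -[LHS]ger0_norm// -sqrtr_sqr E.
have -> : 1 - (1 / 2) ^+ 2 = 3 * (1 / 2) ^+ 2 :> R by field.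
rewrite sqrtrM// sqrtr_sqr ger0_norm; last by lra.
by rewrite mul1r.
Qed.

Lemma sqrt3_bnd : 168 / 97 <= Num.sqrt (3 : R) <= 97 / 56.
Proof.
have s0 : 0 <= Num.sqrt 3 :> R by exact: sqrtr_ge0.
have E : Num.sqrt 3 ^+ 2 = 3 :> R by rewrite sqr_sqrtr.
move: (Num.sqrt 3) s0 E => r s0; rewrite expr2 => E; apply/andP; split; nra.
Qed.

Lemma pi_gt31 : 31 / 10 < pi :> R.
Proof.
have p0 := pi_gt0 R.
have c6 : cos (pi / 6) ^+ 2 = 3 / 4 :> R.
  have := cos_mulr2n (pi / 6 : R).
  have -> : (pi / 6) *+ 2 = pi / 3 :> R by move: (pi) => q; field.
  by rewrite cos_pi3 => E; lra.
have c60 : 0 <= cos (pi / 6) :> R by apply: cos_ge0_pihalf; apply/andP; split; lra.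
have := cos_ge_quad (pi / 6 : R).
move: (cos _) c6 c60 => c c6 c0 h.
have c1 : c <= 97 / 112 by rewrite expr2 in c6; nra.
have h2 : 15 / 56 <= (pi / 6) ^+ 2 :> R by lra.
move: h2; move: (pi) p0 => q q0; rewrite expr2; nra.
Qed.
End numerics.

(** * Large s, near the hexagonal point *)

Section near.
Variable R : realType.
Implicit Types (s x y a z : R) (p : int * int).

Lemma Psi_quad_left a v : 34 / 5 <= a -> 0 <= v -> v <= 19 / 44 ->
  Psi a + a * (a - 3 / 2) * expR (- a) * (v * (1 + v)) <= Psi (a * (1 - v)).
Proof.
move=> a0 v0 v1.
have av0 : 0 <= a * v by apply: mulr_ge0 => //; lra.
have h := expR_ge_cub av0.
rewrite /Psi (_ : - (a * (1 - v)) = - a + a * v); last by ring.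
rewrite expRD.
have e0 := expR_gt0 (- a).
have A0 : 0 < a * (1 - v) - 1 / 2.
  have : 34 / 5 * (25 / 44) <= a * (1 - v) by apply: ler_pM; lra.
  by lra.
have -> : (a - 1 / 2) * expR (- a) + a * (a - 3 / 2) * expR (- a) * (v * (1 + v)) =
  expR (- a) * ((a - 1 / 2) + a * (a - 3 / 2) * (v * (1 + v))) by ring.
have -> : (a * (1 - v) - 1 / 2) * (expR (- a) * expR (a * v)) =
  expR (- a) * ((a * (1 - v) - 1 / 2) * expR (a * v)) by ring.
rewrite ler_pM2l//; apply: le_trans (ler_wpM2l (ltW A0) h).
rewrite -subr_ge0.
have -> : (a * (1 - v) - 1 / 2) * (1 + a * v + (a * v) ^+ 2 / 2 + (a * v) ^+ 3 / 6) -
  (a - 1 / 2 + a * (a - 3 / 2) * (v * (1 + v))) =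
  (a * v) ^+ 2 * ((a / 2 - 9 / 4) + a * v * (a * (1 - v) / 6 - 7 / 12)) + 3 / 2 * a * v ^+ 2.
  by field.
have k1 : 0 <= a * (1 - v) / 6 - 7 / 12.
  have : 34 / 5 * (25 / 44) <= a * (1 - v) by apply: ler_pM; lra.
  by lra.
apply: addr_ge0.
  apply: mulr_ge0; first exact: sqr_ge0.
  by apply: addr_ge0; [lra|exact: mulr_ge0].
by apply: mulr_ge0; [lra|exact: sqr_ge0].
Qed.

Lemma Psi_quad_right a u : 34 / 5 <= a -> 0 <= u -> u <= 19 / 25 ->
  Psi a + a * (a - 3 / 2) * expR (- a) * (u * (u - 1)) <= Psi (a * (1 + u)).
Proof.
move=> a0 u0 u1.
have au0 : 0 <= a * u by apply: mulr_ge0 => //; lra.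
have h := expRN_ge_cub au0.
rewrite /Psi (_ : - (a * (1 + u)) = - a + - (a * u)); last by ring.
rewrite expRD.
have e0 := expR_gt0 (- a).
have A0 : 0 < a * (1 + u) - 1 / 2 by lra.
have -> : (a - 1 / 2) * expR (- a) + a * (a - 3 / 2) * expR (- a) * (u * (u - 1)) =
  expR (- a) * ((a - 1 / 2) + a * (a - 3 / 2) * (u * (u - 1))) by ring.
have -> : (a * (1 + u) - 1 / 2) * (expR (- a) * expR (- (a * u))) =
  expR (- a) * ((a * (1 + u) - 1 / 2) * expR (- (a * u))) by ring.
rewrite ler_pM2l//.
have [wle|wge] := lerP (a * u) (8 / 5).
  apply: le_trans (ler_wpM2l (ltW A0) h).
  rewrite -subr_ge0.
  have -> : (a * (1 + u) - 1 / 2) * (1 - a * u + (a * u) ^+ 2 / 2 - (a * u) ^+ 3 / 6) -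
    (a - 1 / 2 + a * (a - 3 / 2) * (u * (u - 1))) =
    a * u ^+ 2 * (a * ((a / 2 - 9 / 4) - (a / 6 - 7 / 12) * (a * u) - (a * u) ^+ 2 / 6) + 3 / 2).
    by field.
  apply: mulr_ge0; first by apply: mulr_ge0; [lra|exact: sqr_ge0].
  set w := a * u in wle au0 *.
  have k1 : (a / 6 - 7 / 12) * w <= (a / 6 - 7 / 12) * (8 / 5) by apply: ler_wpM2l; lra.
  have k2 : w ^+ 2 <= 64 / 25 by rewrite expr2; nra.
  have k3 : (7 * a / 30 - 523 / 300) <= (a / 2 - 9 / 4) - (a / 6 - 7 / 12) * w - w ^+ 2 / 6 by lra.
  have k4 : a * (7 * a / 30 - 523 / 300) <= a * ((a / 2 - 9 / 4) - (a / 6 - 7 / 12) * w - w ^+ 2 / 6).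
    by apply: ler_wpM2l => //; lra.
  nra.
apply: (@le_trans _ _ 0); last by rewrite mulr_ge0 ?expR_ge0// ltW.
have k1 : a - 1 / 2 <= 8 / 5 * (1 - 8 / 5 / a) * (a - 3 / 2).
  rewrite -(ler_pM2l (_ : 0 < a)); last by lra.
  have -> : a * (8 / 5 * (1 - 8 / 5 / a) * (a - 3 / 2)) = 8 / 5 * (a - 8 / 5) * (a - 3 / 2).
    by field; rewrite gt_eqF//; lra.
  nra.
have ai : a^-1 <= 5 / 34 by rewrite -[leRHS]invrK lef_pV2 ?posrE ?invr_gt0; lra.
have k2 : 8 / 5 / a * (1 - 8 / 5 / a) <= u * (1 - u).
  have al : 8 / 5 / a <= u by rewrite ler_pdivrMr; [lra|lra].
  rewrite -subr_ge0.
  have -> : u * (1 - u) - 8 / 5 / a * (1 - 8 / 5 / a) = (u - 8 / 5 / a) * (1 - u - 8 / 5 / a) by ring.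
  by apply: mulr_ge0; lra.
have k3 : a * (a - 3 / 2) * (8 / 5 / a * (1 - 8 / 5 / a)) <= a * (a - 3 / 2) * (u * (1 - u)).
  by apply: ler_wpM2l => //; apply: mulr_ge0; lra.
have k4 : a * (a - 3 / 2) * (8 / 5 / a * (1 - 8 / 5 / a)) = 8 / 5 * (1 - 8 / 5 / a) * (a - 3 / 2).
  by field; rewrite gt_eqF//; lra.
lra.
Qed.

(** This parabola takes the value Psi a at x = 1 and x = 2 and is tangent to x
    |-> Psi (a x) at x = 1. Taylor polynomials of the exponential suffice for
    x in [25/44, 44/25]. *)
Lemma Psi_quad a x : 34 / 5 <= a -> 25 / 44 <= x -> x <= 44 / 25 ->
  Psi a + a * (a - 3 / 2) * expR (- a) * ((x - 1) * (x - 2)) <= Psi (a * x).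
Proof.
move=> a0 x0 x1; have [xl|xg] := lerP x 1.
  have := @Psi_quad_left a (1 - x) a0.
  rewrite (_ : 1 - (1 - x) = x); last by ring.
  rewrite (_ : (1 - x) * (1 + (1 - x)) = (x - 1) * (x - 2)); last by ring.
  by apply; lra.
have := @Psi_quad_right a (x - 1) a0.
rewrite (_ : 1 + (x - 1) = x); last by ring.
rewrite (_ : (x - 1) * (x - 1 - 1) = (x - 1) * (x - 2)); last by ring.
by apply; lra.
Qed.

(** The norm form of the Eisenstein integers. *)
Definition hex_norm p : R := p.1%:~R ^+ 2 + p.1%:~R * p.2%:~R + p.2%:~R ^+ 2.
Definition hex_scale : R := 2 / Num.sqrt 3.
(** Multiplication by a cube root of unity. *)
Definition hex_rot p : int * int := (- p.1 - p.2, p.1).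

Lemma hex_scale_bnd : 112 / 97 <= hex_scale <= 97 / 84.
Proof.
have /andP[h1 h2] := sqrt3_bnd R; rewrite /hex_scale.
by rewrite ler_pdivlMr ?ler_pdivrMr; lra.
Qed.

Lemma hex_scale_sq : hex_scale ^+ 2 = 4 / 3.
Proof. by rewrite /hex_scale expr_div_n sqr_sqrtr//; field. Qed.

Lemma qform_hex p : qform (1 / 2) (Num.sqrt 3 / 2) p = hex_scale * hex_norm p.
Proof.
have /andP[h1 h2] := sqrt3_bnd R.
have E : Num.sqrt 3 ^+ 2 = 3 :> R by rewrite sqr_sqrtr.
rewrite /qform /hex_norm /hex_scale; move: (Num.sqrt 3) h1 h2 E => r h1 h2 E.
have r0 : r != 0 by rewrite gt_eqF//; lra.
apply: (mulIf (x := r / 2)); first by rewrite mulf_neq0// invr_eq0.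
rewrite mulfVK ?mulf_neq0 ?invr_eq0//.
have -> : 2 / r * (p.1%:~R ^+ 2 + p.1%:~R * p.2%:~R + p.2%:~R ^+ 2) * (r / 2) =
 (p.1%:~R ^+ 2 + p.1%:~R * p.2%:~R + p.2%:~R ^+ 2) :> R by field.
by rewrite !exprMn E; field.
Qed.

Lemma hex_rot_bij : bijective hex_rot.
Proof.
exists (fun p => (p.2, - p.1 - p.2)) => -[m n]; rewrite /hex_rot /=; congr (_, _); ring.
Qed.

Lemma hex_norm_hex_rot p : hex_norm (hex_rot p) = hex_norm p.
Proof. rewrite /hex_norm /hex_rot /= intrB rmorphN /=; ring. Qed.

Lemma hex_norm_ge1 p : p != (0, 0) -> 1 <= hex_norm p.
Proof.
move=> p0; have -> : hex_norm p = (p.1 ^+ 2 + p.1 * p.2 + p.2 ^+ 2)%:~R.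
  by rewrite !intrD intrM !rmorphXn.
rewrite -[1]/(1%:~R) ler_int; case: p p0 => m n /=; rewrite xpair_eqE negb_and.
have sq (k : int) : 0 <= k * k by rewrite -expr2 sqr_ge0.
have z (k : int) : k * k <= 0 -> k = 0.
  move=> kk; have /eqP : k * k = 0 by apply/eqP; rewrite eq_le kk sq.
  by rewrite mulf_eq0 => /orP[] /eqP.
have h1 := sq (2 * m + n); have h2 := sq n; have h3 := sq m; have h4 := sq (m + 2 * n).
rewrite !expr2 => h; rewrite leNgt; apply/negP => h5.
have m0 : m = 0 by apply: z; lia.
have n0 : n = 0 by apply: z; lia.
by move: h; rewrite m0 n0.
Qed.

Lemma qform_expand x y p : y != 0 -> qform x y p = (p.1%:~R ^+ 2 * (x ^+ 2 + y ^+ 2) + 2 * x * p.1%:~R * p.2%:~R + p.2%:~R ^+ 2) / y.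
Proof. by move=> y0; rewrite /qform; field. Qed.

Lemma psd_form_ge0 (A B C m n : R) : 0 < C -> B ^+ 2 <= 4 * A * C -> 0 <= A * m ^+ 2 + B * m * n + C * n ^+ 2.
Proof.
move=> C0 D; rewrite -(pmulr_rge0 _ (_ : 0 < 4 * C)); last by lra.
have -> : 4 * C * (A * m ^+ 2 + B * m * n + C * n ^+ 2) = (2 * C * n + B * m) ^+ 2 + (4 * A * C - B ^+ 2) * m ^+ 2 by ring.
by rewrite addr_ge0 ?sqr_ge0// mulr_ge0 ?sqr_ge0// subr_ge0.
Qed.

(** The two forms differ by a factor between 1/X and X as soon as the
    discriminants of X q - h and X h - q are nonpositive; both conditions read
    K X <= X^2 + 1. *)
Lemma qform_comp x y p (X : R) : 0 < y -> 0 < X -> y^-1 < X * hex_scale -> hex_scale / X < y^-1 ->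
  hex_scale * (x ^+ 2 + y ^+ 2 + 1 - x) / y * X <= X ^+ 2 + 1 ->
  hex_scale * hex_norm p / X <= qform x y p /\ qform x y p <= X * (hex_scale * hex_norm p).
Proof.
move=> y0 X0 c1 c2 K.
have yn : y != 0 by rewrite gt_eqF.
have Xn : X != 0 by rewrite gt_eqF.
have H := hex_scale_sq.
rewrite qform_expand// /hex_norm; move: (p.1%:~R) (p.2%:~R) => m n; split; rewrite -subr_ge0.
  have -> : (m ^+ 2 * (x ^+ 2 + y ^+ 2) + 2 * x * m * n + n ^+ 2) / y - hex_scale * (m ^+ 2 + m * n + n ^+ 2) / X =
    ((x ^+ 2 + y ^+ 2) / y - hex_scale / X) * m ^+ 2 + (2 * x / y - hex_scale / X) * m * n + (y^-1 - hex_scale / X) * n ^+ 2.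
    by field; rewrite ?yn ?Xn.
  apply: psd_form_ge0; first by lra.
  rewrite -subr_ge0.
  have -> : 4 * ((x ^+ 2 + y ^+ 2) / y - hex_scale / X) * (y^-1 - hex_scale / X) - (2 * x / y - hex_scale / X) ^+ 2 =
    4 * (X ^+ 2 + 3 / 4 * hex_scale ^+ 2 - hex_scale * (x ^+ 2 + y ^+ 2 + 1 - x) / y * X) / X ^+ 2 by field; rewrite ?yn ?Xn.
  by rewrite H; apply: divr_ge0; [lra|exact: sqr_ge0].
have -> : X * (hex_scale * (m ^+ 2 + m * n + n ^+ 2)) - (m ^+ 2 * (x ^+ 2 + y ^+ 2) + 2 * x * m * n + n ^+ 2) / y =
    (X * hex_scale - (x ^+ 2 + y ^+ 2) / y) * m ^+ 2 + (X * hex_scale - 2 * x / y) * m * n + (X * hex_scale - y^-1) * n ^+ 2.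
  by field; rewrite ?yn ?Xn.
apply: psd_form_ge0; first by lra.
rewrite -subr_ge0.
have -> : 4 * (X * hex_scale - (x ^+ 2 + y ^+ 2) / y) * (X * hex_scale - y^-1) - (X * hex_scale - 2 * x / y) ^+ 2 =
    4 + 3 * hex_scale ^+ 2 * X ^+ 2 - 4 * (hex_scale * (x ^+ 2 + y ^+ 2 + 1 - x) / y * X) by field; rewrite ?yn ?Xn.
rewrite H; lra.
Qed.

Definition orbit_ratio x y p (i : nat) : R := qform x y (iter i hex_rot p) / (hex_scale * hex_norm p).

(** The sum and the sum of squares of a binary form over an orbit of the
    rotation are multiples of the norm and of its square; the expression is
    3/8 times a square. *)
Lemma orbit_sum x y p : 0 < y -> p != (0, 0) ->
  0 <= (orbit_ratio x y p 0%N - 1) * (orbit_ratio x y p 0%N - 2) + (orbit_ratio x y p 1%N - 1) * (orbit_ratio x y p 1%N - 2) + (orbit_ratio x y p 2%N - 1) * (orbit_ratio x y p 2%N - 2).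
Proof.
move=> y0 p0; set q := orbit_ratio x y p.
have yn : y != 0 by rewrite gt_eqF.
have n0 : hex_norm p != 0 by rewrite gt_eqF// (lt_le_trans ltr01)// hex_norm_ge1.
have h0 : hex_scale != 0 by rewrite gt_eqF//; have := hex_scale_bnd; lra.
pose u i := y * qform x y (iter i hex_rot p).
pose w := 2 * (x ^+ 2 + y ^+ 2 + 1 - x).
have S1 : u 0%N + u 1%N + u 2%N = hex_norm p * w.
  rewrite /u /w /= /hex_rot /= !qform_expand//= !(mulrC y) !mulfVK// !intrB !rmorphN /= intrB rmorphN/= /hex_norm; ring.
have S2 : u 0%N ^+ 2 + u 1%N ^+ 2 + u 2%N ^+ 2 = hex_norm p ^+ 2 * (w ^+ 2 / 2 - 2 * y ^+ 2).
  by rewrite /u /w /= /hex_rot /= !qform_expand//= !(mulrC y) !mulfVK// !intrB !rmorphN /= intrB rmorphN/= /hex_norm; field.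
have hi : hex_scale^-1 = 3 / 4 * hex_scale.
  by apply: (mulIf h0); rewrite mulVf//; have := hex_scale_sq; rewrite expr2; lra.
have qE i : q i = 3 / 4 * hex_scale * u i / (y * hex_norm p).
  by rewrite /q /orbit_ratio /u invfM hi; field; rewrite ?yn ?n0.
have -> : (q 0%N - 1) * (q 0%N - 2) + (q 1%N - 1) * (q 1%N - 2) + (q 2%N - 1) * (q 2%N - 2) =
  9 / 16 * hex_scale ^+ 2 * (u 0%N ^+ 2 + u 1%N ^+ 2 + u 2%N ^+ 2) / (y * hex_norm p) ^+ 2 -
  9 / 4 * hex_scale * (u 0%N + u 1%N + u 2%N) / (y * hex_norm p) + 6.
  by rewrite !qE; move: (u 0%N) (u 1%N) (u 2%N) => *; field; rewrite ?yn ?n0.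
rewrite S1 S2 hex_scale_sq.
have -> : 9 / 16 * (4 / 3) * (hex_norm p ^+ 2 * (w ^+ 2 / 2 - 2 * y ^+ 2)) / (y * hex_norm p) ^+ 2 -
  9 / 4 * hex_scale * (hex_norm p * w) / (y * hex_norm p) + 6 = 3 / 8 * ((w / y) ^+ 2 - 6 * hex_scale * (w / y) + 9 * (4 / 3)).
  by field; rewrite ?yn ?n0.
rewrite -hex_scale_sq.
have -> : (w / y) ^+ 2 - 6 * hex_scale * (w / y) + 9 * hex_scale ^+ 2 = (w / y - 3 * hex_scale) ^+ 2 by ring.
by rewrite mulr_ge0 ?sqr_ge0.
Qed.

Lemma hex_arg_ge s n : 19 / 10 <= s -> 1 <= n -> 34 / 5 <= pi * s * (hex_scale * n).
Proof.
move=> s0 n1; have hb := hex_scale_bnd; have p1 := pi_gt31 R.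
move: (pi : R) (hex_scale) hb p1 => q h /andP[h1 _] q1.
have k1 : 31 / 10 * (19 / 10) <= q * s by apply: ler_pM; lra.
have k2 : 112 / 97 * 1 <= h * n by apply: ler_pM; lra.
have : (31 / 10 * (19 / 10)) * (112 / 97 * 1) <= q * s * (h * n) by apply: ler_pM; lra.
lra.
Qed.

(** Comparison on one orbit: the parabola of [Psi_quad] at the three ratios.
    *)
Lemma orbit_Psi s x y p : 0 < y -> 19 / 10 <= s -> y^-1 < 44 / 25 * hex_scale -> hex_scale / (44 / 25) < y^-1 ->
  hex_scale * (x ^+ 2 + y ^+ 2 + 1 - x) / y * (44 / 25) <= (44 / 25) ^+ 2 + 1 ->
  3 * Psi (pi * s * (hex_scale * hex_norm p)) <=
  Psi (pi * s * qform x y p) + Psi (pi * s * qform x y (hex_rot p)) + Psi (pi * s * qform x y (hex_rot (hex_rot p))).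
Proof.
move=> y0 s0 c1 c2 K.
have [->|p0] := eqVneq p (0, 0).
  have z : qform x y (0, 0) = 0 by rewrite /qform /= !mul0r addr0 expr0n/= addr0 mul0r.
  have r0 : hex_rot (0, 0) = (0, 0) by [].
  rewrite !r0 z.
  by rewrite /hex_norm /= expr0n/= mul0r !addr0 !mulr0; lra.
have hb := hex_scale_bnd; have n1 := hex_norm_ge1 p0; have p1 := pi_gt31 R.
set a := pi * s * (hex_scale * hex_norm p).
have a0 : 34 / 5 <= a by exact: hex_arg_ge.
have hp : 0 < hex_scale * hex_norm p by rewrite mulr_gt0//; lra.
have X0 : 0 < 44 / 25 :> R by lra.
have comp r : hex_norm r = hex_norm p -> 25 / 44 <= qform x y r / (hex_scale * hex_norm p) /\ qform x y r / (hex_scale * hex_norm p) <= 44 / 25.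
  move=> e; have [q1 q2] := qform_comp r y0 X0 c1 c2 K.
  rewrite e in q1 q2; rewrite ler_pdivlMr// ler_pdivrMr//; split => //.
  by apply: le_trans q1; lra.
have E r : pi * s * qform x y r = a * (qform x y r / (hex_scale * hex_norm p)).
  have hn : hex_scale * hex_norm p != 0 by rewrite gt_eqF.
  by rewrite /a; move: (pi * s) (hex_scale * hex_norm p) (qform x y r) hn => u v w hn; field.
have T r : hex_norm r = hex_norm p ->
  Psi a + a * (a - 3 / 2) * expR (- a) * ((qform x y r / (hex_scale * hex_norm p) - 1) * (qform x y r / (hex_scale * hex_norm p) - 2)) <= Psi (pi * s * qform x y r).
  by move=> e; have [q1 q2] := comp r e; rewrite E; exact: Psi_quad.
have t0 := T p erefl; have t1 := T (hex_rot p) (hex_norm_hex_rot p).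
have t2 := T (hex_rot (hex_rot p)) (etrans (hex_norm_hex_rot _) (hex_norm_hex_rot p)).
have := orbit_sum x y0 p0; rewrite /orbit_ratio /=.
move: (qform x y p / _) (qform x y (hex_rot p) / _) (qform x y (hex_rot (hex_rot p)) / _) t0 t1 t2 => q0 q1 q2 t0 t1 t2 O.
have c0 : 0 <= a * (a - 3 / 2) * expR (- a).
  by rewrite mulr_ge0 ?expR_ge0// mulr_ge0; lra.
have := mulr_ge0 c0 O; lra.
Qed.

(** In the half fundamental domain with y <= 9/8 the lattice is close enough
    to the hexagonal one for [qform_comp] with X = 44/25. *)
Lemma FD_K x y : 0 <= x -> x <= 1 / 2 -> 1 <= x ^+ 2 + y ^+ 2 -> 0 < y -> y <= 9 / 8 ->
  hex_scale * (x ^+ 2 + y ^+ 2 + 1 - x) / y * (44 / 25) <= (44 / 25) ^+ 2 + 1.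
Proof.
move=> x0 x1 zz y0 y1; have hb := hex_scale_bnd.
have k : (x ^+ 2 + y ^+ 2 + 1 - x) / y <= 145 / 72.
  rewrite ler_pdivrMr//; have [yl|yg] := lerP 1 y; first by rewrite expr2 in zz *; nra.
  have x2 : x ^+ 2 <= x / 2 by rewrite expr2; nra.
  have y2 : 1 - y <= x ^+ 2 by rewrite !expr2 in zz *; nra.
  have y3 : (1 - y) ^+ 2 <= x ^+ 2 * x ^+ 2 by rewrite expr2; apply: ler_pM => //; lra.
  have x4 : x ^+ 2 * x ^+ 2 <= x / 2 * (1 / 4).
    by apply: ler_pM; rewrite ?sqr_ge0//; lra.
  have : (1 - y) ^+ 2 = 1 - 2 * y + y ^+ 2 by ring.
  lra.
have : hex_scale * ((x ^+ 2 + y ^+ 2 + 1 - x) / y) <= 97 / 84 * (145 / 72).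
  apply: ler_pM => //; [lra| |lra].
  apply: divr_ge0; [|lra].
  by have := sqr_ge0 y; have := sqr_ge0 x; lra.
rewrite mulrA; lra.
Qed.

(** The sum over the lattice equals one third of the sum over orbits. *)
Lemma slope_near s x y : 19 / 10 <= s -> 0 <= x -> x <= 1 / 2 -> 1 <= x ^+ 2 + y ^+ 2 -> 0 < y -> y <= 9 / 8 ->
  slope s (1 / 2) (Num.sqrt 3 / 2) <= slope s x y.
Proof.
move=> s0 x0 x1 zz y0 y1; have hb := hex_scale_bnd.
have sp : 0 < s by lra.
have K := FD_K x0 x1 zz y0 y1.
have y2 : 3 / 4 <= y ^+ 2 by rewrite !expr2 in zz *; nra.
have r3 : 0 < Num.sqrt 3 / 2 :> R by have := sqrt3_bnd R; lra.
have c1 : y^-1 < 44 / 25 * hex_scale.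
  rewrite -[y^-1]mul1r ltr_pdivrMr//; rewrite expr2 in y2.
  have : 1 < 44 / 25 * (112 / 97) * y by nra.
  by move=> h; apply: lt_le_trans h _; rewrite ler_pM2r//; lra.
have c2 : hex_scale / (44 / 25) < y^-1 by rewrite -[y^-1]mul1r ltr_pdivlMr//; nra.
rewrite /slope ler_wpM2l ?sqrtr_ge0//.
have su := asummable_Psi x sp y0.
have su1 : asummable (fun p => Psi (pi * s * qform x y (hex_rot p))) by exact: (reindex_asummable (bij_inj hex_rot_bij) su).
have su2 : asummable (fun p => Psi (pi * s * qform x y (hex_rot (hex_rot p)))) by exact: (reindex_asummable (bij_inj hex_rot_bij) su1).
have e1 : asum (fun p => Psi (pi * s * qform x y p)) = asum (fun p => Psi (pi * s * qform x y (hex_rot p))) by exact: reindex_asum hex_rot_bij.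
have e2 : asum (fun p => Psi (pi * s * qform x y (hex_rot p))) = asum (fun p => Psi (pi * s * qform x y (hex_rot (hex_rot p)))).
  exact: (@reindex_asum _ _ _ hex_rot (fun p => Psi (pi * s * qform x y (hex_rot p))) hex_rot_bij).
have sh := asummable_Psi (1 / 2) sp r3.
have : 3 * asum (fun p => Psi (pi * s * qform (1 / 2) (Num.sqrt 3 / 2) p)) <=
  asum (fun p => Psi (pi * s * qform x y p) + Psi (pi * s * qform x y (hex_rot p)) + Psi (pi * s * qform x y (hex_rot (hex_rot p)))).
  rewrite -asumZ//; apply: ler_asum.
  - exact: asummableZ.
  - by apply: asummableD => //; exact: asummableD.
  - by move=> p; rewrite qform_hex; exact: orbit_Psi.
rewrite !asumD//; last exact: asummableD.
by rewrite -e2 -e1; lra.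
Qed.
End near.

(** * Large s, y at least 9/8 *)

Section far.
Variable R : realType.
Implicit Types (s x y a z r : R) (p : int * int).

Lemma asum_prod2 (I J : choiceType) (u : I -> R) (v : J -> R) : asummable u -> asummable v ->
  asum (fun p : I * J => u p.1 * v p.2) = asum u * asum v.
Proof.
move=> su sv; rewrite asum_fubini; last exact: asummable_prod2.
rewrite [RHS]mulrC -asumZ//; apply: eq_asum => i /=.
by rewrite asumZ// mulrC.
Qed.

(** A product of geometric series, the majorant of all tails. *)
Definition geom2 r p : R := r ^+ (`|p.1| + `|p.2|)%N.

Lemma asummable_geom2 r : 0 <= r < 1 -> asummable (geom2 r).
Proof.
move=> r01; have := asummable_prod2 (asummable_geomz r01) (asummable_geomz r01).
by apply: asummable_le => p; rewrite /geom2 exprD ger0_norm// -exprD exprn_ge0//; case/andP: r01.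
Qed.

Lemma asum_geom2 r : 0 <= r < 1 -> asum (geom2 r) <= ((1 + r) / (1 - r)) ^+ 2.
Proof.
move=> r01; have /andP[r0 r1] := r01.
rewrite (@eq_asum _ _ _ (fun p => r ^+ `|p.1|%N * r ^+ `|p.2|%N)); last by move=> p; rewrite /geom2 exprD.
rewrite (asum_prod2 (asummable_geomz r01) (asummable_geomz r01)) expr2.
have k : 0 <= asum (fun i : int => r ^+ `|i|%N).
  by apply: asum_ge0 => [|i]; [exact: asummable_geomz|exact: exprn_ge0].
by apply: ler_pM => //; exact: asum_geomz_le.
Qed.

Lemma hex_norm_int p : hex_norm R p = (p.1 ^+ 2 + p.1 * p.2 + p.2 ^+ 2)%:~R.
Proof. by rewrite !intrD intrM !rmorphXn. Qed.

(** The origin and the six minimal vectors of the hexagonal lattice. *)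
Definition hex7 : seq (int * int) :=
  [:: (0, 0); (1, 0); (-1, 0); (0, 1); (0, -1); (1, -1); (-1, 1)].

Lemma hex_pos (u v : int) : 0 <= u -> 0 <= v -> u + v <= u * u + u * v + v * v.
Proof.
move=> u0 v0; have uv := mulr_ge0 u0 v0.
have h (w : int) : 0 <= w -> w <= w * w.
  move=> w0; rewrite -subr_ge0 -[X in _ - X]mulr1 -mulrBr; have [->|w1] : w = 0 \/ 0 <= w - 1 by lia.
    by rewrite mul0r.
  exact: mulr_ge0.
by have := h _ u0; have := h _ v0; lia.
Qed.

Lemma hex_neg (u v : int) : 0 < u -> u < v -> u + v <= u * u - u * v + v * v.
Proof.
move=> u0 uv; have h1 : 0 <= v * (v - u - 1) by apply: mulr_ge0; lia.
have h2 : 0 <= u * (u - 1) by apply: mulr_ge0; lia.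
by move: h1 h2; rewrite !mulrBr !mulr1 [v * u]mulrC; lia.
Qed.

Lemma hex_diag (u : int) : 1 < u -> u + u <= u * u.
Proof. by move=> u1; have : 0 <= u * (u - 2) by [apply: mulr_ge0; lia]; rewrite mulrBr; lia. Qed.

Lemma hex7_out p : p \notin hex7 ->
  2 <= hex_norm R p /\ ((`|p.1| + `|p.2|)%N%:R <= hex_norm R p).
Proof.
case: p => m n h; rewrite !hex_norm_int /=.
have H : (2 <= m * m + m * n + n * n) /\ (Posz (`|m| + `|n|) <= m * m + m * n + n * n).
  have out : 2 <= Posz (`|m| + `|n|) /\ ~ (m = 1 /\ n = -1) /\ ~ (m = -1 /\ n = 1).
    by move: h; rewrite !inE !xpair_eqE => h; lia.
  case: out => q1 [q2 q3].
  suff k : Posz (`|m| + `|n|) <= m * m + m * n + n * n.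
    by split=> //; exact: le_trans k.
  have [m0|m0] := leP 0 m; have [n0|n0] := leP 0 n.
  - by have := hex_pos m0 n0; lia.
  - have [->|n1] := eqVneq m 0; first by have := @hex_pos 0 (- n); lia.
    have [e|[e|e]] : m = - n \/ m < - n \/ - n < m by lia.
    + by have := @hex_diag m; (have -> : n = - m by lia); lia.
    + by have := @hex_neg m (- n); lia.
    + by have := @hex_neg (- n) m; lia.
  - have [->|n1] := eqVneq n 0; first by have := @hex_pos (- m) 0; lia.
    have [e|[e|e]] : n = - m \/ n < - m \/ - m < n by lia.
    + by have := @hex_diag n; (have -> : m = - n by lia); lia.
    + by have := @hex_neg n (- m); lia.
    + by have := @hex_neg (- m) n; lia.
  - have := @hex_pos (- m) (- n); lia.
rewrite !expr2; split; first by rewrite -[2]/(2%:~R) ler_int; case: H.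
by rewrite -[(_ + _)%N%:R]/((Posz (`|m| + `|n|)%N)%:~R) ler_int; case: H.
Qed.

Lemma exp_tail a (N : R) (k : nat) : 34 / 5 <= a -> 2 <= N -> k%:R <= N ->
  Psi (a * N) <= 1 / 9 * expR (- a) * (1 / 2) ^+ k.
Proof.
move=> a0 sqnorm kN.
have h1 : a * N <= 12 * expR (a * N / 12 - 1).
  by have := expR_ge1Dx (a * N / 12 - 1); lra.
have aN : 34 / 5 * N <= a * N by rewrite ler_pM2r//; lra.
have aa : a * 2 <= a * N by rewrite ler_pM2l//; lra.
have Nk : 34 / 5 * k%:R <= a * N by lra.
apply: (@le_trans _ _ (12 * expR (a * N / 12 - 1) * expR (- (a * N)))).
  by rewrite /Psi ler_wpM2r ?expR_ge0//; lra.
have h2 : expR (a * N / 12 - 1) * expR (- (a * N)) <= expR (- a) * (expR (- 1) ^+ 5 * expR (- (3 / 4)) ^+ k).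
  by rewrite -!expRM_natl -!expRD ler_expR; lra.
rewrite -mulrA; apply: (@le_trans _ _ (12 * (expR (- a) * (expR (- 1) ^+ 5 * expR (- (3 / 4)) ^+ k)))).
  by rewrite ler_pM2l.
have e1 := expRN1_le R; have ea := expR_gt0 (- a).
have e5 : expR (- 1) ^+ 5 <= 1 / 108 :> R.
  apply: (@le_trans _ _ ((24 / 65) ^+ 5)); first by rewrite lerXn2r ?nnegrE ?expR_ge0//; lra.
  by rewrite !exprS expr0; lra.
have ek : expR (- (3 / 4)) ^+ k <= (1 / 2) ^+ k :> R.
  rewrite lerXn2r ?nnegrE ?expR_ge0//.
  rewrite expRN -[leRHS]invrK lef_pV2 ?posrE ?expR_gt0 ?invr_gt0//.
  by have := @expR_ge_quad R (3 / 4); lra.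
have := ler_pM (exprn_ge0 5 (expR_ge0 (-1 : R))) (exprn_ge0 k (expR_ge0 (- (3 / 4) : R))) e5 ek.
move: (expR (-1) ^+ 5 * _) => Y; move: ((1 / 2) ^+ k : R) => W YW.
have : expR (- a) * Y <= expR (- a) * (1 / 108 * W) by rewrite ler_pM2l.
lra.
Qed.

Lemma Psi_ge0 (t : R) : 1 / 2 <= t -> 0 <= Psi t.
Proof. by move=> t0; rewrite /Psi mulr_ge0 ?expR_ge0//; lra. Qed.

(** The seven smallest terms are kept; the others are below e^(-a) / 9 times a
    geometric series of sum at most 9. *)
Lemma hex_upper s : 19 / 10 <= s ->
  slope s (1 / 2) (Num.sqrt 3 / 2) <=
  Num.sqrt s * (- (1 / 2) + 6 * Psi (pi * s * hex_scale R) + expR (- (pi * s * hex_scale R))).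
Proof.
move=> s0; rewrite /slope ler_wpM2l ?sqrtr_ge0//.
have a0 : 34 / 5 <= pi * s * hex_scale R by have := hex_arg_ge s0 (lexx 1); rewrite mulr1.
set a := pi * s * hex_scale R in a0 *.
have sp : 0 < s by lra.
have r3 : 0 < Num.sqrt 3 / 2 :> R by have := sqrt3_bnd R; lra.
have sP := asummable_Psi (1 / 2) sp r3.
have QE p : pi * s * qform (1 / 2) (Num.sqrt 3 / 2) p = a * hex_norm R p by rewrite qform_hex mulrA.
pose G p := if p \in hex7 then Psi (a * hex_norm R p) else 0.
have Gz p : p \notin hex7 -> G p = 0 by rewrite /G => /negPf ->.
have G7 : uniq hex7 by [].
have half : 0 <= (1 / 2 : R) < 1 by apply/andP; split; lra.
have sG := asummable_fin Gz; have sD := asummable_geom2 half.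
apply: (@le_trans _ _ (asum (fun p => G p + 1 / 9 * expR (- a) * geom2 (1 / 2) p))).
  apply: ler_asum => //; first by apply: asummableD => //; exact: asummableZ.
  move=> p; rewrite QE /G; case: ifPn => [_|/hex7_out[h1 h2]].
    by rewrite lerDl; apply: mulr_ge0; [apply: mulr_ge0; [lra|exact: expR_ge0]|apply: exprn_ge0; lra].
  by rewrite add0r; exact: exp_tail.
rewrite asumD//; last exact: asummableZ.
rewrite asumZ// (asum_fin G7 Gz) /hex7 !big_cons big_nil /G /=.
have hs : [/\ hex_norm R (0, 0) = 0, hex_norm R (1, 0) = 1, hex_norm R (-1, 0) = 1 & [/\ hex_norm R (0, 1) = 1, hex_norm R (0, -1) = 1, hex_norm R (1, -1) = 1 & hex_norm R (-1, 1) = 1]].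
  by rewrite !hex_norm_int.
case: hs => -> -> -> [-> -> -> ->]; rewrite mulr0 mulr1.
have -> : Psi 0 = - (1 / 2) :> R by rewrite /Psi oppr0 expR0; lra.
have D9 := asum_geom2 half.
have e0 := expR_gt0 (- a).
have D9' : asum (geom2 (1 / 2)) <= 9 :> R by apply: (le_trans D9); rewrite (_ : (1 + 1 / 2) / (1 - 1 / 2) = 3 :> R) ?expr2; [lra|field].
have : expR (- a) * asum (geom2 (1 / 2)) <= expR (- a) * 9 by rewrite ler_pM2l.
lra.
Qed.

Lemma Psi_anti (t u : R) : 3 / 2 <= t -> t <= u -> Psi u <= Psi t.
Proof.
move=> t0 tu; rewrite /Psi.
have -> : - t = - u + (u - t) by ring.
rewrite expRD mulrA [(t - 1 / 2) * _]mulrC -mulrA [leLHS]mulrC ler_pM2l ?expR_gt0//.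
have := expR_ge1Dx (u - t); have : 1 <= t - 1 / 2 by lra.
move=> k1 k2; have : (t - 1 / 2) * (1 + (u - t)) <= (t - 1 / 2) * expR (u - t) by rewrite ler_wpM2l//; lra.
have : 1 * (u - t) <= (t - 1 / 2) * (u - t) by apply: ler_wpM2r; lra.
lra.
Qed.

Lemma Psi_far_le (S h : R) : 589 / 100 <= S -> 112 / 97 <= h -> h <= 97 / 84 ->
  6 * Psi (S * h) + expR (- (S * h)) <= 2 * Psi (8 / 9 * S).
Proof.
move=> S0 h1 h2; rewrite /Psi.
set d := S * h - 8 / 9 * S.
have d0 : 25 / 16 <= d.
  have : 589 / 100 * (232 / 873) <= S * (h - 8 / 9) by apply: ler_pM; lra.
  by rewrite /d; lra.
have -> : - (8 / 9 * S) = - (S * h) + d by rewrite /d; ring.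
rewrite expRD.
have e1 : 22 / 5 <= expR d.
  have : expR (25 / 16) <= expR d by rewrite ler_expR.
  by have := @expR_ge_quart R (25 / 16); rewrite !exprS expr0; lra.
have e0 := expR_gt0 (- (S * h)).
have Sh : S * h <= S * (97 / 84) by rewrite ler_wpM2l//; lra.
have -> : 6 * ((S * h - 1 / 2) * expR (- (S * h))) + expR (- (S * h)) = expR (- (S * h)) * (6 * (S * h) - 2) by field.
have -> : 2 * ((8 / 9 * S - 1 / 2) * (expR (- (S * h)) * expR d)) = expR (- (S * h)) * ((16 / 9 * S - 1) * expR d) by field.
rewrite ler_pM2l//.
have : (16 / 9 * S - 1) * (22 / 5) <= (16 / 9 * S - 1) * expR d by rewrite ler_wpM2l//; lra.
lra.
Qed.

Lemma int_sq_ge1 (m : int) : m != 0 -> 1 <= (m%:~R : R) ^+ 2.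
Proof.
move=> m0; rewrite -rmorphXn -[1]/(1%:~R) ler_int expr2.
by have : 0 < m * m by [rewrite -expr2 exprn_even_gt0]; lia.
Qed.

(** Only the vectors (0, 1) and (0, -1) and the origin are kept from below;
    the other terms are nonnegative. *)
Lemma slope_far s x y : 19 / 10 <= s -> 9 / 8 <= y -> pi * y / s <= 4 ->
  slope s (1 / 2) (Num.sqrt 3 / 2) <= slope s x y.
Proof.
move=> s0 y0 a4; apply: le_trans (hex_upper s0) _.
rewrite /slope ler_wpM2l ?sqrtr_ge0//.
have p1 := pi_gt31 R; have sp : 0 < s by lra.
have yp : 0 < y by lra.
have sP := asummable_Psi x sp yp.
have S0 : 589 / 100 <= pi * s.
  by have : 31 / 10 * (19 / 10) <= pi * s :> R by [apply: ler_pM; lra]; lra.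
have := @Psi_far_le (pi * s) (hex_scale R) S0; have /andP[hb1 hb2] := hex_scale_bnd R => /(_ hb1 hb2) fi.
have t0 : 12 / 5 <= pi * s / y.
  rewrite ler_pdivlMr//; move: a4; rewrite ler_pdivrMr// => a4.
  have : 31 / 10 * (pi * y) <= 31 / 10 * (4 * s) by rewrite ler_pM2l//; lra.
  have : 31 / 10 * (31 / 10) <= pi * pi :> R by apply: ler_pM; lra.
  move: (pi : R) S0 a4 p1 => q S0 a4 p1 qq h.
  have : 31 / 10 * s <= q * s by rewrite ler_pM2r//; lra.
  have : 31 / 10 * y <= q * y by rewrite ler_pM2r//; lra.
  lra.
have t1 : pi * s / y <= 8 / 9 * (pi * s).
  rewrite ler_pdivrMr//; have : pi * s * (9 / 8) <= pi * s * y by rewrite ler_wpM2l//; lra.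
  lra.
have tP := @Psi_anti (pi * s / y) (8 / 9 * (pi * s)).
pose L : seq (int * int) := [:: (0, 0); (0, 1); (0, -1)].
pose G p := if p \in L then Psi (pi * s * qform x y p) else 0.
have Gz p : p \notin L -> G p = 0 by rewrite /G => /negPf ->.
have uL : uniq L by [].
apply: (@le_trans _ _ (asum G)); last first.
  apply: ler_asum => //; first exact: asummable_fin Gz.
  move=> p; rewrite /G; case: ifPn => // pL; apply: Psi_ge0.
  have [m0|m0] := eqVneq p.1 0.
    have n1 : 1 <= (p.2%:~R : R) ^+ 2.
      by apply: int_sq_ge1; apply: contraNneq pL => n0; rewrite (surjective_pairing p) m0 n0.
    have -> : qform x y p = p.2%:~R ^+ 2 / y by rewrite /qform m0 !mul0r add0r expr0n /= addr0.
    have : pi * s / y * 1 <= pi * s / y * p.2%:~R ^+ 2 by rewrite ler_wpM2l//; lra.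
    by rewrite mulr1 [_ / y * _]mulrAC -mulrA; lra.
  have m1 := int_sq_ge1 m0.
  have : y <= qform x y p.
    rewrite /qform ler_pdivlMr// (exprMn _ p.1%:~R y).
    have := sqr_ge0 (p.1%:~R * x + p.2%:~R).
    have : 1 * (y * y) <= p.1%:~R ^+ 2 * (y * y) by rewrite ler_wpM2r// mulr_ge0// ltW.
    by rewrite [y ^+ 2]expr2; lra.
  move=> yQ; have : 589 / 100 * (9 / 8) <= pi * s * qform x y p by apply: ler_pM; lra.
  lra.
rewrite (asum_fin uL Gz) /L !big_cons big_nil /G /=.
have -> : qform x y (0, 0) = 0 by rewrite /qform /= !mul0r addr0 expr0n /= addr0 mul0r.
have -> : qform x y (0, 1) = y^-1 by rewrite /qform /= !mul0r add0r expr0n /= addr0 expr1n mul1r.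
have -> : qform x y (0, -1) = y^-1 by rewrite /qform /= !mul0r add0r expr0n /= addr0 sqrrN expr1n mul1r.
rewrite mulr0; have -> : Psi 0 = - (1 / 2) :> R by rewrite /Psi oppr0 expR0; lra.
have := tP _ t1; lra.
Qed.
End far.

(** * Large s, high in the cusp *)

Section dfar.
Variable R : realType.
Implicit Types (s x y a z r : R) (p : int * int).

Lemma sqnorm_int p : sqnorm R p = (p.1 ^+ 2 + p.2 ^+ 2)%:~R.
Proof. by rewrite intrD !rmorphXn. Qed.

Lemma sqnorm_ge p : (`|p.1| + `|p.2|)%N%:R <= sqnorm R p.
Proof.
rewrite sqnorm_int -[(_ + _)%N%:R]/((Posz (`|p.1| + `|p.2|)%N)%:~R) ler_int.
have h (m : int) : `|m| <= m ^+ 2.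
  by rewrite expr2; have := normr_ge0 m; nia.
by have := h p.1; have := h p.2; lia.
Qed.

Lemma sqnorm_ge1 p : p != (0, 0) -> 1 <= sqnorm R p.
Proof.
move=> p0; rewrite sqnorm_int -[1]/(1%:~R) ler_int.
have := sqnorm_ge p; rewrite sqnorm_int -[(_ + _)%N%:R]/((Posz (`|p.1| + `|p.2|)%N)%:~R) ler_int.
suff : (0 < `|p.1| + `|p.2|)%N by lia.
by move: p0; rewrite lt0n addn_eq0 !absz_eq0 (surjective_pairing p) xpair_eqE.
Qed.

Lemma phase_le1 x p : `|phase x p| <= 1.
Proof. by rewrite ler_norml cos_geN1 cos_le1. Qed.

(** sqrt a * a * c e^(- a c) <= 8 e^(- 3 N - 1): linear bounds of the
    exponential at a = 4 and a c = 4. *)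
Lemma dual_term_le a c N : 4 <= a -> 1 <= N -> N <= c ->
  Num.sqrt a * a * (c * expR (- (a * c))) <= 8 * expR (- 1) * expR (- (3 * N)) :> R.
Proof.
move=> a4 N1 Nc.
have sa : Num.sqrt a <= 2 * expR ((a - 4) / 8).
  rewrite -(@ler_pXn2r _ 2) ?nnegrE ?sqrtr_ge0 ?mulr_ge0 ?expR_ge0//.
  rewrite sqr_sqrtr; last by lra.
  rewrite exprMn -expRM_natl (_ : 2 * ((a - 4) / 8) = a / 4 - 1); last by field.
  by rewrite expr2; have := expR_ge1Dx (a / 4 - 1); lra.
have ac : a * c <= 4 * expR (a * c / 4 - 1) by have := expR_ge1Dx (a * c / 4 - 1); lra.
have ac0 : 0 <= a * c by apply: mulr_ge0; lra.
have := ler_pM (sqrtr_ge0 a) ac0 sa ac.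
move/(ler_wpM2r (expR_ge0 (- (a * c)))) => h.
rewrite (_ : Num.sqrt a * a * (c * expR (- (a * c))) = Num.sqrt a * (a * c) * expR (- (a * c))); last by ring.
apply: le_trans h _.
have -> : 2 * expR ((a - 4) / 8) * (4 * expR (a * c / 4 - 1)) * expR (- (a * c)) =
  8 * (expR ((a - 4) / 8) * expR (a * c / 4 - 1) * expR (- (a * c))) by ring.
rewrite -[leRHS]mulrA ler_pM2l// -!expRD ler_expR.
have aN : a * N <= a * c by rewrite ler_pM2l//; lra.
have : 4 * (3 / 4 * N - 1 / 8) <= a * (3 / 4 * N - 1 / 8) by rewrite ler_pM2r; lra.
lra.
Qed.

Lemma hex_neg_bound s : 19 / 10 <= s -> slope s (1 / 2) (Num.sqrt 3 / 2) <= - (2 / 5) * Num.sqrt s.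
Proof.
move=> s0; apply: le_trans (hex_upper s0) _; rewrite [leRHS]mulrC ler_wpM2l ?sqrtr_ge0//.
have a0 : 34 / 5 <= pi * s * hex_scale R by have := hex_arg_ge s0 (lexx 1); rewrite mulr1.
move: (pi * s * hex_scale R) a0 => a a0.
rewrite /Psi.
have h : (6 * a - 2) * 10 <= expR a.
  have e5 : 140 <= expR 1 ^+ 5 :> R.
    apply: (@le_trans _ _ ((27 / 10) ^+ 5)); first by rewrite !exprS expr0; lra.
    by have := expR1_ge R => e1; rewrite lerXn2r ?nnegrE ?expR_ge0//; lra.
  have e2 : 1 + (a - 5) + (a - 5) ^+ 2 / 2 <= expR (a - 5) by apply: expR_ge_quad; lra.
  have -> : expR a = expR 1 ^+ 5 * expR (a - 5).
    by rewrite -expRM_natl -expRD; congr expR; ring.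
  have s2 := sqr_ge0 (a - 5).
  apply: le_trans (ler_pM _ _ e5 e2); [|lra|lra].
  by rewrite expr2; nra.
have e0 := expR_gt0 (- a).
have : (6 * a - 2) * expR (- a) <= 1 / 10.
  have : (6 * a - 2) * 10 * expR (- a) <= expR a * expR (- a) by rewrite ler_pM2r.
  by rewrite -expRD subrr expR0; lra.
lra.
Qed.

(** For a = pi y / s >= 4 the dual sum is at least - 2/5 in the normalisation
    by sqrt s, and the hexagonal value is below - 2/5. *)
Lemma slope_dualfar s x y : 19 / 10 <= s -> 0 < y -> 4 <= pi * y / s ->
  slope s (1 / 2) (Num.sqrt 3 / 2) <= slope s x y.
Proof.
move=> s0 y0 a4; apply: le_trans (hex_neg_bound s0) _.
have sp : 0 < s by lra.
have p1 := pi_gt31 R.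
rewrite slope_dual//; set a := pi * y / s in a4 *.
have aE : y = a * s / pi by rewrite /a; move: (pi : R) p1 => q q1; field; rewrite ?gt_eqF//; lra.
have -> : Num.sqrt y = Num.sqrt a * Num.sqrt s / Num.sqrt pi.
  have e4 (u v w : R) : 0 <= u -> 0 <= v -> 0 <= w -> Num.sqrt (u * v / w) = Num.sqrt u * Num.sqrt v / Num.sqrt w.
    by move=> u0 v0 w0; rewrite sqrtrM ?mulr_ge0// sqrtrM// sqrtrV.
  by rewrite {1}aE e4//; lra.
clearbody a; set z := s ^+ 2; have z1 : 1 <= z by rewrite /z expr2; nra.
have ap : 0 < a by lra.
have zp : 0 < z by lra.
set r := expR (- 3) : R.
have r1 : 0 <= r < 1 by rewrite expR_ge0 /= /r expR_lt1; lra.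
have r19 : r <= 1 / 19.
  rewrite /r (_ : - 3 = 3 * - 1); last by lra.
  rewrite expRM_natl; apply: (@le_trans _ _ ((24 / 65) ^+ 3)).
    by have e1 := expRN1_le R; rewrite lerXn2r ?nnegrE ?expR_ge0//; lra.
  by rewrite !exprS expr0; lra.
pose G p := 8 * expR (- 1) * (geom2 r p - (p == (0, 0))%:R).
have sd0 : asummable (fun p : int * int => (p == (0, 0))%:R : R).
  by apply: (@asummable_fin _ _ _ [:: (0, 0)]) => p; rewrite inE => /negPf ->.
have sd := asummable_geom2 r1.
have sG : asummable G by apply: asummableZ; exact: asummableB.
have st := asummable_dual_weight x ap zp.
have key p : `|Num.sqrt a * a * dual_slope a z x p| <= G p.
  rewrite /G; have [->|p0] := eqVneq p (0, 0).
    by rewrite /dual_slope /dual_weight /geom2 /= !expr0n /= mul0r subrr !mul0r mulr0 normr0 expr0 subrr mulr0.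
  rewrite subr0 !normrM (ger0_norm (sqrtr_ge0 a)) (ger0_norm (ltW ap)) (ger0_norm (expR_ge0 _)).
  have N1 := sqnorm_ge1 p0; have Nc := dual_form_ge p z1.
  apply: (@le_trans _ _ (Num.sqrt a * a * (dual_form z p * expR (- (a * dual_form z p))))).
    apply: ler_wpM2l; first by rewrite mulr_ge0 ?sqrtr_ge0// ltW.
    rewrite -[leRHS]mulr1; apply: ler_pM; rewrite ?mulr_ge0 ?expR_ge0 ?normr_ge0 ?phase_le1//.
    by rewrite ler_wpM2r ?expR_ge0// dual_weight_dual_form// ltW.
  apply: le_trans (dual_term_le a4 N1 Nc) _; rewrite ler_wpM2l ?mulr_ge0 ?expR_ge0//.
  rewrite /geom2 /r -expRM_natl ler_expR; have := sqnorm_ge p; lra.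
have B := asum_norm sG key.
rewrite asumZ// in B.
have {B} : - (asum G) <= Num.sqrt a * a * asum (dual_slope a z x).
  by move: B; rewrite ler_norml => /andP[].
have Gs : asum G <= 7 / 10.
  rewrite /G asumZ; last exact: asummableB.
  rewrite asumB// (@asum_fin _ _ (fun p : int * int => (p == (0, 0))%:R : R) [:: (0, 0)])//; last by move=> p; rewrite inE => /negPf ->.
  rewrite big_cons big_nil eqxx addr0.
  have := asum_geom2 r1; have : ((1 + r) / (1 - r)) ^+ 2 <= (10 / 9) ^+ 2.
    rewrite lerXn2r ?nnegrE ?divr_ge0//; [by case/andP: r1; lra|by case/andP: r1; lra|].
    by rewrite ler_pdivrMr; case/andP: r1; lra.
  move=> h1 h2; have h3 : asum (geom2 r) - 1 <= 19 / 81 by rewrite expr2 in h1; lra.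
  have e1 := expRN1_le R.
  have h4 : 8 * expR (- 1) * (asum (geom2 r) - 1) <= 8 * expR (- 1) * (19 / 81) by rewrite ler_wpM2l ?mulr_ge0 ?expR_ge0.
  by apply: (le_trans h4); lra.
have sqp : 7 / 4 <= Num.sqrt pi :> R.
  rewrite -[leLHS]ger0_norm; last by lra.
  by rewrite -sqrtr_sqr ler_sqrt; [rewrite expr2; lra|lra].
move=> B.
have -> : Num.sqrt a * Num.sqrt s / Num.sqrt pi * a * asum (dual_slope a z x) =
  Num.sqrt a * a * asum (dual_slope a z x) / Num.sqrt pi * Num.sqrt s by ring.
rewrite ler_wpM2r ?sqrtr_ge0//.
rewrite ler_pdivlMr; last by lra.
lra.
Qed.

Lemma slope_min_large s x y : 19 / 10 <= s -> 0 <= x -> x <= 1 / 2 -> 1 <= x ^+ 2 + y ^+ 2 -> 0 < y ->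
  slope s (1 / 2) (Num.sqrt 3 / 2) <= slope s x y.
Proof.
move=> s0 x0 x1 zz y0; have [yl|yg] := leP y (9 / 8); first exact: slope_near.
have [al|ag] := leP (pi * y / s) 4; last by apply: slope_dualfar => //; exact: ltW.
by apply: slope_far => //; exact: ltW.
Qed.
End dfar.

(** * Small s: comparison of x with 1/2 *)

Section horiz.
Variable R : realType.
Implicit Types (s x y a z r : R) (p : int * int).

Lemma abs_sin_muln (n : nat) (t : R) : `|sin (n%:R * t)| <= n%:R * `|sin t|.
Proof.
elim: n => [|n IH]; first by rewrite !mul0r sin0 normr0.
rewrite -natr1 mulrDl mul1r sinD mulrDl mul1r; apply: le_trans (ler_normD _ _) _.
rewrite !normrM; apply: lerD.
  by apply: le_trans IH; rewrite -[leRHS]mulr1 ler_wpM2l// ler_norml cos_geN1 cos_le1.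
by rewrite -[leRHS]mul1r ler_wpM2r// ler_norml cos_geN1 cos_le1.
Qed.

Lemma one_sub_cos (t : R) : 1 - cos t = 2 * sin (t / 2) ^+ 2.
Proof.
have {1}-> : t = t / 2 + t / 2 by field.
by rewrite cosD -!expr2 cos2sin2; ring.
Qed.

Lemma one_sub_cos_mul (N : int) (t : R) : 1 - cos (N%:~R * t) <= N%:~R ^+ 2 * (1 - cos t).
Proof.
wlog N0 : N / 0 <= N => [H|].
  have [/H//|N0] := leP 0 N; have := H (- N); rewrite rmorphN /= mulNr cosN sqrrN; apply; lia.
case: N N0 => // n _; rewrite !one_sub_cos [leRHS]mulrCA ler_pM2l// -exprMn -mulrA.
rewrite -[leLHS]real_normK ?num_real// -[leRHS]real_normK ?num_real//.
by rewrite lerXn2r ?nnegrE// [leRHS]normrM (ger0_norm (ler0n _ _)) abs_sin_muln.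
Qed.

(** The common factor of all the differences of phases between x and 1/2. *)
Definition kappa x : R := 1 + cos (2 * pi * x).

Lemma kappa_ge0 x : 0 <= kappa x.
Proof. by rewrite /kappa; have := cos_geN1 (2 * pi * x); lra. Qed.

Definition dphase x p : R := phase x p - phase (1 / 2) p.

Lemma phaseE x p : phase x p = phase (1 / 2) p * cos ((p.1 * p.2)%:~R * (pi - 2 * pi * x)).
Proof.
rewrite /phase -intrM; move: (p.1 * p.2) => N.
have -> : 2 * pi * x * N%:~R = N%:~R * pi - N%:~R * (pi - 2 * pi * x) by ring.
have -> : 2 * pi * (1 / 2) * N%:~R = N%:~R * pi :> R by field.
have sN : sin (N%:~R * pi) = 0 :> R by rewrite mulrC sin_pi_int.
by rewrite cosB sN mul0r addr0.
Qed.

Lemma dphase_le x p : `|dphase x p| <= (p.1%:~R ^+ 2 * p.2%:~R ^+ 2) * kappa x.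
Proof.
rewrite /dphase phaseE -exprMn -intrM; move: (p.1 * p.2) => N.
rewrite -{2}[phase _ _]mulr1 -mulrBr normrM.
have h : 1 - cos (N%:~R * (pi - 2 * pi * x)) <= N%:~R ^+ 2 * kappa x.
  by apply: le_trans (one_sub_cos_mul _ _) _; rewrite /kappa cosB cospi sinpi; lra.
apply: le_trans h; rewrite -[leRHS]mul1r.
have c1 := cos_le1 (N%:~R * (pi - 2 * pi * x)).
apply: ler_pM => //; first exact: phase_le1.
by rewrite distrC ger0_norm// subr_ge0.
Qed.

Lemma dphase_one x p : p.1 * p.2 = 1 \/ p.1 * p.2 = -1 -> dphase x p = kappa x.
Proof.
move=> H; rewrite /dphase phaseE.
have c1 : cos ((p.1 * p.2)%:~R * (pi - 2 * pi * x)) = - cos (2 * pi * x).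
  by case: H => ->; rewrite ?rmorphN1 ?mul1r ?mulN1r ?cosN cosB cospi sinpi; ring.
have -> : phase (1 / 2) p = -1 :> R.
  rewrite /phase -intrM; have -> : 2 * pi * (1 / 2) = pi :> R by field.
  by case: H => ->; rewrite ?rmorphN1 ?mulr1 ?mulrN1 ?cosN cospi.
by rewrite c1 /kappa; ring.
Qed.

Lemma expR_lip (a c d : R) : 0 <= a -> c <= d ->
  0 <= expR (- (a * c)) - expR (- (a * d)) <= a * (d - c) * expR (- (a * c)).
Proof.
move=> a0 cd; have ad : 0 <= a * (d - c) by rewrite mulr_ge0 ?subr_ge0.
have -> : - (a * d) = - (a * c) - a * (d - c) by ring.
rewrite expRD; have e0 := expR_gt0 (- (a * c)).
have h := expR_ge1Dx (- (a * (d - c))).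
have h1 : expR (- (a * (d - c))) <= 1 by rewrite -expR0 ler_expR oppr_le0.
have k1 : expR (- (a * c)) * (1 + - (a * (d - c))) <= expR (- (a * c)) * expR (- (a * (d - c))) by rewrite ler_pM2l.
have k2 : expR (- (a * c)) * expR (- (a * (d - c))) <= expR (- (a * c)) * 1 by rewrite ler_pM2l.
by apply/andP; split; lra.
Qed.

(** Pairing (m, k) with (k, m): if q1 >= q2 are the two exponentials, the pair
    is (M + K)(z - 1) q2 + (M z - K)(q1 - q2), and q1 - q2 is at most a (K -
    M)(z - 1) q1. The factor z - 1 is what makes the estimates uniform down to
    s = 1. *)
Lemma pairW a z (M K : R) : 0 <= a -> 1 <= z -> 0 <= M -> M <= K ->
  `|(M * z - K) * expR (- (a * (M * z + K))) + (K * z - M) * expR (- (a * (K * z + M)))| <=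
  (z - 1) * expR (- (a * (M * z + K))) * ((M + K) + a * (`|M * z - K| * (K - M))).
Proof.
move=> a0 z1 M0 MK.
have CC : M * z + K <= K * z + M.
  by rewrite -subr_ge0 (_ : _ - _ = (K - M) * (z - 1)); [apply: mulr_ge0; lra|ring].
have /andP[l1 l2] := expR_lip a0 CC.
set q1 := expR (- (a * (M * z + K))) in l1 l2 *; set q2 := expR (- (a * (K * z + M))) in l1 l2 *.
have q20 : 0 <= q2 by exact: expR_ge0.
have -> : (M * z - K) * q1 + (K * z - M) * q2 = (M + K) * (z - 1) * q2 + (M * z - K) * (q1 - q2) by ring.
apply: le_trans (ler_normD _ _) _; rewrite [X in X + _]ger0_norm; last first.
  by apply: mulr_ge0 => //; apply: mulr_ge0; lra.
rewrite normrM (ger0_norm l1).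
have k1 : (M + K) * (z - 1) * q2 <= (M + K) * (z - 1) * q1.
  by apply: ler_wpM2l; [apply: mulr_ge0; lra|lra].
have k2 : `|M * z - K| * (q1 - q2) <= `|M * z - K| * (a * (K * z + M - (M * z + K)) * q1).
  by apply: ler_wpM2l.
have -> : (z - 1) * q1 * (M + K + a * (`|M * z - K| * (K - M))) =
  (M + K) * (z - 1) * q1 + `|M * z - K| * (a * (K * z + M - (M * z + K)) * q1) by ring.
exact: lerD.
Qed.
End horiz.

(** * Bounds for symmetrised dual terms *)

Section horiz2.
Variable R : realType.
Implicit Types (s x y a z r : R) (p : int * int).

Lemma expR4_ge : 269 / 5 <= expR 4 :> R.
Proof.
have -> : 4 = 4 * 1 :> R by ring.
rewrite expRM_natl; apply: (@le_trans _ _ ((65 / 24) ^+ 4)); first by rewrite !exprS expr0; lra.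
by have := expR1_ge R => h; rewrite lerXn2r ?nnegrE ?expR_ge0//; lra.
Qed.

Lemma expR232_ge : 10 <= expR (58 / 25) :> R.
Proof.
have -> : 58 / 25 = 1 + (1 + 8 / 25) :> R by field.
rewrite !expRD; have e1 := expR1_ge R.
have e2 : 65 / 24 * (65 / 24) <= expR 1 * expR 1 :> R by apply: ler_pM; lra.
have e3 : 172 / 125 <= expR (8 / 25) :> R.
  by have := @expR_ge_cub R (8 / 25); rewrite !exprS expr0; lra.
have : 65 / 24 * (65 / 24) * (172 / 125) <= expR 1 * expR 1 * expR (8 / 25) :> R by apply: ler_pM; lra.
by rewrite -mulrA; lra.
Qed.

(** Nearly an equality at a = 141/100, S = 10. Hence S and 1 + a S are
    replaced by exponentials tangent there, and only exponents remain to be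
    compared. *)
Lemma rest_bound a (S : R) (n : nat) : 141 / 100 <= a -> 10 <= S -> n%:R <= S - 6 ->
  S ^+ 3 / 4 * (1 + a * S) * expR (- (a * (S - 2))) <= 9 / 10 * (1 / 2) ^+ n.
Proof.
move=> a0 S0 nS.
have s1 : S <= expR (58 / 25 + (S / 10 - 1)).
  rewrite expRD; have h1 := expR232_ge; have h2 := expR_ge1Dx (S / 10 - 1).
  have : 10 * (S / 10) <= expR (58 / 25) * expR (S / 10 - 1) by apply: ler_pM; lra.
  lra.
have s3 : S ^+ 3 <= expR (3 * (58 / 25 + (S / 10 - 1))).
  by rewrite expRM_natl lerXn2r ?nnegrE ?expR_ge0//; lra.
have s4 : 1 + a * S <= 151 / 10 * expR ((S / 10 - 1) + (a - 141 / 100)).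
  rewrite expRD; have h1 := expR_ge1Dx (S / 10 - 1); have h2 := expR_ge1Dx (a - 141 / 100).
  have : S / 10 * (a - 41 / 100) <= expR (S / 10 - 1) * expR (a - 141 / 100) by apply: ler_pM; lra.
  have : 141 / 100 * S <= a * S by rewrite ler_pM2r; lra.
  lra.
have e15 : 151 / 36 <= expR (3 / 2) :> R.
  by have := @expR_ge_quart R (3 / 2); rewrite !exprS expr0; lra.
have e7 : expR (- (7 / 10)) <= 1 / 2 :> R.
  rewrite expRN -[leRHS]invrK lef_pV2 ?posrE ?expR_gt0 ?invr_gt0//.
  by have := @expR_ge_quart R (7 / 10); rewrite !exprS expr0; lra.
have en : expR (- (7 / 10) * n%:R) <= (1 / 2) ^+ n :> R.
  by rewrite mulrC expRM_natl lerXn2r ?nnegrE ?expR_ge0.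
have S3 : 0 <= S ^+ 3 by apply: exprn_ge0; lra.
have aS : 0 <= 1 + a * S by have := mulr_ge0 (_ : 0 <= a) (_ : 0 <= S); lra.
have h := ler_pM S3 aS s3 s4.
have {}h := ler_wpM2r (expR_ge0 (- (a * (S - 2)))) h.
apply: (@le_trans _ _ (9 / 10 * (expR (3 / 2) * (expR (3 * (58 / 25 + (S / 10 - 1))) * expR ((S / 10 - 1) + (a - 141 / 100)) * expR (- (a * (S - 2))))))).
  move: h; set E := expR (3 * _); set E2 := expR (_ + (a - _)); set E3 := expR (- _).
  have : 151 / 36 * (E * E2 * E3) <= expR (3 / 2) * (E * E2 * E3).
    by apply: ler_wpM2r => //; rewrite !mulr_ge0 ?expR_ge0.
  move: E E2 E3 (S ^+ 3) (1 + a * S) (expR (3 / 2)) => E E2 E3 X Y e32 *; nra.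
rewrite ler_pM2l//; apply: le_trans en; rewrite -!expRD ler_expR.
have : 10 * (a - 141 / 100) <= S * (a - 141 / 100) by rewrite ler_wpM2r; lra.
lra.
Qed.

(** The terms (+-1, +-2) and (+-2, +-1) against the main terms. As a^2 z >=
    359/50, z is large when a is small. *)
Lemma ratio12 a z : 141 / 100 <= a -> 359 / 50 <= a ^+ 2 * z -> 1 <= z ->
  expR (- (3 * a)) * (5 + 3 * a * (4 - z)) <= 1 / 8.
Proof.
move=> a0 az z1.
have t : 509 / 50 - 903 / 250 * a <= a * z.
  rewrite -(ler_pM2l (_ : 0 < a)); last by lra.
  apply: le_trans (_ : 359 / 50 <= _); last by rewrite mulrA -expr2.
  have := sqr_ge0 (a - 141 / 100); rewrite !expr2; lra.
have e1 : 269 / 5 * (1 + (3 * a - 4) + (3 * a - 4) ^+ 2 / 2) <= expR (3 * a).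
  rewrite [X in _ <= expR X](_ : _ = 4 + (3 * a - 4)); last by ring.
  rewrite expRD; have e4 := expR4_ge; have e5 := sqr_ge0 (3 * a - 4).
  have e6 : 1 + (3 * a - 4) + (3 * a - 4) ^+ 2 / 2 <= expR (3 * a - 4) by apply: expR_ge_quad; lra.
  by apply: (ler_pM _ _ e4 e6); lra.
have e0 := expR_gt0 (- (3 * a)).
have -> : 1 / 8 = expR (- (3 * a)) * (expR (3 * a) * (1 / 8)) by rewrite mulrA -expRD addNr expR0 !mul1r.
rewrite ler_pM2l//.
have := sqr_ge0 (3 * a - 4 - 1 / 5); rewrite !expr2 in e1 *; lra.
Qed.

Definition swap p := (p.2, p.1).
(** Geometric weights vanishing at 0: the axes do not contribute, and removing
    them from the majorant is needed for the final margin. *)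
Definition geom_pos (m : int) : R := if m == 0 then 0 else (1 / 2) ^+ `|m|.
Definition hor_list : seq (int * int) :=
  [:: (1, 1); (1, -1); (-1, 1); (-1, -1); (1, 2); (1, -2); (-1, 2); (-1, -2);
      (2, 1); (2, -1); (-2, 1); (-2, -1); (2, 2); (2, -2); (-2, 2); (-2, -2)].
(** Lower bounds of the pairs with |m|, |k| at most 2, in units of kappa (z -
    1) e^(- a (1 + z)). *)
Definition hbound (c12 c22 : R) p : R :=
  if p \in hor_list then
    if p.1 ^+ 2 == p.2 ^+ 2 then (if p.1 ^+ 2 == 1 then 2 else - c22) else - c12
  else 0.

Lemma asummable_geom_pos : asummable geom_pos.
Proof.
have h : 0 <= (1 / 2 : R) < 1 by apply/andP; split; lra.
apply: asummable_le (asummable_geomz h) => m; rewrite /geom_pos.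
by case: eqP => _; rewrite ?normr0 ?exprn_ge0 ?ger0_norm ?exprn_ge0.
Qed.

Lemma asum_geom_pos : 0 <= asum geom_pos <= 2.
Proof.
have h : 0 <= (1 / 2 : R) < 1 by apply/andP; split; lra.
have u0 m : 0 <= geom_pos m by rewrite /geom_pos; case: eqP => // _; exact: exprn_ge0.
rewrite asum_ge0//=; last exact: asummable_geom_pos.
have sd : asummable (fun m : int => (m == 0)%:R : R).
  by apply: (@asummable_fin _ _ _ [:: 0]) => m; rewrite inE => /negPf ->.
have e : asum (fun m : int => (m == 0)%:R : R) = 1.
  rewrite (@asum_fin _ _ _ [:: 0])//; last by move=> m; rewrite inE => /negPf ->.
  by rewrite big_cons big_nil eqxx addr0.
have := asum_geomz_le h; rewrite (_ : (1 + 1 / 2) / (1 - 1 / 2) = 3 :> R); last by field.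
suff : asum (fun i : int => (1 / 2) ^+ `|i|%N) = asum geom_pos + 1 :> R by move=> ->; lra.
rewrite -[X in asum geom_pos + X]e -asumD//; last exact: asummable_geom_pos.
apply: eq_asum => m; rewrite /geom_pos; case: eqP => [->|_]; first by rewrite expr0 add0r.
by rewrite addr0.
Qed.

Definition hterm a z p := dual_weight z p * expR (- (a * dual_form z p)).
Definition hpair a z (M K : R) := (M * z - K) * expR (- (a * (M * z + K))) + (K * z - M) * expR (- (a * (K * z + M))).

Lemma hterm_swap a z p : hterm a z p + hterm a z (swap p) = hpair a z (p.1%:~R ^+ 2) (p.2%:~R ^+ 2).
Proof. by rewrite /hterm /hpair /dual_weight /dual_form /=. Qed.

Lemma hpair_sym a z M K : hpair a z M K = hpair a z K M.
Proof. by rewrite /hpair addrC. Qed.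

Lemma dphase_swap x p : dphase x (swap p) = dphase x p.
Proof. by rewrite /dphase /phase /= ![p.2%:~R * _]mulrC. Qed.

Lemma cross_le z (M K : R) : 1 <= z -> z <= 4 -> 0 <= M -> M <= K ->
  `|M * z - K| * (K - M) <= (M + K) * (M + K).
Proof.
move=> z1 z4 M0 MK.
have Mz : M * 1 <= M * z by apply: ler_wpM2l; lra.
have Mz4 : M * z <= M * 4 by apply: ler_wpM2l; lra.
have m1 : 0 <= M * (K - M) by apply: mulr_ge0; lra.
have d0 : 0 <= K - M by lra.
have m2 := sqr_ge0 M; have m3 := sqr_ge0 (K - M); rewrite !expr2 in m2 m3.
have [h|h] := ler0P (M * z - K).
  have : - (M * z - K) * (K - M) <= (K - M) * (K - M) by apply: ler_wpM2r; lra.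
  lra.
have : (M * z - K) * (K - M) <= (M * 4 - K) * (K - M) by apply: ler_wpM2r; lra.
lra.
Qed.

Lemma hpair_abs a z (M K : R) : 0 <= a -> 1 <= z -> z <= 4 -> 1 <= M -> M <= K ->
  `|hpair a z M K| <= (z - 1) * expR (- (a * (1 + z))) *
    ((M + K) * (1 + a * (M + K)) * expR (- (a * (M + K - 2)))).
Proof.
move=> a0 z1 z4 M1 MK; apply: le_trans (pairW a0 z1 _ MK) _; first by lra.
rewrite -!mulrA; apply: ler_wpM2l; first by lra.
have E : expR (- (a * (M * z + K))) <= expR (- (a * (1 + z))) * expR (- (a * (M + K - 2))).
  rewrite -expRD ler_expR -opprD lerN2 -mulrDr; apply: ler_wpM2l => //.
  have : 0 <= (M - 1) * (z - 1) by apply: mulr_ge0; lra.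
  lra.
have M0 : 0 <= M by lra.
have B := cross_le z1 z4 M0 MK.
have aB := ler_wpM2l a0 B.
have T : 0 <= M + K + a * (`|M * z - K| * (K - M)).
  apply: addr_ge0; first by lra.
  by apply: mulr_ge0 => //; apply: mulr_ge0 => //; lra.
apply: le_trans (ler_pM (expR_ge0 _) T E (_ : _ <= (M + K) * (1 + a * (M + K)))) _; first by lra.
have e (u v w t : R) : u * v * (w * t) = u * (w * (t * v)) by ring.
by rewrite e.
Qed.

End horiz2.

(** * The slope is smallest on the line x = 1/2 *)

Section horiz3.
Variable R : realType.
Implicit Types (s x y a z r : R) (p : int * int).

Lemma int_sq (m : int) : (m%:~R : R) ^+ 2 = (m * m)%:~R.
Proof. by rewrite -rmorphXn expr2. Qed.

Lemma hor_in p : p \in hor_list ->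
  [\/ [/\ p.1 * p.1 = 1, p.2 * p.2 = 1 & p.1 * p.2 = 1 \/ p.1 * p.2 = -1],
      (p.1 * p.1 = 1 /\ p.2 * p.2 = 4), (p.1 * p.1 = 4 /\ p.2 * p.2 = 1) |
      (p.1 * p.1 = 4 /\ p.2 * p.2 = 4)].
Proof.
case: p => m k; rewrite !inE !xpair_eqE /= => h.
have : [\/ ((m = 1 \/ m = -1) /\ (k = 1 \/ k = -1)), ((m = 1 \/ m = -1) /\ (k = 2 \/ k = -2)),
  ((m = 2 \/ m = -2) /\ (k = 1 \/ k = -1)) | ((m = 2 \/ m = -2) /\ (k = 2 \/ k = -2))].
  have [h1|[h1|[h1|h1]]] : ((m = 1 \/ m = -1) /\ (k = 1 \/ k = -1)) \/ ((m = 1 \/ m = -1) /\ (k = 2 \/ k = -2)) \/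
  ((m = 2 \/ m = -2) /\ (k = 1 \/ k = -1)) \/ ((m = 2 \/ m = -2) /\ (k = 2 \/ k = -2)) by lia.
  - by constructor 1.
  - by constructor 2.
  - by constructor 3.
  - by constructor 4.
case=> [[[->|->] [->|->]]|[[->|->] [->|->]]|[[->|->] [->|->]]|[[->|->] [->|->]]].
all: try by (constructor 1; split => //; by [left|right]).
all: try by constructor 2.
all: try by constructor 3.
all: by constructor 4.
Qed.

Lemma sq_ge_abs (n : int) : n != 0 -> Posz `|n| <= n * n /\ 1 <= n * n.
Proof.
move=> n0; have e : n * n = Posz `|n| * Posz `|n| by rewrite abszE -normrM ger0_norm -?expr2 ?sqr_ge0.
by rewrite e; have : (0 < `|n|)%N by [lia]; move: `|n|%N => k k0; nia.
Qed.

Lemma sq_ge_abs3 (n : int) : (2 < `|n|)%N -> Posz `|n| + 6 <= n * n.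
Proof.
move=> n0; have e : n * n = Posz `|n| * Posz `|n| by rewrite abszE -normrM ger0_norm -?expr2 ?sqr_ge0.
by rewrite e; move: `|n|%N n0 => k k0; nia.
Qed.

Lemma hor_out p : p \notin hor_list -> p.1 != 0 -> p.2 != 0 ->
  [/\ 1 <= p.1 * p.1, 1 <= p.2 * p.2, 10 <= p.1 * p.1 + p.2 * p.2 &
    Posz (`|p.1| + `|p.2|) + 6 <= p.1 * p.1 + p.2 * p.2].
Proof.
case: p => m k /= h m0 k0.
have : (2 < `|m|)%N \/ (2 < `|k|)%N.
  have [m2|m2] := ltnP 2 `|m|; first by left.
  have [k2|k2] := ltnP 2 `|k|; first by right.
  exfalso; move: h; have sm (n : int) : n != 0 -> (`|n| <= 2)%N -> n = 1 \/ n = -1 \/ n = 2 \/ n = -2.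
    by clear; lia.
  by case: (sm m m0 m2) => [->|[->|[->|->]]]; case: (sm k k0 k2) => [->|[->|[->|->]]].
move: h => _; have [m1 m2] := sq_ge_abs m0; have [k1 k2] := sq_ge_abs k0.
by case=> h; have h3 := sq_ge_abs3 h; split => //; lia.
Qed.

(** The main terms are exact, the other terms of the list are bounded below by
    minus their absolute value, and the rest is absorbed in the geometric
    majorant. *)
Lemma pair_bound a z x p : 141 / 100 <= a -> 1 <= z -> z <= 361 / 100 ->
  kappa x * (z - 1) * expR (- (a * (1 + z))) *
    (hbound (4 * (expR (- (3 * a)) * (5 + 3 * a * (4 - z)))) (128 * expR (- (6 * a))) p - 9 / 10 * (geom_pos R p.1 * geom_pos R p.2))
  <= dphase x p * hpair a z (p.1%:~R ^+ 2) (p.2%:~R ^+ 2).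
Proof.
move=> a0 z1 z4.
have k0 := kappa_ge0 x; set e0 := expR (- (a * (1 + z))); have e0p : 0 < e0 by exact: expR_gt0.
set s := z - 1; have s0 : 0 <= s by rewrite /s; lra.
have kse : 0 <= kappa x * s * e0 by rewrite !mulr_ge0// ltW.
have u0 m : 0 <= geom_pos R m by rewrite /geom_pos; case: eqP => // _; exact: exprn_ge0.
have dp := dphase_le x p.
have gen (v : R) : (p.1%:~R ^+ 2 * p.2%:~R ^+ 2) * `|hpair a z (p.1%:~R ^+ 2) (p.2%:~R ^+ 2)| <= s * e0 * v ->
    kappa x * s * e0 * (- v) <= dphase x p * hpair a z (p.1%:~R ^+ 2) (p.2%:~R ^+ 2).
  move=> h; rewrite mulrN lerNl; apply: le_trans (ler_norm _) _; rewrite normrN normrM.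
  apply: le_trans (ler_wpM2r (normr_ge0 _) dp) _.
  have := ler_wpM2l k0 h; move: `|hpair _ _ _ _| => w; move: (p.1%:~R ^+ 2 : R) (p.2%:~R ^+ 2 : R) => M K hex_scale.
  by rewrite (_ : M * K * kappa x * w = kappa x * (M * K * w)) 1?(_ : kappa x * s * e0 * v = kappa x * (s * e0 * v)); [|ring|ring].
have uup : 0 <= geom_pos R p.1 * geom_pos R p.2 by exact: mulr_ge0.
have weak (V v : R) : V <= v -> kappa x * s * e0 * v <= dphase x p * hpair a z (p.1%:~R ^+ 2) (p.2%:~R ^+ 2) ->
  kappa x * s * e0 * (V - 9 / 10 * (geom_pos R p.1 * geom_pos R p.2)) <= dphase x p * hpair a z (p.1%:~R ^+ 2) (p.2%:~R ^+ 2).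
  by move=> Vv; apply: le_trans; rewrite ler_wpM2l//; lra.

have [m0|m0] := eqVneq p.1 0.
  have D : dphase x p = 0.
    by apply/eqP; rewrite -normr_eq0 eq_le normr_ge0 andbT; move: dp; rewrite m0 expr0n /= !mul0r.
  have pl : p \notin hor_list by rewrite (surjective_pairing p) m0 !inE !xpair_eqE.
  by rewrite D mul0r /hbound (negPf pl) {1}/geom_pos m0 eqxx mul0r mulr0 subrr mulr0.
have [n0|n0] := eqVneq p.2 0.
  have D : dphase x p = 0.
    by apply/eqP; rewrite -normr_eq0 eq_le normr_ge0 andbT; move: dp; rewrite n0 expr0n /= mulr0 mul0r.
  have pl : p \notin hor_list by rewrite (surjective_pairing p) n0 !inE !xpair_eqE !andbF.
  by rewrite D mul0r /hbound (negPf pl) /geom_pos n0 eqxx !mulr0 subrr mulr0.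
have z4' : z <= 4 by lra.
have ap : 0 <= a by lra.
have E12 : `|hpair a z 1 4| <= s * e0 * (expR (- (3 * a)) * (5 + 3 * a * (4 - z))).
  have m14 : 1 <= 4 :> R by lra.
  apply: le_trans (pairW ap z1 ler01 m14) _.
  rewrite (_ : - (a * (1 * z + 4)) = - (a * (1 + z)) + - (3 * a)); last by ring.
  rewrite expRD -/e0 ler0_norm; last by lra.
  by move: (expR (- (3 * a))) => e3; rewrite /s le_eqVlt; apply/orP; left; apply/eqP; ring.
have [pl|pl] := boolP (p \in hor_list).
  rewrite !int_sq in gen weak *; rewrite /hbound pl !expr2.
  case: (hor_in pl) => [[M K mk]|[M K]|[M K]|[M K]]; rewrite M K ?eqxx /= in gen weak *.
  - apply: (weak _ 2) => //; rewrite (dphase_one _ mk) /hpair /e0 /s.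
    rewrite (_ : a * (1 * z + 1) = a * (1 + z)); last by ring.
    by rewrite le_eqVlt; apply/orP; left; apply/eqP; ring.
  - apply: (weak _ _ (lexx _)); apply: gen.
    by have -> : 4%:~R = 4 :> R by []; move: E12; rewrite !mul1r; lra.
  - apply: (weak _ _ (lexx _)); apply: gen; rewrite hpair_sym.
    by have -> : 4%:~R = 4 :> R by []; move: E12; rewrite !mulr1; lra.
  - apply: (weak _ _ (lexx _)); apply: gen.
    have -> : 4%:~R = 4 :> R by [].
    have p4 : 0 <= 4 :> R by lra.
    apply: le_trans (ler_wpM2l _ (pairW ap z1 p4 (lexx 4))) _; first by lra.
    rewrite subrr !mulr0 addr0.
    have : expR (- (a * (4 * z + 4))) <= e0 * expR (- (6 * a)).
      rewrite /e0 -expRD ler_expR; have : a * 1 <= a * z by rewrite ler_wpM2l.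
      lra.
    move/(ler_wpM2l s0); rewrite -/s; lra.
have [M1 K1 S1 n1] := hor_out pl m0 n0.
rewrite /hbound (negPf pl) sub0r.
have -> : 9 / 10 * (geom_pos R p.1 * geom_pos R p.2) = 9 / 10 * (1 / 2) ^+ (`|p.1| + `|p.2|)%N :> R.
  by rewrite /geom_pos (negPf m0) (negPf n0) exprD.
apply: gen; rewrite !int_sq.
rewrite -(ler_int R) in M1; rewrite -(ler_int R) in K1.
have {}S1 : 10 <= (p.1 * p.1)%:~R + (p.2 * p.2)%:~R :> R by rewrite -intrD -[10]/(10%:~R) ler_int.
have {}n1 : (`|p.1| + `|p.2|)%N%:R + 6 <= (p.1 * p.1)%:~R + (p.2 * p.2)%:~R :> R.
  by rewrite -intrD -[_%:R]/((Posz (`|p.1| + `|p.2|)%N)%:~R) -[6]/(6%:~R) -intrD ler_int.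
move: ((p.1 * p.1)%:~R) ((p.2 * p.2)%:~R) M1 K1 S1 n1 => M K M1 K1 S1 n1.
have {}n1 : (`|p.1| + `|p.2|)%N%:R <= (M + K) - 6 by lra.
have rb := rest_bound a0 S1 n1.
have W : `|hpair a z M K| <= s * e0 * ((M + K) * (1 + a * (M + K)) * expR (- (a * (M + K - 2)))).
  have [MK|MK] := leP M K; first exact: hpair_abs.
  by rewrite hpair_sym [M + K]addrC; apply: hpair_abs => //; exact: ltW.
have MK4 : M * K <= (M + K) ^+ 2 / 4 by have := sqr_ge0 (M - K); rewrite !expr2; lra.
have MK0 : 0 <= M * K by apply: mulr_ge0; lra.
apply: le_trans (ler_pM MK0 (normr_ge0 _) MK4 W) _.
rewrite [leLHS](_ : _ = s * e0 * ((M + K) ^+ 3 / 4 * (1 + a * (M + K)) * expR (- (a * (M + K - 2))))).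
  by apply: ler_wpM2l => //; rewrite mulr_ge0// ltW.
by move: (expR (- (a * (M + K - 2)))) => u; rewrite !exprS expr0; ring.
Qed.

(** Sum of [pair_bound]: 8 - 32/8 - 512/2500 - 36/10 is positive. *)
Lemma horiz_min a z x : 141 / 100 <= a -> 1 <= z -> z <= 361 / 100 -> 359 / 50 <= a ^+ 2 * z ->
  asum (dual_slope a z (1 / 2)) <= asum (dual_slope a z x).
Proof.
move=> a0 z1 z4 az.
have ap : 0 < a by lra.
have zp : 0 < z by lra.
have s1 := asummable_dual_weight x ap zp; have s2 := asummable_dual_weight (1 / 2) ap zp.
have sB := asummableB s1 s2.
pose t p := dual_slope a z x p - dual_slope a z (1 / 2) p.
have swb : bijective swap by exists swap => -[].
rewrite -subr_ge0 -asumB// -/t.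
have st : asummable (fun p => t (swap p)) := reindex_asummable (bij_inj swb) sB.
have E : asum t = asum (fun p => t (swap p)) := reindex_asum _ swb.
suff : 0 <= asum (fun p => t p + t (swap p)) by rewrite asumD// -E; lra.
set c12 := 4 * (expR (- (3 * a)) * (5 + 3 * a * (4 - z))); set c22 := 128 * expR (- (6 * a)).
have Vz p : p \notin hor_list -> hbound c12 c22 p = 0 by rewrite /hbound => /negPf ->.
have sV := asummable_fin Vz.
have suu := asummable_prod2 (asummable_geom_pos R) (asummable_geom_pos R).
apply: (@le_trans _ _ (asum (fun p => kappa x * (z - 1) * expR (- (a * (1 + z))) * (hbound c12 c22 p - 9 / 10 * (geom_pos R p.1 * geom_pos R p.2))))); last first.
  apply: ler_asum.
  - by apply: asummableZ; apply: asummableB => //; exact: asummableZ.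
  - exact: asummableD.
  - move=> p; have := pair_bound x p a0 z1 z4; rewrite -hterm_swap -/c12 -/c22 => h; apply: le_trans h _.
    by rewrite mulrDr -{2}(dphase_swap x p) /t /dual_slope /dphase /hterm le_eqVlt; apply/orP; left; apply/eqP; ring.
rewrite asumZ; last by apply: asummableB => //; exact: asummableZ.
apply: mulr_ge0.
  by rewrite !mulr_ge0 ?expR_ge0 ?kappa_ge0//; lra.
rewrite asumB//; last exact: asummableZ.
rewrite asumZ// asum_prod2 ?asum_fin//; try exact: asummable_geom_pos.
rewrite (@asum_fin _ _ _ hor_list)// /hor_list !big_cons big_nil /hbound /=.
have r12 := ratio12 a0 az z1.
have e8 : expR (- (6 * a)) <= 1 / 2500.
  apply: (@le_trans _ _ (expR (- 8))); first by rewrite ler_expR; lra.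
  rewrite (_ : - 8 = - 4 + - 4); last by ring.
  have h : expR (- 4) <= 1 / 50 :> R.
    rewrite expRN -[leRHS]invrK lef_pV2 ?posrE ?expR_gt0 ?invr_gt0//.
    by have := expR4_ge R; lra.
  rewrite expRD; have := ler_pM (expR_ge0 _) (expR_ge0 _) h h; lra.
have /andP[u0 u2] := asum_geom_pos R.
have : asum (geom_pos R) * asum (geom_pos R) <= 2 * 2 by exact: ler_pM.
rewrite /c12 /c22; lra.
Qed.

(** The bound 67/25 is just below pi sqrt 3 / 2, the value at the hexagonal
    point. *)
Lemma slope_horiz s x y : 1 <= s -> s <= 19 / 10 -> 67 / 25 <= pi * y ->
  slope s (1 / 2) y <= slope s x y.
Proof.
move=> s1 s2 py; have p0 := pi_gt31 R.
have y0 : 0 < y by rewrite -(pmulr_rgt0 _ (pi_gt0 R)); lra.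
rewrite !slope_dual; [|lra|done|lra|done].
apply: ler_wpM2l.
  apply: mulr_ge0; first exact: sqrtr_ge0.
  by apply: divr_ge0; lra.
move: (pi * y) py => b b0.
have z1 : 1 <= s ^+ 2 by rewrite expr2; nra.
have z2 : s ^+ 2 <= 361 / 100 by rewrite expr2; nra.
apply: horiz_min => //.
  rewrite ler_pdivlMr; lra.
rewrite -exprMn mulfVK; last by rewrite gt_eqF//; lra.
by rewrite expr2; nra.
Qed.
End horiz3.

(** * The leading terms on the line x = 1/2 *)

Section core.
Variable R : realType.
Implicit Types (s x y a z r : R) (p : int * int).

(** Differentiating twice in a produces this polynomial in the exponent C =
    m^2 z + k^2, after the factor e^a is taken out. *)
Definition vpoly a (C : R) := (C - 1) * (C * a - 5 / 2) - 1.

Lemma expR_num (n : nat) (f r : R) : 0 <= f ->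
  r <= (65 / 24) ^+ n * (1 + f + f ^+ 2 / 2 + f ^+ 3 / 6 + f ^+ 4 / 24) -> r <= expR (n%:R + f).
Proof.
move=> f0 h; apply: (le_trans h); rewrite expRD.
have e1 := expR1_ge R.
apply: ler_pM; [by apply: exprn_ge0; lra| |  |exact: expR_ge_quart].
  by have := exprn_ge0 2 f0; have := exprn_ge0 3 f0; have := exprn_ge0 4 f0; lra.
rewrite -[n%:R]mulr1 expRM_natl lerXn2r ?nnegrE ?expR_ge0//; lra.
Qed.

Lemma inv_le (u v : R) : 0 < u -> u <= v -> v^-1 <= u^-1.
Proof. by move=> u0 uv; rewrite lef_pV2 ?posrE//; apply: lt_le_trans uv. Qed.

(** Reduces an exponential at a >= b to a numerical bound r <= e^b. *)
Lemma exp_shift (c a b r : R) (n : nat) : b <= a -> 0 < r -> r <= expR b -> c = n%:R ->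
  expR (- (c * a)) <= (r ^- n) * expR (- (c * (a - b))).
Proof.
move=> ba r0 rb ->; rewrite (_ : - (n%:R * a) = - (n%:R * b) + - (n%:R * (a - b))); last by ring.
rewrite expRD ler_wpM2r ?expR_ge0// expRN expRM_natl; apply: inv_le; first exact: exprn_gt0.
by rewrite lerXn2r ?nnegrE ?expR_ge0// ltW.
Qed.

(** A linear function grows slower than e^(c t) if it does so at t = 0. *)
Lemma lin_decay (c l b t : R) : 0 <= t -> b <= c * l -> 0 <= l -> (l + b * t) * expR (- (c * t)) <= l.
Proof.
move=> t0 bl l0; have h := expR_ge1Dx (c * t).
have : (l + b * t) * expR (- (c * t)) <= l * expR (c * t) * expR (- (c * t)).
  rewrite ler_wpM2r ?expR_ge0//.
  have : l * (1 + c * t) <= l * expR (c * t) by rewrite ler_wpM2l.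
  have : b * t <= c * l * t by rewrite ler_wpM2r.
  lra.
by rewrite -mulrA -expRD subrr expR0 mulr1.
Qed.

Lemma edge_axis_le a b r : 141 / 100 <= b -> b <= a -> 0 < r -> r <= expR b ->
  4 * (12 * a - 17 / 2) * expR (- (3 * a)) <= (48 * b - 34) * r ^- 3 /\
  a * (4 * (12 * a - 17 / 2) * expR (- (3 * a))) <= b * ((48 * b - 34) * r ^- 3).
Proof.
move=> b0 ba r0 rb; have e := exp_shift ba r0 rb (erefl (3%:R : R)).
have t0 : 0 <= a - b by lra.
have i3 : 0 < r ^- 3 by rewrite invr_gt0 exprn_gt0.
have a0 : 0 <= a by lra.
have d1 : a * expR (- (1 * (a - b))) <= b.
  have := @lin_decay 1 b 1 (a - b) t0; rewrite (_ : b + 1 * (a - b) = a); last by ring.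
  by apply; lra.
have d2 : (48 * a - 34) * expR (- (2 * (a - b))) <= 48 * b - 34.
  have := @lin_decay 2 (48 * b - 34) 48 (a - b) t0; rewrite (_ : _ + 48 * (a - b) = 48 * a - 34); last by ring.
  by apply; lra.
have d3 : (48 * a - 34) * expR (- (3 * (a - b))) <= 48 * b - 34.
  have := @lin_decay 3 (48 * b - 34) 48 (a - b) t0; rewrite (_ : _ + 48 * (a - b) = 48 * a - 34); last by ring.
  by apply; lra.
have p0 : 0 <= 48 * a - 34 by lra.
have -> : 4 * (12 * a - 17 / 2) = 48 * a - 34 by field.
have e1 := ler_wpM2l p0 e.
split.
  apply: (le_trans e1); have := ler_wpM2r (ltW i3) d3.
  by rewrite mulrCA mulrC.
apply: (le_trans (ler_wpM2l a0 e1)).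
rewrite (_ : - (3 * (a - b)) = - (1 * (a - b)) + - (2 * (a - b))) ?expRD; last by ring.
have n1 : 0 <= a * expR (- (1 * (a - b))) by rewrite mulr_ge0 ?expR_ge0.
have n2 : 0 <= (48 * a - 34) * expR (- (2 * (a - b))) by rewrite mulr_ge0 ?expR_ge0.
have := ler_wpM2r (ltW i3) (ler_pM n1 n2 d1 d2).
rewrite -[b * _ * _]mulrA; apply: le_trans.
move: (expR _) (expR _) (r ^- 3) => u v w; rewrite le_eqVlt; apply/orP; left; apply/eqP; ring.
Qed.

Lemma edge_pair_1_4_le a b r z (z1 z2 : R) : 141 / 100 <= b -> b <= a -> 0 < r -> r <= expR b ->
  1 <= z -> z1 <= z -> z <= z2 -> z2 <= 4 ->
  vpoly a (z + 4) * (5 + 3 * a * (4 - z)) * expR (- (4 * a)) <=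
  ((z2 + 3) * (b * (z2 + 4) - 5 / 2) - 1) * (5 + 3 * b * (4 - z1)) * r ^- 4.
Proof.
move=> b0 ba r0 rb zz za zb z24; have e := exp_shift ba r0 rb (erefl (4%:R : R)).
have t0 : 0 <= a - b by lra.
have i4 : 0 < r ^- 4 by rewrite invr_gt0 exprn_gt0.
have bz : 141 / 100 * 5 <= b * (z + 4) by apply: ler_pM; lra.
have q1 : 4 * (91 / 20) <= (z + 3) * (b * (z + 4) - 5 / 2) by apply: ler_pM; lra.
have az : b * (z + 4) <= a * (z + 4) by rewrite ler_wpM2r//; lra.
have q2 : (z + 3) * (b * (z + 4) - 5 / 2) <= (z + 3) * (a * (z + 4) - 5 / 2) by rewrite ler_wpM2l//; lra.
have d1 : vpoly a (z + 4) * expR (- (2 * (a - b))) <= (z + 3) * (b * (z + 4) - 5 / 2) - 1.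
  have := @lin_decay 2 ((z + 3) * (b * (z + 4) - 5 / 2) - 1) ((z + 3) * (z + 4)) (a - b) t0.
  rewrite (_ : _ + (z + 3) * (z + 4) * (a - b) = vpoly a (z + 4)); last by rewrite /vpoly; field.
  apply; last by lra.
  have : (z + 3) * (z + 4) <= (z + 3) * (2 * (b * (z + 4) - 5 / 2) - 1 / 2).
    rewrite ler_wpM2l//; first by lra.
    have : (z + 4) * (141 / 100) <= (z + 4) * b by rewrite ler_wpM2l//; lra.
    lra.
  by lra.
have d2 : (5 + 3 * a * (4 - z)) * expR (- (2 * (a - b))) <= 5 + 3 * b * (4 - z).
  have bz4 : 141 / 100 * (4 - z) <= b * (4 - z) by rewrite ler_wpM2r//; lra.
  have := @lin_decay 2 (5 + 3 * b * (4 - z)) (3 * (4 - z)) (a - b) t0.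
  rewrite (_ : _ + 3 * (4 - z) * (a - b) = 5 + 3 * a * (4 - z)); last by ring.
  by apply; lra.
have n1 : 0 <= vpoly a (z + 4) by rewrite /vpoly (_ : z + 4 - 1 = z + 3); [lra|ring].
have n2 : 0 <= 5 + 3 * a * (4 - z) by have := mulr_ge0 (_ : 0 <= a) (_ : 0 <= 4 - z); lra.
have := ler_wpM2l (mulr_ge0 n1 n2) e => h; apply: (le_trans h) => {h}.
rewrite (_ : - (4 * (a - b)) = - (2 * (a - b)) + - (2 * (a - b))) ?expRD; last by ring.
have m1 : 0 <= vpoly a (z + 4) * expR (- (2 * (a - b))) by rewrite mulr_ge0 ?expR_ge0.
have m2 : 0 <= (5 + 3 * a * (4 - z)) * expR (- (2 * (a - b))) by rewrite mulr_ge0 ?expR_ge0.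
have f1 : (z + 3) * (b * (z + 4) - 5 / 2) - 1 <= (z2 + 3) * (b * (z2 + 4) - 5 / 2) - 1.
  rewrite lerD2r; apply: ler_pM; [clear -zz; lra|clear -bz; lra|clear -zb; lra|].
  by rewrite lerD2r ler_wpM2l//; [clear -b0; lra|clear -zb; lra].
have f2 : 5 + 3 * b * (4 - z) <= 5 + 3 * b * (4 - z1).
  by rewrite lerD2l; apply: ler_wpM2l; [clear -b0; lra|clear -za; lra].
have := ler_wpM2r (ltW i4) (ler_pM m1 m2 (le_trans d1 f1) (le_trans d2 f2)).
apply: le_trans.
move: (expR _) (r ^- 4) (vpoly _ _) => u w y; rewrite le_eqVlt; apply/orP; left; apply/eqP; ring.
Qed.

Lemma edge_pair_1_1_le a z (z2 k t : R) : 1 <= z -> z <= z2 -> 0 < t -> t <= expR (1 + k) ->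
  k * (z2 + z2 * z2) <= 5 / 2 * z2 + 1 -> 0 <= k ->
  vpoly a (1 + z) * expR (- a) <= (z2 + z2 * z2) / t.
Proof.
move=> z0 zz t0 tk kz k0.
have kk : k * (z + z * z) <= 5 / 2 * z + 1.
  rewrite -(ler_pM2l (_ : 0 < z2)); last by lra.
  have : z * (k * (z2 + z2 * z2)) <= z * (5 / 2 * z2 + 1) by rewrite ler_wpM2l//; lra.
  have : 0 <= (k * (z * z2) + 1) * (z2 - z) by rewrite mulr_ge0//; [have := mulr_ge0 k0 (mulr_ge0 (_ : 0 <= z) (_ : 0 <= z2)); lra|lra].
  lra.
have e : vpoly a (1 + z) <= (z + z * z) * expR (a - k - 1).
  have := expR_ge1Dx (a - k - 1) => h.
  have p : 0 <= z + z * z by have := mulr_ge0 (_ : 0 <= z) (_ : 0 <= z); lra.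
  by have := ler_wpM2l p h; rewrite /vpoly; lra.
have := ler_wpM2r (expR_ge0 (- a)) e; rewrite -mulrA -expRD (_ : a - k - 1 + - a = - (1 + k)); last by ring.
move=> h; apply: (le_trans h); rewrite expRN.
apply: ler_pM; rewrite ?invr_ge0 ?expR_ge0//; last exact: inv_le.
- by have := mulr_ge0 (_ : 0 <= z) (_ : 0 <= z); lra.
- by rewrite lerD// ler_pM//; lra.
Qed.

(** The terms with m^2 + k^2 = 1, 2, 4, 5 of the second derivative, with (z -
    1) / 25 set aside for all the others, multiplied by e^(a (z - 1)). *)
Definition edge_expr a z : R :=
  expR (a * (z - 1)) - z + z * (z - 1) * (z * a - 5 / 2)
  - 4 * (12 * a - 17 / 2) * expR (- (3 * a)) * (expR (a * (z - 1)) - expR (- (3 * (a * (z - 1)))))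
  - 2 * (z - 1) * (vpoly a (1 + z) * expR (- a))
  - 2 * (z - 1) * (vpoly a (z + 4) * (5 + 3 * a * (4 - z)) * expR (- (4 * a)))
  - 1 / 25 * (z - 1) * expR (a * (z - 1)).

(** On s1 <= s <= s2 every monotone ingredient is replaced by its value at an
    end point, and a by its smallest value b; what remains is one inequality
    between numbers. The terms are all multiples of z - 1 up to e^(a (z - 1))
    - 1 >= a (z - 1) D, so no division by z - 1 is needed. *)
Lemma edge_cell s a (s1 s2 b r k t : R) : 1 <= s1 -> s1 <= s -> s <= s2 -> s2 <= 19 / 10 ->
  67 / 25 <= a * s -> 141 / 100 <= b -> b * s2 <= 67 / 25 ->
  0 < r -> r <= expR b -> 0 < t -> t <= expR (1 + k) -> 0 <= k ->
  k * (s2 ^+ 2 + s2 ^+ 2 * s2 ^+ 2) <= 5 / 2 * s2 ^+ 2 + 1 ->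
  let z1 := s1 ^+ 2 in let z2 := s2 ^+ 2 in let eta := (48 * b - 34) * r ^- 3 in
  let d := (z1 - 1) * b in
  0 <= 1 - eta - 1 / 25 * (z2 - 1) ->
  0 <= b * (1 + d / 2 + d ^+ 2 / 6 + d ^+ 3 / 24) * (1 - eta - 1 / 25 * (z2 - 1))
    - 3 * (b * eta) - 1 - 1 / 25 + z1 * (67 / 25 * s1 - 5 / 2)
    - 2 * ((z2 + z2 * z2) / t)
    - 2 * (((z2 + 3) * (b * (z2 + 4) - 5 / 2) - 1) * (5 + 3 * b * (4 - z1)) * r ^- 4) ->
  0 <= edge_expr a (s ^+ 2).
Proof.
move=> s10 s1s ss2 s219 as_ b0 bs2 r0 rb t0 tk k0 kz z1 z2 eta d.
have s0 : 1 <= s by lra.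
have ba : b <= a.
  rewrite -(ler_pM2r (_ : 0 < s)); last by lra.
  by apply: le_trans as_; apply: le_trans bs2; rewrite ler_wpM2l//; lra.
set z := s ^+ 2.
have zE : z = s * s by rewrite /z expr2.
have zz1 : z1 <= z by rewrite /z1 zE expr2 ler_pM//; lra.
have zz2 : z <= z2 by rewrite /z2 zE expr2 ler_pM//; lra.
have z10 : 1 <= z1 by rewrite /z1 expr2; have : 1 * 1 <= s1 * s1 by [rewrite ler_pM//; lra]; lra.
have z24 : z2 <= 4 by rewrite /z2 expr2; have : s2 * s2 <= 19 / 10 * (19 / 10) by [rewrite ler_pM//; lra]; lra.
have zz : 1 <= z by lra.
have za : z1 * (67 / 25 * s1 - 5 / 2) <= z * (z * a - 5 / 2).
  apply: ler_pM; [lra|lra|done|].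
  have -> : z * a = s * (a * s) by rewrite zE; ring.
  have : 67 / 25 * s1 <= a * s * s by apply: ler_pM; lra.
  lra.
rewrite /edge_expr; fold z.
clear as_ bs2.
set dl := a * (z - 1).
have dl0 : 0 <= dl by rewrite mulr_ge0//; lra.
have dd : d <= dl by rewrite /d /dl mulrC; apply: ler_pM; [lra|lra|done|lra].
have d0 : 0 <= d by rewrite /d; apply: mulr_ge0; lra.
have et0 : 0 <= 4 * (12 * a - 17 / 2) * expR (- (3 * a)) by rewrite mulr_ge0 ?expR_ge0//; lra.
have q := expR_ge_quart dl0.
have e3 := expR_ge1Dx (- (3 * dl)).
set X := expR dl in q *; set X3 := expR (- (3 * dl)) in e3 *.
have sg0 : 0 <= z - 1 by lra.
pose D := 1 + d / 2 + d ^+ 2 / 6 + d ^+ 3 / 24.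
have D0 : 0 <= D by rewrite /D; have := exprn_ge0 2 d0; have := exprn_ge0 3 d0; lra.
have Y : (z - 1) * (b * D) <= X - 1.
  have : dl * D <= dl * (1 + dl / 2 + dl ^+ 2 / 6 + dl ^+ 3 / 24).
    apply: ler_wpM2l => //; rewrite /D.
    have : d ^+ 2 <= dl ^+ 2 by rewrite lerXn2r ?nnegrE.
    have : d ^+ 3 <= dl ^+ 3 by rewrite lerXn2r ?nnegrE.
    lra.
  have : (z - 1) * (b * D) <= dl * D.
    by rewrite mulrA ler_wpM2r// /dl mulrC ler_wpM2r.
  rewrite !exprS expr0 in q *; lra.
have [n1 n2] := edge_axis_le b0 ba r0 rb.
have y := edge_pair_1_4_le b0 ba r0 rb zz zz1 zz2 z24.
have h := edge_pair_1_1_le a zz zz2 t0 tk kz k0.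
set et := 4 * (12 * a - 17 / 2) * expR (- (3 * a)) in et0 n1 n2 *.
set H1 := vpoly a (1 + z) * expR (- a) in h *.
set H4 := vpoly a (z + 4) * _ * _ in y *.
move=> P0 P1; rewrite -/D in P1.
have P0' : 0 <= 1 - et - 1 / 25 * (z - 1) by rewrite /eta in P0; lra.
have k1 : (z - 1) * (b * D) * (1 - eta - 1 / 25 * (z2 - 1)) <= (X - 1) * (1 - et - 1 / 25 * (z - 1)).
  apply: ler_pM => //; last by rewrite /eta; lra.
  by rewrite !mulr_ge0//; lra.
have k2 : et * (X - X3) <= et * ((X - 1) + 3 * dl) by rewrite ler_wpM2l//; lra.
have k3 := ler_wpM2l sg0 h.
have k4 := ler_wpM2l sg0 y.
have k5 := ler_wpM2l sg0 za.
have k6 := ler_wpM2l sg0 n2.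
have k7 := mulr_ge0 sg0 P1.
move: k1 k2 k3 k4 k5 k6 k7; rewrite -/eta /dl; clearbody et H1 H4 X X3 D eta z1 z2 z.
move: (_ / t) (_ * r ^- 4) => u v.
move=> *; lra.
Qed.
End core.

(** * The leading terms are nonnegative *)

Section cells.
Variable R : realType.
Implicit Types (s a : R).

Ltac cell h1 h2 h3 n f r k n' f' t :=
  let e1 := fresh in let e2 := fresh in
  have e1 : r <= expR (n%:R + f) :> R by
    [clear; apply: expR_num; [lra|rewrite ?exprS ?expr0; lra]];
  have e2 : t <= expR (1 + k) :> R by
    [clear; rewrite (_ : 1 + k = n'%:R + f'); last by [lra];
     apply: expR_num; [lra|rewrite ?exprS ?expr0; lra]];
  apply: (edge_cell _ h1 h2 _ h3 _ _ _ e1 _ e2); try (clear; lra);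
  clear; cbv zeta; rewrite -?exprVn ?invf_div ?exprS ?expr0; lra.

(** Fifteen cells are enough; they get shorter towards s = 19/10, where the
    margin is small. Each call gives b = n + f, r <= e^b, k, and t <= e^(1 +
    k). *)
Lemma edge_expr_ge0 s a : 1 <= s -> s <= 19 / 10 -> 67 / 25 <= a * s -> 0 <= edge_expr a (s ^+ 2).
Proof.
move=> h1 h2 h3.
have [{}h2|/ltW {}h1] := leP s (57 / 50).
  cell h1 h2 h3 2%N (7 / 20 : R) (52 / 5 : R) (71 / 50 : R) 2%N (21 / 50 : R) (279 / 25 : R).
have [{}h2|/ltW {}h1] := leP s (127 / 100).
  cell h1 h2 h3 2%N (11 / 100 : R) (409 / 50 : R) (119 / 100 : R) 2%N (19 / 100 : R) (443 / 50 : R).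
have [{}h2|/ltW {}h1] := leP s (69 / 50).
  cell h1 h2 h3 1%N (47 / 50 : R) (691 / 100 : R) (26 / 25 : R) 2%N (1 / 25 : R) (763 / 100 : R).
have [{}h2|/ltW {}h1] := leP s (147 / 100).
  cell h1 h2 h3 1%N (41 / 50 : R) (613 / 100 : R) (93 / 100 : R) 1%N (93 / 100 : R) (171 / 25 : R).
have [{}h2|/ltW {}h1] := leP s (31 / 20).
  cell h1 h2 h3 1%N (18 / 25 : R) (111 / 20 : R) (17 / 20 : R) 1%N (17 / 20 : R) (158 / 25 : R).
have [{}h2|/ltW {}h1] := leP s (81 / 50).
  cell h1 h2 h3 1%N (13 / 20 : R) (259 / 50 : R) (79 / 100 : R) 1%N (79 / 100 : R) (119 / 20 : R).
have [{}h2|/ltW {}h1] := leP s (167 / 100).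
  cell h1 h2 h3 1%N (3 / 5 : R) (493 / 100 : R) (3 / 4 : R) 1%N (3 / 4 : R) (143 / 25 : R).
have [{}h2|/ltW {}h1] := leP s (171 / 100).
  cell h1 h2 h3 1%N (14 / 25 : R) (237 / 50 : R) (18 / 25 : R) 1%N (18 / 25 : R) (111 / 20 : R).
have [{}h2|/ltW {}h1] := leP s (7 / 4).
  cell h1 h2 h3 1%N (53 / 100 : R) (23 / 5 : R) (69 / 100 : R) 1%N (69 / 100 : R) (539 / 100 : R).
have [{}h2|/ltW {}h1] := leP s (89 / 50).
  cell h1 h2 h3 1%N (1 / 2 : R) (223 / 50 : R) (67 / 100 : R) 1%N (67 / 100 : R) (132 / 25 : R).
have [{}h2|/ltW {}h1] := leP s (181 / 100).
  cell h1 h2 h3 1%N (12 / 25 : R) (437 / 100 : R) (13 / 20 : R) 1%N (13 / 20 : R) (259 / 50 : R).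
have [{}h2|/ltW {}h1] := leP s (183 / 100).
  cell h1 h2 h3 1%N (23 / 50 : R) (107 / 25 : R) (16 / 25 : R) 1%N (16 / 25 : R) (513 / 100 : R).
have [{}h2|/ltW {}h1] := leP s (93 / 50).
  cell h1 h2 h3 1%N (11 / 25 : R) (21 / 5 : R) (31 / 50 : R) 1%N (31 / 50 : R) (503 / 100 : R).
have [{}h2|/ltW {}h1] := leP s (47 / 25).
  cell h1 h2 h3 1%N (21 / 50 : R) (103 / 25 : R) (61 / 100 : R) 1%N (61 / 100 : R) (249 / 50 : R).
cell h1 h2 h3 1%N (41 / 100 : R) (102 / 25 : R) (3 / 5 : R) 1%N (3 / 5 : R) (493 / 100 : R).
Qed.
End cells.

(** * Pairs of terms of the second derivative *)

Section pairs.
Variable R : realType.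
Implicit Types (s x y a z r : R) (p : int * int).

Definition vfac a (C : R) := vpoly a C * expR (- (a * (C - 1))).
Definition vpair a z (M K : R) := (M * z - K) * vfac a (M * z + K) + (K * z - M) * vfac a (K * z + M).

Lemma vpoly_mono a (C D : R) : 141 / 100 <= a -> 4 <= C -> C <= D -> 0 <= vpoly a C /\ vpoly a C <= vpoly a D.
Proof.
move=> a0 C4 CD.
have k1 : 141 / 100 * 4 <= C * a by rewrite mulrC ler_pM//; lra.
have k2 : C * a <= D * a by rewrite ler_wpM2r//; lra.
rewrite /vpoly; split.
  have : 3 * (1 / 2) <= (C - 1) * (C * a - 5 / 2) by apply: ler_pM; lra.
  lra.
by rewrite lerD2r; apply: ler_pM; lra.
Qed.

(** vpoly grows polynomially and more slowly than the exponential decays, from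
    C = 5 on. *)
Lemma vfac_decr a (C D : R) : 141 / 100 <= a -> 5 <= C -> C <= D ->
  [/\ 0 <= vfac a D, vfac a D <= vfac a C & vfac a C - vfac a D <= a * (D - C) * vfac a C].
Proof.
move=> a0 C5 CD.
have C4 : 4 <= C by lra.
have [h0 hD] := vpoly_mono a0 C4 CD.
have a1 : 0 <= a by lra.
have CD1 : C - 1 <= D - 1 by lra.
have /andP[l1 l2] := expR_lip a1 CD1.
have e0 := expR_ge0 (- (a * (D - 1))).
split.
- by rewrite /vfac mulr_ge0//; lra.
- rewrite /vfac (_ : - (a * (D - 1)) = - (a * (C - 1)) + - (a * (D - C))); last by ring.
  rewrite expRD mulrCA [leRHS]mulrC ler_pM2l ?expR_gt0//.
  have t0 : 0 <= a * (D - C) by rewrite mulr_ge0//; lra.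
  rewrite expRN ler_pdivrMr ?expR_gt0//.
  apply: le_trans (ler_wpM2l h0 (expR_ge_quad t0)).
  have aC : 141 / 100 * 5 <= a * C by apply: ler_pM; lra.
  have hC : 4 * (a * C - 5 / 2) - 1 <= vpoly a C.
    by rewrite /vpoly lerD2r [C * a]mulrC ler_wpM2r//; lra.
  have -> : vpoly a D = vpoly a C + (D - C) * (2 * (a * C) - a - 5 / 2) + a * (D - C) ^+ 2 by rewrite /vpoly; field.
  have g0 : 141 / 100 * vpoly a C <= a * vpoly a C by rewrite ler_wpM2r.
  have g1 : 2 * (a * C) - a - 5 / 2 <= a * vpoly a C by lra.
  have g2 : 2 <= a * vpoly a C by lra.
  have g3 : (D - C) * (2 * (a * C) - a - 5 / 2) <= (D - C) * (a * vpoly a C) by rewrite ler_wpM2l//; lra.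
  have g4 : a * (D - C) ^+ 2 * 2 <= a * (D - C) ^+ 2 * (a * vpoly a C) by rewrite ler_wpM2l// mulr_ge0// sqr_ge0.
  rewrite !exprMn expr2 in g4 *; lra.
- rewrite /vfac mulrA.
  have k1 := ler_wpM2l h0 l2; have k2 := ler_wpM2r e0 hD.
  by rewrite mulrAC; lra.
Qed.

Lemma vpair_sym a z M K : vpair a z M K = vpair a z K M.
Proof. by rewrite /vpair addrC. Qed.

(** Same pairing as in [pairW], with the additional factor vpoly. *)
Lemma vpair_abs a z (M K : R) : 141 / 100 <= a -> 1 <= z -> 0 <= M -> M <= K -> 5 <= M * z + K ->
  `|vpair a z M K| <= (z - 1) * (vfac a (M * z + K) * ((M + K) + a * (`|M * z - K| * (K - M)))).
Proof.
move=> a0 z1 M0 MK C5.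
have CC : M * z + K <= K * z + M.
  by rewrite -subr_ge0 (_ : _ - _ = (K - M) * (z - 1)); [apply: mulr_ge0; lra|ring].
have [l1 l2 l3] := vfac_decr a0 C5 CC.
rewrite /vpair; set q1 := vfac a (M * z + K) in l1 l2 l3 *; set q2 := vfac a (K * z + M) in l1 l2 l3 *.
have -> : (M * z - K) * q1 + (K * z - M) * q2 = (M + K) * (z - 1) * q2 + (M * z - K) * (q1 - q2) by ring.
apply: le_trans (ler_normD _ _) _; rewrite [X in X + _]ger0_norm; last first.
  by apply: mulr_ge0 => //; apply: mulr_ge0; lra.
have q12 : 0 <= q1 - q2 by lra.
rewrite normrM (ger0_norm q12).
have k1 : (M + K) * (z - 1) * q2 <= (M + K) * (z - 1) * q1.
  by apply: ler_wpM2l; [apply: mulr_ge0; lra|lra].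
have k2 := ler_wpM2l (normr_ge0 (M * z - K)) l3.
have -> : (z - 1) * (q1 * (M + K + a * (`|M * z - K| * (K - M)))) =
  (M + K) * (z - 1) * q1 + `|M * z - K| * (a * (K * z + M - (M * z + K)) * q1) by ring.
exact: lerD.
Qed.

(** On the axis the larger exponent carries a positive term, at least K
    vpoly(K) e^(- a (K z - 1)). *)
Lemma vpair_axis a z (K : R) : 141 / 100 <= a -> 1 <= z -> 4 <= K ->
  - (K * vpoly a K * expR (- (a * (K - 1))) * (1 - expR (- (a * K * (z - 1))))) <= vpair a z 0 K.
Proof.
move=> a0 z1 K4; rewrite /vpair /vfac mul0r !add0r subr0 addr0.
have Kz : K <= K * z by rewrite -[leLHS]mulr1 ler_wpM2l//; lra.
have [h0 h1] := vpoly_mono a0 K4 Kz.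
rewrite (_ : - (a * (K * z - 1)) = - (a * (K - 1)) + - (a * K * (z - 1))); last by ring.
rewrite expRD; set e1 := expR (- (a * (K - 1))); set e2 := expR (- (a * K * (z - 1))).
have e12 : 0 <= e1 * e2 by rewrite mulr_ge0 ?expR_ge0.
have K0 : 0 <= K by lra.
have : K * (vpoly a K * (e1 * e2)) <= K * z * (vpoly a (K * z) * (e1 * e2)).
  by apply: ler_pM => //; [rewrite mulr_ge0|rewrite ler_wpM2r].
lra.
Qed.

Lemma one_sub_exp_le (u : R) : 1 - expR (- u) <= u.
Proof. by have := expR_ge1Dx (- u); lra. Qed.

Lemma expR_natge (n : nat) : (65 / 24) ^+ n <= expR n%:R :> R.
Proof. by have e1 := expR1_ge R; rewrite -[n%:R]mulr1 expRM_natl lerXn2r ?nnegrE ?expR_ge0//; lra. Qed.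

(** Tangent of 359/50/a. *)
Lemma az_ge a z : 141 / 100 <= a -> 359 / 50 <= a ^+ 2 * z -> 10 - 7 / 2 * a <= a * z.
Proof.
move=> a0 az; rewrite -(ler_pM2l (_ : 0 < a)); last by lra.
apply: le_trans (_ : 359 / 50 <= _); last by rewrite mulrA -expr2.
have := sqr_ge0 (a - 10 / 7); rewrite !expr2; lra.
Qed.

(** A numerical bound c / e <= u <= e^y certifies c e^(-x) <= e for all x >=
    y. *)
Lemma mul_expRN_le (c e u x y : R) : c <= e * u -> u <= expR y -> 0 <= e -> y <= x -> c * expR (- x) <= e.
Proof.
move=> cu uy e0 yx; have h : c <= e * expR x.
  by apply: (le_trans cu); apply: ler_wpM2l => //; apply: (le_trans uy); rewrite ler_expR.
have := ler_wpM2r (expR_ge0 (- x)) h.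
by rewrite -mulrA -expRD subrr expR0 mulr1.
Qed.

Lemma lin_exp (l c t : R) : 0 <= t -> c <= l -> 0 <= l -> l + c * t <= l * expR t.
Proof. by move=> t0 cl l0; have := ler_wpM2l l0 (expR_ge1Dx t); have := ler_wpM2r t0 cl; lra. Qed.

(** The factor 1 - e^(- 9 a (z - 1)) must be bounded by a multiple of z - 1:
    by 1 if z >= 2, by 9 a (z - 1) otherwise, where a is larger. *)
Lemma vpair_0_9_ge a z : 141 / 100 <= a -> 359 / 50 <= a ^+ 2 * z -> 1 <= z ->
  - (3 / 250 * (z - 1)) <= vpair a z 0 9.
Proof.
move=> a0 az z1; have K4 : 4 <= 9 :> R by lra.
apply: le_trans (vpair_axis a0 z1 K4); rewrite lerN2.
have -> : vpoly a 9 = 72 * a - 21 by rewrite /vpoly; field.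
have -> : a * (9 - 1) = 8 * a by ring.
have e0 := expR_ge0 (- (8 * a)).
have h0 : 0 <= 9 * (72 * a - 21) * expR (- (8 * a)) by rewrite mulr_ge0//; lra.
have [zl|zg] := leP 2 z.
  have : 9 * (72 * a - 21) * expR (- (8 * a)) <= 3 / 250.
    have t0 : 0 <= a - 141 / 100 by lra.
    have l : 9 * (72 * a - 21) <= 9 * 81 * expR (a - 141 / 100).
      by have := @lin_exp 81 72 _ t0; lra.
    apply: le_trans (ler_wpM2r e0 l) _.
    rewrite -[leLHS]mulrA -expRD (_ : a - 141 / 100 + - (8 * a) = - (7 * a + 141 / 100)); last by ring.
    apply: (@mul_expRN_le _ _ ((65 / 24) ^+ 11 * (1 + 1 / 5)) _ (11%:R + 1 / 5)); [| |clear; lra|clear -a0; lra].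
      by clear; rewrite !exprS expr0; lra.
    by clear; apply: expR_num; [lra|rewrite ler_wpM2l ?exprn_ge0//; rewrite ?exprS ?expr0; lra].
  have e1 := expR_ge0 (- (a * 9 * (z - 1))).
  move=> h; have : 9 * (72 * a - 21) * expR (- (8 * a)) * (1 - expR (- (a * 9 * (z - 1)))) <= 3 / 250 * 1.
    have : 9 * (72 * a - 21) * expR (- (8 * a)) * (1 - expR (- (a * 9 * (z - 1)))) <= 9 * (72 * a - 21) * expR (- (8 * a)) * 1.
      by rewrite ler_wpM2l//; lra.
    lra.
  lra.
have a1 : 189 / 100 <= a.
  rewrite leNgt; apply/negP => al.
  have : a * a * z <= 189 / 100 * (189 / 100) * 2.
    by apply: ler_pM; [apply: mulr_ge0; clear -a0; lra|clear -z1; lra|apply: ler_pM; clear -a0 al; lra|clear -zg; lra].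
  by rewrite -expr2; lra.
have : 81 * a * (72 * a - 21) * expR (- (8 * a)) <= 3 / 250.
  have t0 : 0 <= a - 189 / 100 by lra.
  have l : 72 * a - 21 <= 116 * expR (a - 189 / 100).
    by have := @lin_exp 116 72 _ t0; lra.
  have m : a <= 189 / 100 * expR (a - 189 / 100).
    by have := @lin_exp (189 / 100) 1 _ t0; lra.
  have p1 : 0 <= a by lra.
  have p2 : 0 <= 72 * a - 21 by lra.
  have := ler_pM p1 p2 m l; clear l m; move=> lm.
  have {}lm : 81 * a * (72 * a - 21) <= 81 * (189 / 100) * 116 * (expR (a - 189 / 100) * expR (a - 189 / 100)).
    by move: lm; move: (expR _) => u; lra.
  apply: le_trans (ler_wpM2r e0 lm) _.
  rewrite -[leLHS]mulrA -!expRD (_ : a - 189 / 100 + (a - 189 / 100) + - (8 * a) = - (6 * a + 378 / 100)); last by lra.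
  apply: (@mul_expRN_le _ _ ((65 / 24) ^+ 15) _ 15%:R); [|exact: expR_natge|clear; lra|clear -a1; lra].
  by clear; rewrite !exprS expr0; lra.
move=> h.
have := one_sub_exp_le (a * 9 * (z - 1)) => o.
have := ler_wpM2l h0 o => k; apply: (le_trans k).
have sg : 0 <= z - 1 by lra.
have k2 := ler_wpM2r sg h; lra.
Qed.

Lemma vpair_1_9_le a z : 141 / 100 <= a -> 359 / 50 <= a ^+ 2 * z -> 1 <= z -> z <= 361 / 100 ->
  `|vpair a z 1 9| <= 1 / 400 * (z - 1).
Proof.
move=> a0 az z1 z3.
have o1 : 0 <= 1 :> R by lra.
have o19 : 1 <= 9 :> R by lra.
have C5 : 5 <= 1 * z + 9 by lra.
apply: le_trans (vpair_abs a0 z1 o1 o19 C5) _.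
rewrite mulrC; apply: ler_wpM2r; first by lra.
rewrite mul1r ler0_norm; last by lra.
have azg := az_ge a0 az.
have z4 : z <= 4 by lra.
clear az z3.
have h1 : vpoly a (z + 9) <= 12 * (13 * a).
  have a1 : 0 <= a by lra.
  have k1 : (z + 9) * a <= 13 * a by rewrite ler_wpM2r//; lra.
  have k3 : 14 <= (z + 9) * a by have : 10 * (141 / 100) <= (z + 9) * a by [apply: ler_pM; lra]; lra.
  have : (z + 9 - 1) * ((z + 9) * a - 5 / 2) <= 12 * (13 * a) by apply: ler_pM; lra.
  by rewrite /vpoly; lra.
have h2 : 1 + 9 + a * (- (z - 9) * (9 - 1)) <= 10 + 64 * a.
  have : a * (9 - z) <= a * 8 by rewrite ler_wpM2l//; lra.
  lra.
have t0 : 0 <= a - 141 / 100 by lra.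
have m1 := @lin_exp (141 / 100) 1 _ t0; have m2 := @lin_exp 101 64 _ t0.
have e0 := expR_ge0 (a - 141 / 100).
have h3 : 12 * (13 * a) * (10 + 64 * a) <= 156 * (141 / 100) * 101 * (expR (a - 141 / 100) * expR (a - 141 / 100)).
  have u1 : a <= 141 / 100 * expR (a - 141 / 100) by clear -m1; lra.
  have u2 : 10 + 64 * a <= 101 * expR (a - 141 / 100) by clear -m2; lra.
  have p1 : 0 <= a by clear -a0; lra.
  have p2 : 0 <= 10 + 64 * a by clear -a0; lra.
  have := ler_pM p1 p2 u1 u2; clear; move: (expR _) => u; lra.
clear m1 m2.
have C4 : 4 <= z + 9 by lra.
have [h0 _] := vpoly_mono a0 C4 (lexx _).
have h20 : 0 <= 1 + 9 + a * (- (z - 9) * (9 - 1)).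
  have : 0 <= a * (9 - z) by apply: mulr_ge0; [clear -a0; lra|clear -z4; lra].
  clear; lra.
rewrite /vfac mulrAC.
have k := le_trans (ler_pM h0 h20 h1 h2) h3.
apply: le_trans (ler_wpM2r (expR_ge0 _) k) _.
rewrite -[leLHS]mulrA -!expRD.
rewrite (_ : a - 141 / 100 + (a - 141 / 100) + - (a * (z + 9 - 1)) = - (6 * a + a * z + 141 / 50)); last by field.
clear -a0 azg; apply: (@mul_expRN_le _ _ ((65 / 24) ^+ 16 * (1 + 3 / 10)) _ (16%:R + 3 / 10)); [| |lra|lra].
  by clear; rewrite !exprS expr0; lra.
by clear; apply: expR_num; [lra|rewrite ler_wpM2l ?exprn_ge0//; rewrite ?exprS ?expr0; lra].
Qed.

End pairs.

(** * Pairs far from the origin *)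

Section tails.
Variable R : realType.
Implicit Types (s x y a z r : R) (p : int * int).

Lemma half_le : expR (- (7 / 10)) <= 1 / 2 :> R.
Proof.
rewrite expRN -[leRHS]invrK lef_pV2 ?posrE ?expR_gt0 ?invr_gt0//.
by have := @expR_ge_quart R (7 / 10); rewrite !exprS expr0; lra.
Qed.

Lemma half_pow (n : nat) (x : R) : n%:R <= x -> expR (- (7 / 10 * x)) <= (1 / 2) ^+ n.
Proof.
move=> nx; apply: (@le_trans _ _ (expR (n%:R * - (7 / 10)))); first by rewrite ler_expR; lra.
by rewrite expRM_natl lerXn2r ?nnegrE ?expR_ge0// half_le.
Qed.

(** An exponential majorant of S that is exact at S = l. *)
Lemma scale_exp (l c S : R) : 0 < l -> l <= expR c -> S <= expR (c + (S / l - 1)).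
Proof.
move=> l0 lc; rewrite expRD; have h := expR_ge1Dx (S / l - 1).
have := ler_pM (ltW l0) (expR_ge0 (S / l - 1)) lc (lexx _); apply: le_trans.
have : l * (S / l) <= l * expR (S / l - 1) by rewrite ler_pM2l//; lra.
by rewrite mulrC mulfVK// gt_eqF.
Qed.

Lemma axis_tail a z K (n : nat) : 141 / 100 <= a -> 1 <= z -> 16 <= K -> n%:R <= K - 12 ->
  - (1 / 500 * (1 / 2) ^+ n * (z - 1)) <= vpair a z 0 K.
Proof.
move=> a0 z1 K16 nK; have K4 : 4 <= K by lra.
apply: le_trans (vpair_axis a0 z1 K4); rewrite lerN2.
have K0 : 0 <= K by lra.
have a1 : 0 <= a by lra.
have sg : 0 <= z - 1 by lra.
have aK : 0 <= a * K by apply: mulr_ge0.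
have hK : vpoly a K <= K * (a * K).
  have : (K - 1) * (K * a - 5 / 2) <= K * (a * K).
    have : 141 / 100 * 16 <= a * K by apply: ler_pM; lra.
    by move=> ?; rewrite [K * a]mulrC; apply: ler_pM; lra.
  rewrite /vpoly; lra.
have [h0 _] := vpoly_mono a0 K4 (lexx _).
have e0 := expR_ge0 (- (a * (K - 1))).
apply: (@le_trans _ _ (K * (K * (a * K)) * expR (- (a * (K - 1))) * (a * K * (z - 1)))).
  apply: ler_pM.
  - by rewrite !mulr_ge0.
  - by rewrite subr_ge0 expR_le1 oppr_le0 mulr_ge0.
  - by rewrite ler_wpM2r// ler_wpM2l//.
  - exact: one_sub_exp_le.
rewrite [leLHS]mulrA ler_wpM2r//.
apply: le_trans (ler_wpM2l _ (half_pow nK)); last by lra.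
have e278 : 16 <= expR (279 / 100) :> R.
  rewrite (_ : 279 / 100 = 2%:R + 79 / 100); last by lra.
  by apply: expR_num; [lra|rewrite !exprS expr0; lra].
have sK := scale_exp K (_ : 0 < 16) e278.
have {}sK := sK (ltac:(lra)).
have s4 : K ^+ 4 <= expR (279 / 25 + (K / 4 - 4)).
  rewrite (_ : _ + _ = 4 * (279 / 100 + (K / 16 - 1))); last by field.
  by rewrite expRM_natl lerXn2r ?nnegrE ?expR_ge0.
have t0 : 0 <= a - 141 / 100 by lra.
have m1 := @lin_exp R (141 / 100) 1 _ t0.
have u1 : a <= 141 / 100 * expR (a - 141 / 100) by lra.
have aa := ler_pM a1 a1 u1 u1.
have e7 : 141 / 100 * (141 / 100) <= 1 / 500 * expR 7 :> R.
  have h := expR_natge R 7; apply: (@le_trans _ _ (1 / 500 * (65 / 24) ^+ 7)); first by clear; rewrite !exprS expr0; lra.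
  by apply: ler_wpM2l; [clear; lra|exact: h].
have -> : K * (K * (a * K)) * expR (- (a * (K - 1))) * (a * K) = (a * a) * K ^+ 4 * expR (- (a * (K - 1))) by ring.
have ea := expR_ge0 (a - 141 / 100).
have aa2 : a * a <= 1 / 500 * (expR 7 * (expR (a - 141 / 100) * expR (a - 141 / 100))).
  apply: (le_trans aa).
  have := ler_wpM2r (mulr_ge0 ea ea) e7; clear; move: (expR (a - _)) (expR 7) => u v; lra.
have := ler_wpM2r e0 (ler_pM (mulr_ge0 a1 a1) (exprn_ge0 4 K0) aa2 s4) => h; apply: (le_trans h).
rewrite -[leLHS]mulrA -[leLHS]mulrA; apply: ler_wpM2l; first by clear; lra.
rewrite -!expRD ler_expR.
have : 16 * (a - 141 / 100) <= K * (a - 141 / 100) by rewrite ler_wpM2r.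
clear -a0 K16; lra.
Qed.

Lemma interior_pre a z M K : 141 / 100 <= a -> 1 <= z -> z <= 361 / 100 ->
  0 <= M -> M <= K -> 13 <= M + K ->
  0 <= vpoly a (M * z + K) <= 7 / 3 * (M + K) * (7 / 3 * (a * (M + K))).
Proof.
move=> a0 z1 z3 M0 MK S13; have a1 : 0 <= a by lra.
have Mz : M * 1 <= M * z by apply: ler_wpM2l.
have Mz4 : M * z <= M * (361 / 100) by apply: ler_wpM2l.
have CS : M * z + K <= 7 / 3 * (M + K) by clear -Mz4 MK M0; lra.
have C13 : 13 <= M * z + K by clear -Mz S13; lra.
clear -a0 a1 CS C13; move: (M * z + K) (M + K) CS C13 => C S CS C13.
have C4 : 4 <= C by lra.
have [h0 _] := vpoly_mono a0 C4 (lexx _).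
rewrite h0 /=; clear h0 C4.
have k1 : C * a <= 7 / 3 * (a * S) by have := ler_wpM2r a1 CS; clear; lra.
have k2 : 13 * (7 / 5) <= C * a by apply: ler_pM; clear -C13 a0; lra.
have : (C - 1) * (C * a - 5 / 2) <= 7 / 3 * S * (7 / 3 * (a * S)).
  by apply: ler_pM; clear -CS C13 k1 k2; lra.
by rewrite /vpoly; clear; lra.
Qed.

(** As [rest_bound], now tangent at S = 13. *)
Lemma interior_num a (S : R) (n : nat) : 141 / 100 <= a -> 13 <= S -> n%:R <= S - 8 ->
  7 / 3 * S * (7 / 3 * (a * S)) * (S * (1 + a * S)) * expR (- (a * (S - 2) + (10 - 7 / 2 * a))) <=
  2 / 125 * (1 / 2) ^+ n.
Proof.
move=> a0 S13 nS; have c0 : 0 <= 2 / 125 :> R by clear; lra.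
apply: le_trans (ler_wpM2l c0 (half_pow nS)).
have e1 : 13 <= expR (129 / 50) :> R.
  rewrite (_ : 129 / 50 = 2%:R + 29 / 50); last by clear; lra.
  by apply: expR_num; clear; [lra|rewrite !exprS expr0; lra].
have p13 : 0 < 13 :> R by clear; lra.
have sS := scale_exp S p13 e1; clear e1.
have S0 : 0 <= S by clear -S13; lra.
have a1 : 0 <= a by clear -a0; lra.
have s3 : S ^+ 3 <= expR (387 / 50 + (S * (3 / 13) - 3)).
  rewrite (_ : _ + _ = 3 * (129 / 50 + (S / 13 - 1))); last by field.
  by rewrite expRM_natl lerXn2r ?nnegrE ?expR_ge0.
clear sS.
have m1 : a <= 141 / 100 * expR (a - 141 / 100).
  by have := expR_ge1Dx (a - 141 / 100); clear -a0; lra.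
have m2 : 1 + a * S <= 97 / 5 * (expR (a - 141 / 100) * expR (S / 13 - 1)).
  have u1 : a / (141 / 100) <= expR (a - 141 / 100) by rewrite ler_pdivrMr; clear -m1; lra.
  have u3 : 0 <= a / (141 / 100) by apply: divr_ge0 => //; clear; lra.
  have u4 : 0 <= S / 13 by clear -S0; lra.
  have u5 : S / 13 <= expR (S / 13 - 1) by have := expR_ge1Dx (S / 13 - 1); clear; lra.
  have := ler_pM u3 u4 u1 u5; rewrite (_ : a / (141 / 100) * (S / 13) = a * S * (100 / 1833)); last by field.
  have : 7 / 5 * 13 <= a * S by apply: ler_pM => //; clear -a0; lra.
  clear; lra.
have e9 : 7 / 3 * (7 / 3) * (141 / 100) * (97 / 5) <= 2 / 125 * expR (46 / 5) :> R.
  have h : (65 / 24) ^+ 9 * (61 / 50) <= expR (46 / 5) :> R.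
    rewrite (_ : 46 / 5 = 9%:R + 1 / 5); last by clear; lra.
    by apply: expR_num; [clear; lra|apply: ler_wpM2l; [apply: exprn_ge0; clear; lra|clear; rewrite !exprS expr0; lra]].
  apply: (@le_trans _ _ (2 / 125 * ((65 / 24) ^+ 9 * (61 / 50)))); first by clear; rewrite !exprS expr0; lra.
  exact: ler_wpM2l.
have -> : 7 / 3 * S * (7 / 3 * (a * S)) * (S * (1 + a * S)) = 7 / 3 * (7 / 3) * (a * (1 + a * S)) * S ^+ 3.
  by rewrite !exprS expr0; ring.
have ea := expR_ge0 (a - 141 / 100); have eS := expR_ge0 (S / 13 - 1).
have aS : 0 <= 1 + a * S by apply: addr_ge0 => //; exact: mulr_ge0.
have w1 : 7 / 3 * (7 / 3) * (a * (1 + a * S)) <= 2 / 125 * (expR (46 / 5) * (expR (a - 141 / 100) * (expR (a - 141 / 100) * expR (S / 13 - 1)))).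
  have p0 : 0 <= expR (a - 141 / 100) * (expR (a - 141 / 100) * expR (S / 13 - 1)) by apply: mulr_ge0 => //; exact: mulr_ge0.
  have := ler_wpM2r p0 e9; have := ler_pM a1 aS m1 m2; clear.
  move: (1 + a * S) (expR (a - _)) (expR (S / 13 - 1)) (expR (46 / 5)) => b u v w.
  lra.
have w0 : 0 <= 7 / 3 * (7 / 3) * (a * (1 + a * S)) by apply: mulr_ge0; [clear; lra|exact: mulr_ge0].
have := ler_wpM2r (expR_ge0 (- (a * (S - 2) + (10 - 7 / 2 * a)))) (ler_pM w0 (exprn_ge0 3 S0) w1 s3) => h.
apply: (le_trans h); rewrite -[leLHS]mulrA -[leLHS]mulrA; apply: ler_wpM2l => //.
rewrite -!expRD ler_expR; clear -S13 a0.
have : 13 * (a - 141 / 100) <= S * (a - 141 / 100) by apply: ler_wpM2r; lra.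
lra.
Qed.

Lemma interior_tail a z M K (n : nat) : 141 / 100 <= a -> 359 / 50 <= a ^+ 2 * z -> 1 <= z -> z <= 361 / 100 ->
  1 <= M -> M <= K -> 13 <= M + K -> n%:R <= M + K - 8 ->
  `|vpair a z M K| <= 2 / 125 * (1 / 2) ^+ n * (z - 1).
Proof.
move=> a0 az z1 z3 M1 MK S13 nS.
have M0 : 0 <= M by clear -M1; lra.
have a1 : 0 <= a by clear -a0; lra.
have z4 : z <= 4 by clear -z3; lra.
have azg := az_ge a0 az.
have C5 : 5 <= M * z + K.
  by have := ler_wpM2l M0 z1; clear -S13; lra.
apply: le_trans (vpair_abs a0 z1 M0 MK C5) _.
rewrite mulrC; apply: ler_wpM2r; first by clear -z1; lra.
have /andP[h0 h1] := interior_pre a0 z1 z3 M0 MK S13.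
have B := ler_wpM2l a1 (cross_le z1 z4 M0 MK).
have B0 : 0 <= a * (`|M * z - K| * (K - M)).
  by apply: mulr_ge0 => //; apply: mulr_ge0 => //; rewrite subr_ge0.
have h2 : M + K + a * (`|M * z - K| * (K - M)) <= (M + K) * (1 + a * (M + K)) by move: B; clear; lra.
have h20 : 0 <= M + K + a * (`|M * z - K| * (K - M)) by move: B0; clear -M0 MK; lra.
have X : a * (M + K - 2) + (10 - 7 / 2 * a) <= a * (M * z + K - 1).
  have k : 0 <= (M - 1) * (z - 1) by apply: mulr_ge0; rewrite subr_ge0.
  by have := mulr_ge0 a1 k; clear -azg; lra.
rewrite /vfac mulrAC; apply: le_trans (interior_num a0 S13 nS).
apply: ler_pM; rewrite ?expR_ge0//; first exact: mulr_ge0.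
  exact: ler_pM.
by rewrite ler_expR lerN2.
Qed.
End tails.

(** * Summing all pairs on the line x = 1/2 *)

Section vert.
Variable R : realType.
Implicit Types (s x y a z r : R) (p : int * int).

Definition range7 : seq int := [:: 0; 1; -1; 2; -2; 3; -3].
(** All pairs with |m|, |k| at most 3; outside of it m^2 + k^2 >= 16. *)
Definition box7 : seq (int * int) := [seq (m, k) | m <- range7, k <- range7].

Lemma rng7_in (m : int) : m \in range7 -> m * m = 0 \/ m * m = 1 \/ m * m = 4 \/ m * m = 9.
Proof.
rewrite !inE => h.
have : m = 0 \/ (m = 1 \/ m = -1) \/ (m = 2 \/ m = -2) \/ (m = 3 \/ m = -3) by lia.
case=> [->|[h1|[h1|h1]]]; [by left|right; left|right; right; left|right; right; right].
all: by case: h1 => ->.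
Qed.

Lemma rng7_out (m : int) : m \notin range7 -> 16 <= m * m.
Proof.
move=> h; have h4 : (3 < `|m|)%N by move: h; rewrite !inE; lia.
have e : m * m = Posz `|m| * Posz `|m| by rewrite abszE -normrM ger0_norm -?expr2 ?sqr_ge0.
by rewrite e; move: `|m|%N h4 => k k0; nia.
Qed.

Lemma box7_in p : p \in box7 -> p.1 \in range7 /\ p.2 \in range7.
Proof. by case/allpairsP => -[m k] /= [hm hk ->]. Qed.

Lemma box7_out p : p \notin box7 -> 16 <= p.1 * p.1 + p.2 * p.2.
Proof.
move=> h; have sq (m : int) : 0 <= m * m by rewrite -expr2 sqr_ge0.
have [h1|/rng7_out h1] := boolP (p.1 \in range7); last by have := sq p.2; lia.
have [h2|/rng7_out h2] := boolP (p.2 \in range7); last by have := sq p.1; lia.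
by move: h; rewrite (surjective_pairing p) allpairs_f.
Qed.

(** The bound depends only on m^2 + k^2, which determines {m^2, k^2} up to 10.
    *)
Definition vbound (v1 v2 v4 v5 v9 v10 : R) p : R :=
  let S := p.1 * p.1 + p.2 * p.2 in
  if S == 1 then v1 else if S == 2 then v2 else if S == 4 then v4 else
  if S == 5 then v5 else if S == 9 then v9 else if S == 10 then v10 else 0.

Lemma vbound_out v1 v2 v4 v5 v9 v10 p : p \notin box7 -> vbound v1 v2 v4 v5 v9 v10 p = 0.
Proof.
move/box7_out; rewrite /vbound; move: (_ + _) => S S16.
by do 6 (case: eqP => [e|_]; first by lia).
Qed.

Lemma vbound_sum v1 v2 v4 v5 v9 v10 : asum (vbound v1 v2 v4 v5 v9 v10) =
  4 * v1 + 4 * v2 + 4 * v4 + 8 * v5 + 4 * v9 + 8 * v10.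
Proof.
rewrite (@asum_fin _ _ _ box7)//; last by move=> p; exact: vbound_out.
by rewrite /box7 big_allpairs /range7 !big_cons !big_nil /vbound /=; ring.
Qed.

Lemma phase_half_axis p : p.1 * p.2 = 0 -> phase (1 / 2) p = 1 :> R.
Proof. by move=> e; rewrite /phase -intrM e mulr0 cos0. Qed.

Lemma phase_half_odd p : p.1 * p.2 = 1 \/ p.1 * p.2 = -1 -> phase (1 / 2) p = -1 :> R.
Proof.
move=> H; rewrite /phase -intrM; have -> : 2 * pi * (1 / 2) = pi :> R by field.
by case: H => ->; rewrite ?rmorphN1 ?mulr1 ?mulrN1 ?cosN cospi.
Qed.

Lemma phase_half_even p (N : int) : p.1 * p.2 = 2 * N -> phase (1 / 2) p = 1 :> R.
Proof.
move=> e; rewrite /phase -intrM e intrM -[2%:~R]/(2 : R).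
have -> : 2 * pi * (1 / 2) * (2 * N%:~R) = 2 * pi * N%:~R :> R by field.
exact: cos_2pi_int.
Qed.

(** Majorant for the pairs with m^2 + k^2 >= 13: interior ones and, with a
    smaller constant, those on the axes. *)
Definition vtail z p : R := (z - 1) * (2 / 125 * (geom_pos R p.1 * geom_pos R p.2) + 1 / 500 * geom2 (1 / 2) p).

Lemma sq_absE (m : int) : m * m = Posz (`|m| * `|m|)%N.
Proof. by rewrite PoszM abszE -normrM ger0_norm -?expr2 ?sqr_ge0. Qed.

Lemma sq_axis (m : int) : 13 <= m * m -> 16 <= m * m /\ Posz `|m| + 12 <= m * m.
Proof.
rewrite sq_absE; move: `|m|%N => k k13.
have k4 : (3 < k)%N by nia.
by split; nia.
Qed.

Lemma sq_interior (m k : int) : m != 0 -> k != 0 -> 13 <= m * m + k * k ->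
  Posz (`|m| + `|k|) + 8 <= m * m + k * k.
Proof.
rewrite !sq_absE -!absz_eq0; move: `|m|%N `|k|%N => i j i0 j0 S13.
have [i1|[i1|[i1|i1]]] : (i = 1 \/ i = 2 \/ i = 3 \/ 4 <= i)%N by lia.
all: have [j1|[j1|[j1|j1]]] : (j = 1 \/ j = 2 \/ j = 3 \/ 4 <= j)%N by lia.
all: by rewrite ?i1 ?j1 in S13 *; nia.
Qed.

Lemma vert_far a z p : 141 / 100 <= a -> 359 / 50 <= a ^+ 2 * z -> 1 <= z -> z <= 361 / 100 ->
  13 <= p.1 * p.1 + p.2 * p.2 ->
  - vtail z p <= phase (1 / 2) p * vpair a z ((p.1 * p.1)%:~R) ((p.2 * p.2)%:~R).
Proof.
move=> a0 az z1 z3 S13.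
have sg : 0 <= z - 1 by lra.
have h2 : 0 <= 1 / 2 :> R by lra.
have u0 m : 0 <= geom_pos R m by rewrite /geom_pos; case: eqP => // _; exact: exprn_ge0.
have d0 : 0 <= geom2 (1 / 2 : R) p by apply: exprn_ge0.
have [ax|nax] := eqVneq (p.1 * p.2) 0.
  rewrite phase_half_axis// mul1r.
  apply: (@le_trans _ _ (- (1 / 500 * (1 / 2) ^+ (`|p.1| + `|p.2|)%N * (z - 1)))).
    rewrite lerN2 /vtail mulrC; apply: ler_wpM2l => //; rewrite /geom2 lerDr.
    by apply: mulr_ge0; [lra|exact: mulr_ge0].
  move/eqP: ax; rewrite mulf_eq0 => /orP[]/eqP e0; rewrite e0 mul0r.
    have [K16 n12] : 16 <= p.2 * p.2 /\ Posz `|p.2| + 12 <= p.2 * p.2 by apply: sq_axis; rewrite e0 mul0r add0r in S13.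
    clear S13; apply: axis_tail => //; first by rewrite -[16]/(16%:~R) ler_int.
    by rewrite lerBrDr -[_%:R]/((Posz (`|0| + `|p.2|)%N)%:~R) -[12]/(12%:~R) -intrD ler_int.
  have [K16 n12] : 16 <= p.1 * p.1 /\ Posz `|p.1| + 12 <= p.1 * p.1.
    by apply: sq_axis; rewrite e0 mul0r addr0 in S13.
  clear S13; rewrite vpair_sym; apply: axis_tail => //; first by rewrite -[16]/(16%:~R) ler_int.
  by rewrite addn0 lerBrDr -[_%:R]/((Posz `|p.1|%N)%:~R) -[12]/(12%:~R) -intrD ler_int.
have [m0 k0] : p.1 != 0 /\ p.2 != 0 by apply/andP; rewrite -negb_or -mulf_eq0.
have [m1 m2] := sq_ge_abs m0; have [k1 k2] := sq_ge_abs k0.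
have n8 := sq_interior m0 k0 S13.
have E : geom_pos R p.1 * geom_pos R p.2 = (1 / 2) ^+ (`|p.1| + `|p.2|)%N by rewrite /geom_pos (negPf m0) (negPf k0) exprD.
have {}n8 : (`|p.1| + `|p.2|)%N%:R <= (p.1 * p.1)%:~R + (p.2 * p.2)%:~R - 8 :> R.
  by rewrite lerBrDr -[_%:R]/((Posz (`|p.1| + `|p.2|)%N)%:~R) -[8]/(8%:~R) -!intrD ler_int.
have {}S13 : 13 <= (p.1 * p.1)%:~R + (p.2 * p.2)%:~R :> R by rewrite -intrD -[13]/(13%:~R) ler_int.
have {}m2 : 1 <= (p.1 * p.1)%:~R :> R by rewrite -[1]/(1%:~R) ler_int.
have {}k2 : 1 <= (p.2 * p.2)%:~R :> R by rewrite -[1]/(1%:~R) ler_int.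
have ph := phase_le1 (1 / 2 : R) p.
have T : `|vpair a z (p.1 * p.1)%:~R (p.2 * p.2)%:~R| <= vtail z p.
  apply: (@le_trans _ _ (2 / 125 * (1 / 2) ^+ (`|p.1| + `|p.2|)%N * (z - 1))); last first.
    rewrite /vtail E mulrC; apply: ler_wpM2l => //; rewrite lerDl.
    by apply: mulr_ge0; [lra|].
  have [MK|/ltW MK] := leP ((p.1 * p.1)%:~R : R) (p.2 * p.2)%:~R; first exact: interior_tail.
  by rewrite vpair_sym; rewrite [(p.1 * p.1)%:~R + _]addrC in S13 n8; exact: interior_tail.
rewrite lerNl; apply: le_trans (ler_norm _) _; rewrite normrN normrM -[leRHS]mul1r.
by apply: ler_pM.
Qed.

Lemma vtail_ge0 z p : 1 <= z -> 0 <= vtail z p.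
Proof.
move=> z1; have u0 m : 0 <= geom_pos R m by rewrite /geom_pos; case: eqP => // _; exact: exprn_ge0.
apply: mulr_ge0; first by lra.
apply: addr_ge0; first by apply: mulr_ge0; [lra|exact: mulr_ge0].
by apply: mulr_ge0; [lra|apply: exprn_ge0].
Qed.

(** The number in vb1, vb2, vb4, vb5 is m^2 + k^2. *)
Definition vb1 a z := vpair a z 0 1 : R.
Definition vb2 a z := vpair a z 1 1 : R.
Definition vb4 a z : R := 4 * (12 * a - 17 / 2) * expR (- (3 * a)) * (1 - expR (- (4 * (a * (z - 1))))).
Definition vb5 a z : R := (z - 1) * (vfac a (z + 4) * (5 + 3 * a * (4 - z))).

Lemma vert_term a z p : 141 / 100 <= a -> 359 / 50 <= a ^+ 2 * z -> 1 <= z -> z <= 361 / 100 ->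
  vbound (vb1 a z) (- vb2 a z) (- vb4 a z) (- vb5 a z) (- (3 / 250 * (z - 1))) (- (1 / 400 * (z - 1))) p - vtail z p
  <= phase (1 / 2) p * vpair a z ((p.1 * p.1)%:~R) ((p.2 * p.2)%:~R).
Proof.
move=> a0 az z1 z3; have v0 := vtail_ge0 p z1.
have weak (V v : R) : V <= v -> v <= phase (1 / 2) p * vpair a z ((p.1 * p.1)%:~R) ((p.2 * p.2)%:~R) ->
  V - vtail z p <= phase (1 / 2) p * vpair a z ((p.1 * p.1)%:~R) ((p.2 * p.2)%:~R).
  by move=> Vv h; apply: le_trans h; lra.
have far := @vert_far a z p a0 az z1 z3.
have [pb|pb] := boolP (p \in box7); last first.
  rewrite vbound_out// sub0r; apply: far; have := box7_out pb; lia.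
have [/rng7_in hm /rng7_in hk] := box7_in pb.
have az0 (m : int) : m * m = 0 -> m = 0 by move=> /eqP; rewrite mulf_eq0 => /orP[]/eqP.
have ax_l : p.1 * p.1 = 0 -> phase (1 / 2) p = 1 :> R by move=> /az0 e; apply: phase_half_axis; rewrite e mul0r.
have ax_r : p.2 * p.2 = 0 -> phase (1 / 2) p = 1 :> R by move=> /az0 e; apply: phase_half_axis; rewrite e mulr0.
have absb (v : R) (M K : R) : `|vpair a z M K| <= v -> - v <= phase (1 / 2) p * vpair a z M K.
  move=> h; rewrite lerNl; apply: le_trans (ler_norm _) _; rewrite normrN normrM -[leRHS]mul1r.
  by apply: ler_pM => //; exact: phase_le1.
have n0 : 0 <= 1 :> R by lra.
have n14 : 1 <= 4 :> R by lra.
have c14 : 5 <= 1 * z + 4 by lra.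
have B2 : `|vpair a z 1 4| <= vb5 a z.
  apply: le_trans (vpair_abs a0 z1 n0 n14 c14) _; rewrite mul1r ler0_norm; last by lra.
  rewrite /vb5 (_ : 1 + 4 + a * (- (z - 4) * (4 - 1)) = 5 + 3 * a * (4 - z)) ?lexx//; ring.
have A2 : - vb4 a z <= vpair a z 0 4.
  apply: le_trans (vpair_axis a0 z1 (lexx 4)); rewrite lerN2 /vb4.
  have -> : vpoly a 4 = 12 * a - 17 / 2 by rewrite /vpoly; field.
  rewrite (_ : a * (4 - 1) = 3 * a) 1?(_ : a * 4 * (z - 1) = 4 * (a * (z - 1))) ?lexx//; ring.
have A9 := vpair_0_9_ge a0 az z1.
have B9 := vpair_1_9_le a0 az z1 z3.
move: far weak; rewrite /vbound.
case: hm => [m|[m|[m|m]]]; case: hk => [k|[k|[k|k]]]; rewrite m k /= => far weak.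
- apply: (weak _ 0) => //; rewrite (ax_l m) /vpair; lra.
- by apply: (weak _ _ (lexx _)); rewrite (ax_l m) mul1r.
- by apply: (weak _ _ (lexx _)); rewrite (ax_l m) mul1r.
- by apply: (weak _ _ (lexx _)); rewrite (ax_l m) mul1r.
- by apply: (weak _ _ (lexx _)); rewrite (ax_r k) mul1r vpair_sym.
- apply: (weak _ _ (lexx _)); rewrite phase_half_odd ?mulN1r//.
  have : (p.1 * p.2) * (p.1 * p.2) = 1 by rewrite mulrACA m k.
  by move: (p.1 * p.2) => N; rewrite -expr2 => /eqP; rewrite sqrf_eq1 => /orP[]/eqP ->; [left|right].
- by apply: (weak _ _ (lexx _)); exact: absb.
- by apply: (weak _ _ (lexx _)); exact: absb.
- by apply: (weak _ _ (lexx _)); rewrite (ax_r k) mul1r vpair_sym.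
- by apply: (weak _ _ (lexx _)); rewrite vpair_sym; exact: absb.
- apply: (weak _ 0) => //.
  have -> : phase (1 / 2) p = 1 :> R.
    have : (p.1 * p.2) * (p.1 * p.2) = 4 * 4 by rewrite mulrACA m k.
    move=> e; have : p.1 * p.2 = 2 * 2 \/ p.1 * p.2 = 2 * -2.
      by move: (p.1 * p.2) e => N; rewrite -!expr2 => /eqP; rewrite eqf_sqr => /orP[]/eqP ->; [left|right].
    by case=> /phase_half_even.
  have C4 : 4 <= 4 * z + 4 by lra.
  have [h0 _] := vpoly_mono a0 C4 (lexx _).
  rewrite mul1r /vpair -[4%:~R]/(4 : R) -mulrDl.
  apply: mulr_ge0; first by lra.
  by rewrite /vfac mulr_ge0 ?expR_ge0.
- by rewrite sub0r; apply: far.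
- by apply: (weak _ _ (lexx _)); rewrite (ax_r k) mul1r vpair_sym.
- by apply: (weak _ _ (lexx _)); rewrite vpair_sym; exact: absb.
- by rewrite sub0r; apply: far.
- by rewrite sub0r; apply: far.
Qed.

(** Multiplication by e^(a (z - 1)) turns the explicit terms into [edge_expr].
    *)
Lemma vb_edge a z :
  (vb1 a z - vb2 a z - vb4 a z - 2 * vb5 a z - 1 / 25 * (z - 1)) * expR (a * (z - 1)) = edge_expr a z.
Proof.
rewrite /vb1 /vb2 /vb4 /vb5 /vpair /edge_expr.
have r1 : vfac a 1 = -1 by rewrite /vfac /vpoly subrr mul0r mulr0 oppr0 expR0; ring.
have rz : vfac a z * expR (a * (z - 1)) = (z - 1) * (z * a - 5 / 2) - 1.
  by rewrite /vfac -mulrA -expRD addNr expR0 mulr1.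
have r1z : vfac a (1 + z) * expR (a * (z - 1)) = vpoly a (1 + z) * expR (- a).
  by rewrite /vfac -mulrA -expRD; congr (_ * expR _); ring.
have rz4 : vfac a (z + 4) * expR (a * (z - 1)) = vpoly a (z + 4) * expR (- (4 * a)).
  by rewrite /vfac -mulrA -expRD; congr (_ * expR _); ring.
have e4 : expR (- (4 * (a * (z - 1)))) * expR (a * (z - 1)) = expR (- (3 * (a * (z - 1)))).
  by rewrite -expRD; congr (expR _); ring.
rewrite !mul0r !add0r !mul1r !addr0 subr0 [z + 1]addrC r1.
have := congr1 (fun t => z * t) rz; have := congr1 (fun t => 2 * (z - 1) * t) r1z.
have := congr1 (fun t => 2 * (z - 1) * (5 + 3 * a * (4 - z)) * t) rz4.
have := congr1 (fun t => 4 * (12 * a - 17 / 2) * expR (- (3 * a)) * t) e4; clear.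
move: (vfac a z) (vfac a (z + 4)) (vfac a (1 + z)) (vpoly a (z + 4)) (vpoly a (1 + z)) => q u v u' v'.
move: (expR (a * (z - 1))) (expR (- (4 * (a * (z - 1))))) (expR (- (3 * (a * (z - 1))))) => X X4 X3.
move: (expR (- (3 * a))) (expR (- (4 * a))) (expR (- a)) => E3 E4 E1 /=.
lra.
Qed.

Lemma asummable_vtail z : asummable (vtail z).
Proof.
have h : 0 <= (1 / 2 : R) < 1 by apply/andP; split; lra.
apply: asummableZ; apply: asummableD; apply: asummableZ; last exact: asummable_geom2.
exact: asummable_prod2 (asummable_geom_pos R) (asummable_geom_pos R).
Qed.

Lemma asum_vtail z : 1 <= z -> asum (vtail z) <= 41 / 500 * (z - 1).
Proof.
move=> z1; have h : 0 <= (1 / 2 : R) < 1 by apply/andP; split; lra.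
have su := asummable_prod2 (asummable_geom_pos R) (asummable_geom_pos R).
have sd := asummable_geom2 h.
rewrite /vtail asumZ; last by apply: asummableD; exact: asummableZ.
rewrite mulrC; apply: ler_wpM2r; first by lra.
rewrite asumD ?asumZ//; try exact: asummableZ.
rewrite asum_prod2; try exact: asummable_geom_pos.
have /andP[u0 u2] := asum_geom_pos R.
have u4 : asum (geom_pos R) * asum (geom_pos R) <= 2 * 2 by exact: ler_pM.
have := asum_geom2 h; rewrite (_ : (1 + 1 / 2) / (1 - 1 / 2) = 3 :> R) ?expr2; last by field.
lra.
Qed.
End vert.

(** * Monotonicity on the line x = 1/2 *)

Section mono.
Variable R : realType.
Implicit Types (s x y a z r : R) (p : int * int).

Definition moment_term z (j : nat) a p : R := phase (1 / 2) p * (dual_weight z p * dual_form z p ^+ j) * expR (- (a * dual_form z p)).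
(** Moments of the dual sum at x = 1/2; differentiation in a raises the index.
    *)
Definition moment z j a : R := asum (moment_term z j a).

Lemma moment_term_bound z (j : nat) (l a : R) p : 1 <= z -> 0 < l -> l <= a ->
  `|moment_term z j a p| <= z ^+ j.+1 * ((1 + sqnorm R p) ^+ j.+1 * expR (- (l * sqnorm R p))).
Proof.
move=> z1 l0 la; have z0 : 0 <= z by lra.
have c0 := dual_form_ge0 p z0; have n0 := sqnorm_ge0 R p.
rewrite /moment_term normrM (ger0_norm (expR_ge0 _)) [leRHS]mulrA.
apply: ler_pM; rewrite ?normr_ge0 ?expR_ge0//; last first.
  rewrite ler_expR lerN2; apply: ler_pM; [exact: ltW|done|done|exact: dual_form_ge].
rewrite normrM normrM normrX (ger0_norm c0) -[leRHS]mul1r.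
apply: ler_pM; rewrite ?mulr_ge0 ?exprn_ge0//; first exact: phase_le1.
have cz : dual_form z p <= z * (1 + sqnorm R p).
  rewrite /dual_form /sqnorm; have m0 := sqr_ge0 (p.1%:~R : R); have k0 := sqr_ge0 (p.2%:~R : R).
  have : 1 * p.2%:~R ^+ 2 <= z * p.2%:~R ^+ 2 by rewrite ler_wpM2r.
  lra.
apply: (@le_trans _ _ (dual_form z p * dual_form z p ^+ j)); first by rewrite ler_wpM2r ?exprn_ge0// dual_weight_dual_form.
rewrite -exprS -exprMn lerXn2r// nnegrE mulr_ge0//; lra.
Qed.

Lemma asummable_moment_term z j a : 1 <= z -> 0 < a -> asummable (moment_term z j a).
Proof.
move=> z1 a0; apply: asummable_le (asummableZ _ (asummable_poly j.+1 a0)) => p.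
exact: (moment_term_bound j p z1 a0 (lexx a)).
Qed.

Lemma derive_moment z j a : 1 <= z -> 0 < a -> is_derive a 1 (moment z j) (- moment z j.+1 a).
Proof.
move=> z1 a0; have a2 : 0 < a / 2 by lra.
have -> : - moment z j.+1 a = asum (fun p => - moment_term z j.+1 a p) by rewrite asumN//; exact: asummable_moment_term.
apply: (@is_derive_asum _ _ (fun t p => moment_term z j t p) (fun t p => - moment_term z j.+1 t p)
  (fun p => z ^+ j.+2 * ((1 + sqnorm R p) ^+ j.+2 * expR (- (a / 2 * sqnorm R p)))) a (a / 2) (2 * a)).
- by apply/andP; split; lra.
- by apply: asummableZ; exact: asummable_poly.
- by move=> t /andP[t1 _]; apply: asummable_moment_term => //; exact: lt_le_trans t1.
- move=> t p _; rewrite /moment_term; dsolve; rewrite /= exprS; ring.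
- by move=> t p /andP[t1 _]; rewrite normrN; exact: moment_term_bound.
Qed.

(** Up to a positive factor, the derivative in y of the slope at x = 1/2. The
    factor e^a is chosen so that the derivative in a has no exponential left
    in its leading term. *)
Definition vsign z a : R := expR a * (3 / 2 * moment z 0 a - a * moment z 1 a).

Lemma vfac_moment_term z a p : phase (1 / 2) p * (dual_weight z p * vfac a (dual_form z p)) =
  expR a * (3 / 2 * moment_term z 0 a p - (a + 5 / 2) * moment_term z 1 a p + a * moment_term z 2 a p).
Proof.
rewrite /moment_term /vfac /vpoly (_ : - (a * (dual_form z p - 1)) = a + - (a * dual_form z p)); last by ring.
by rewrite expRD; move: (expR a) (expR _) (dual_form z p) (dual_weight z p) (phase _ _) => *; field.
Qed.

Lemma asummable_vfac z a : 1 <= z -> 0 < a ->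
  asummable (fun p => phase (1 / 2) p * (dual_weight z p * vfac a (dual_form z p))).
Proof.
move=> z1 a0; rewrite (funext (vfac_moment_term z a)).
apply: asummableZ; apply: asummableD; [apply: asummableB|]; apply: asummableZ; exact: asummable_moment_term.
Qed.

Lemma derive_vsign z a : 1 <= z -> 0 < a ->
  is_derive a 1 (vsign z) (asum (fun p => phase (1 / 2) p * (dual_weight z p * vfac a (dual_form z p)))).
Proof.
move=> z1 a0.
have s0 := asummable_moment_term 0 z1 a0; have s1 := asummable_moment_term 1 z1 a0; have s2 := asummable_moment_term 2 z1 a0.
have -> : asum (fun p => phase (1 / 2) p * (dual_weight z p * vfac a (dual_form z p))) =
  expR a * (3 / 2 * moment z 0 a - (a + 5 / 2) * moment z 1 a + a * moment z 2 a).
  rewrite /moment -!asumZ// -asumB; [|exact: asummableZ..].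
  rewrite -asumD; [|by apply: asummableB; exact: asummableZ|exact: asummableZ].
  rewrite -asumZ; last by apply: asummableD; [apply: asummableB; exact: asummableZ|exact: asummableZ].
  by apply: eq_asum => p; exact: vfac_moment_term.
have d0 := derive_moment 0 z1 a0; have d1 := derive_moment 1 z1 a0.
have H := dmul (dexp (did a)) (dadd (dmul (dcst (3 / 2) a) d0) (dopp (dmul (did a) d1))).
by apply: (deq H) => /=; field.
Qed.

(** Explicit terms from [edge_expr_ge0], the others from [vbound] and [vtail];
    12/1000 + 5/1000 + 41/2000 is below 1/25. *)
Lemma vderiv_ge0 s a : 1 <= s -> s <= 19 / 10 -> 67 / 25 <= a * s ->
  0 <= asum (fun p => phase (1 / 2) p * (dual_weight (s ^+ 2) p * vfac a (dual_form (s ^+ 2) p))).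
Proof.
move=> s1 s2 as_; have core := edge_expr_ge0 s1 s2 as_.
have a0 : 141 / 100 <= a.
  rewrite leNgt; apply/negP => al; have : a * s <= 141 / 100 * (19 / 10); last by lra.
  have [a0|a0] := leP 0 a; first by apply: ler_pM; lra.
  have : a * s <= 0 by rewrite mulr_le0_ge0//; lra.
  lra.
have az : 359 / 50 <= a ^+ 2 * s ^+ 2.
  rewrite -exprMn expr2; apply: (@le_trans _ _ (67 / 25 * (67 / 25))); first by clear; lra.
  by apply: ler_pM; [clear; lra|clear; lra|exact: as_|exact: as_].
have z1 : 1 <= s ^+ 2 by rewrite expr2; have : 1 * 1 <= s * s by [apply: ler_pM]; lra.
have z2 : s ^+ 2 <= 361 / 100 by rewrite expr2; have : s * s <= 19 / 10 * (19 / 10) by [apply: ler_pM; lra]; lra.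
clear as_ s1 s2; move: (s ^+ 2) core az z1 z2 => z core az z1 z2.
have ap : 0 < a by lra.
pose u p := phase (1 / 2) p * (dual_weight z p * vfac a (dual_form z p)).
have su : asummable u := asummable_vfac z1 ap.
have swb : bijective swap by exists swap => -[].
have su2 : asummable (fun p => u (swap p)) := reindex_asummable (bij_inj swb) su.
have E : asum u = asum (fun p => u (swap p)) := reindex_asum _ swb.
suff : 0 <= asum (fun p => u p + u (swap p)) by rewrite asumD// -E -/u; lra.
have uE p : u p + u (swap p) = phase (1 / 2) p * vpair a z ((p.1 * p.1)%:~R) ((p.2 * p.2)%:~R).
  rewrite /u /vpair /dual_weight /dual_form /phase /= -!int_sq ![p.2%:~R * p.1%:~R]mulrC.
  by rewrite -[LHS]mulrDr.
have sV : asummable (vbound (vb1 a z) (- vb2 a z) (- vb4 a z) (- vb5 a z) (- (3 / 250 * (z - 1))) (- (1 / 400 * (z - 1)))).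
  by apply: (@asummable_fin _ _ _ box7) => p; exact: vbound_out.
have sT := asummable_vtail z.
apply: le_trans (ler_asum (asummableB sV sT) (asummableD su su2) _); last first.
  by move=> p; rewrite uE; exact: vert_term.
rewrite asumB// vbound_sum.
have tl := asum_vtail z1.
rewrite -vb_edge pmulr_lge0 ?expR_gt0// in core.
lra.
Qed.

Lemma vsign_mono s (a b : R) : 1 <= s -> s <= 19 / 10 -> 67 / 25 <= a * s -> a <= b -> vsign (s ^+ 2) a <= vsign (s ^+ 2) b.
Proof.
move=> s1 s2 as_ ab.
have a0 : 0 < a by rewrite -(pmulr_lgt0 _ (_ : 0 < s)); lra.
have z1 : 1 <= s ^+ 2 by rewrite expr2; have : 1 * 1 <= s * s by [apply: ler_pM]; lra.
have D t : a <= t <= b -> is_derive t 1 (vsign (s ^+ 2)) (asum (fun p => phase (1 / 2) p * (dual_weight (s ^+ 2) p * vfac t (dual_form (s ^+ 2) p)))).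
  by move=> /andP[t1 _]; apply: derive_vsign => //; exact: lt_le_trans t1.
apply: (derive_ge0_le ab D) => t /andP[t1 _]; apply: vderiv_ge0 => //; apply: (le_trans as_).
by apply: ler_wpM2r => //; lra.
Qed.

(** The variable b = sqrt a avoids differentiating a square root. *)
Definition vslope z (b : R) : R := b ^+ 3 * moment z 0 (b ^+ 2).

Lemma derive_vslope z (b : R) : 1 <= z -> 0 < b ->
  is_derive b 1 (vslope z) (2 * b ^+ 2 * expR (- (b ^+ 2)) * vsign z (b ^+ 2)).
Proof.
move=> z1 b0; have b2 : 0 < b ^+ 2 by exact: exprn_gt0.
have H := dmul (dexpn 3 (did b)) (dcomp (dexpn 2 (did b)) (derive_moment 0 z1 b2)).
apply: (deq H); rewrite /vsign /=.
rewrite [RHS](_ : _ = 2 * b ^+ 2 * (expR (- (b ^+ 2)) * expR (b ^+ 2)) * (3 / 2 * moment z 0 (b ^+ 2) - b ^+ 2 * moment z 1 (b ^+ 2))); last by ring.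
by rewrite -expRD addNr expR0 !exprS expr0; field.
Qed.

Lemma slope_vslope s y : 0 < s -> 0 < y ->
  slope s (1 / 2) y = Num.sqrt (s / pi) * vslope (s ^+ 2) (Num.sqrt (pi * y / s)).
Proof.
move=> s0 y0; have p0 := pi_gt0 R.
have a0 : 0 <= pi * y / s by rewrite divr_ge0 ?mulr_ge0 ?ltW.
rewrite slope_dual// /vslope (exprS (Num.sqrt _) 2) sqr_sqrtr//.
have -> : Num.sqrt y = Num.sqrt (s / pi) * Num.sqrt (pi * y / s).
  rewrite -sqrtrM ?divr_ge0 ?ltW//; congr Num.sqrt.
  by move: (pi : R) p0 => q q0; field; rewrite ?gt_eqF.
have -> : asum (dual_slope (pi * y / s) (s ^+ 2) (1 / 2)) = moment (s ^+ 2) 0 (pi * y / s).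
  by rewrite /moment; apply: eq_asum => p; rewrite /dual_slope /moment_term expr0 mulr1 mulrC mulrA.
by rewrite !mulrA.
Qed.

(** Consequence of the monotonicity of the sign: nonnegative stays so upwards,
    negative downwards. *)
Lemma slope_vert s (y1 y2 : R) : 1 <= s -> s <= 19 / 10 -> 67 / 25 <= pi * y1 -> y1 < y2 ->
  (0 <= vsign (s ^+ 2) (pi * y1 / s) -> slope s (1 / 2) y1 <= slope s (1 / 2) y2) /\
  (vsign (s ^+ 2) (pi * y2 / s) < 0 -> slope s (1 / 2) y2 < slope s (1 / 2) y1).
Proof.
move=> s1 s2 py y12; have p0 := pi_gt0 R.
have s0 : 0 < s by lra.
have y10 : 0 < y1 by rewrite -(pmulr_rgt0 _ p0); lra.
have y20 : 0 < y2 by lra.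
have z1 : 1 <= s ^+ 2 by rewrite expr2; have : 1 * 1 <= s * s by [apply: ler_pM]; lra.
have c0 : 0 < Num.sqrt (s / pi) by rewrite sqrtr_gt0 divr_gt0.
rewrite (slope_vslope s0 y10) (slope_vslope s0 y20).
set a1 := pi * y1 / s; set a2 := pi * y2 / s.
have a10 : 0 < a1 by rewrite /a1 divr_gt0// mulr_gt0.
have a12 : a1 < a2 by rewrite /a1 /a2 ltr_pM2r ?invr_gt0// ltr_pM2l.
have as1 : 67 / 25 <= a1 * s by rewrite /a1 mulfVK// gt_eqF.
have b10 : 0 < Num.sqrt a1 by rewrite sqrtr_gt0.
have b12 : Num.sqrt a1 < Num.sqrt a2 by rewrite ltr_sqrt//; lra.
have q1 : Num.sqrt a1 ^+ 2 = a1 by rewrite sqr_sqrtr// ltW.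
have q2 : Num.sqrt a2 ^+ 2 = a2 by rewrite sqr_sqrtr//; lra.
clearbody a1 a2; move: (Num.sqrt a1) (Num.sqrt a2) b10 b12 q1 q2 => b1 b2 b10 b12 q1 q2.
have between t : b1 <= t <= b2 -> a1 <= t ^+ 2 <= a2.
  move=> /andP[t1 t2]; have t0 : 0 <= t by lra.
  by rewrite -q1 -q2 !lerXn2r ?nnegrE//; lra.
have dd t : b1 <= t <= b2 -> is_derive t 1 (vslope (s ^+ 2)) (2 * t ^+ 2 * expR (- (t ^+ 2)) * vsign (s ^+ 2) (t ^+ 2)).
  by move=> /andP[t1 t2]; apply: derive_vslope => //; lra.
have pos t : b1 <= t <= b2 -> 0 < 2 * t ^+ 2 * expR (- (t ^+ 2)).
  by move=> /andP[t1 t2]; rewrite !mulr_gt0 ?expR_gt0//; lra.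
split=> h.
  rewrite ler_pM2l//; apply: (derive_ge0_le _ dd); first exact: ltW.
  move=> t tb; apply: mulr_ge0; first exact/ltW/pos.
  apply: (le_trans h); apply: vsign_mono => //; by case/andP: (between t tb).
rewrite ltr_pM2l// -ltrN2; apply: (@derive_gt0_lt _ (fun t => - vslope (s ^+ 2) t) (fun t => - (2 * t ^+ 2 * expR (- (t ^+ 2)) * vsign (s ^+ 2) (t ^+ 2)))) => //.
  by move=> t tb; apply: dopp; exact: dd.
move=> t tb; rewrite oppr_gt0 pmulr_rlt0; last exact: pos.
apply: le_lt_trans h; have /andP[u1 u2] := between t tb.
apply: vsign_mono => //; apply: (le_trans as1); apply: ler_wpM2r => //; lra.
Qed.
End mono.

(** * The slope is smallest at the hexagonal point *)

Section hexmin.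
Variable R : realType.
Implicit Types (s x y a z r : R) (p : int * int).

(** An integral change of variables permutes the lattice sum. *)
Lemma slope_bij s x y x' y' (e : int * int -> int * int) : bijective e ->
  (forall p, qform x' y' p = qform x y (e p)) -> slope s x' y' = slope s x y.
Proof.
move=> be H; rewrite /slope [in RHS](reindex_asum _ be); congr (_ * _).
by apply: eq_asum => p; rewrite H.
Qed.

Lemma ntheta_bij s x y x' y' (e : int * int -> int * int) : bijective e ->
  (forall p, qform x' y' p = qform x y (e p)) -> ntheta s x' y' = ntheta s x y.
Proof.
move=> be H; rewrite /ntheta [in RHS](reindex_asum _ be); congr (_ * _).
by apply: eq_asum => p; rewrite H.
Qed.

Lemma swap_bij : bijective swap.
Proof. by exists swap => -[]. Qed.

Lemma qform_inv x y p : 0 < y ->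
  qform (x / (x ^+ 2 + y ^+ 2)) (y / (x ^+ 2 + y ^+ 2)) p = qform x y (swap p).
Proof.
move=> y0; have r0 : x ^+ 2 + y ^+ 2 != 0.
  by rewrite gt_eqF// ltr_wpDl ?sqr_ge0// exprn_gt0.
have yn : y != 0 by rewrite gt_eqF.
by rewrite /qform /swap /=; move: (p.1%:~R) (p.2%:~R) => m n; field; rewrite r0 yn.
Qed.

Lemma slope_inv s x y : 0 < y -> slope s (x / (x ^+ 2 + y ^+ 2)) (y / (x ^+ 2 + y ^+ 2)) = slope s x y.
Proof. by move=> y0; apply: (slope_bij _ swap_bij) => p; exact: qform_inv. Qed.

Lemma ntheta_inversion s x y : 0 < y -> ntheta s (x / (x ^+ 2 + y ^+ 2)) (y / (x ^+ 2 + y ^+ 2)) = ntheta s x y.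
Proof. by move=> y0; apply: (ntheta_bij _ swap_bij) => p; exact: qform_inv. Qed.

Lemma ntheta_shift s x y (k : int) : ntheta s (x + k%:~R) y = ntheta s x y.
Proof.
apply: (@ntheta_bij _ _ _ _ _ (fun p => (p.1, p.2 + k * p.1))).
  by exists (fun p => (p.1, p.2 - k * p.1)) => -[m n] /=; congr (_, _); ring.
by move=> p; rewrite /qform /= intrD intrM; congr ((_ ^+ 2 + _) / _); ring.
Qed.

Lemma ntheta_opp s x y : ntheta s (- x) y = ntheta s x y.
Proof.
apply: (@ntheta_bij _ _ _ _ _ (fun p => (- p.1, p.2))).
  by exists (fun p => (- p.1, p.2)) => -[m n] /=; rewrite opprK.
by move=> p; rewrite /qform /= rmorphN /= mulrN !mulNr sqrrN.
Qed.

Definition hex_im : R := Num.sqrt 3 / 2.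

Lemma hex_im_bnd : 84 / 97 <= hex_im <= 97 / 112.
Proof. by have := sqrt3_bnd R; rewrite /hex_im; lra. Qed.

Lemma hex_im_sq : hex_im ^+ 2 = 3 / 4.
Proof. by rewrite /hex_im expr_div_n sqr_sqrtr//; field. Qed.

(** The image of 1/2 + i y under inversion has height y / (1/4 + y^2); for y
    just above the hexagonal point it lies just below, still in the range of
    [slope_horiz]. *)
Lemma slope_star s y : 1 <= s -> s <= 19 / 10 -> hex_im < y -> y <= 13 / 15 ->
  slope s (1 / 2) (y / (1 / 4 + y ^+ 2)) <= slope s (1 / 2) y /\
  (67 / 25 <= pi * (y / (1 / 4 + y ^+ 2)) /\ y / (1 / 4 + y ^+ 2) < hex_im).
Proof.
move=> s1 s2 hy y1; have /andP[b1 b2] := hex_im_bnd; have hs := hex_im_sq.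
have y0 : 0 < y by lra.
have yy : y * y <= 13 / 15 * (13 / 15) by apply: ler_pM; lra.
have hy2 : hex_im * hex_im < y * y by rewrite ltr_pM//; lra.
rewrite expr2 in hs.
have D0 : 0 < 1 / 4 + y ^+ 2 by rewrite expr2; lra.
have p1 := pi_gt31 R.
have y' : 173 / 200 <= y / (1 / 4 + y ^+ 2) by rewrite ler_pdivlMr// expr2; lra.
have P : 67 / 25 <= pi * (y / (1 / 4 + y ^+ 2)).
  have : 31 / 10 * (173 / 200) <= pi * (y / (1 / 4 + y ^+ 2)) by apply: ler_pM; lra.
  lra.
split; last first.
  split=> //; rewrite ltr_pdivrMr// expr2.
  have : 0 < (y - hex_im) * (hex_im * y - 1 / 4).
    apply: mulr_gt0; first by lra.
    have : 84 / 97 * (84 / 97) <= hex_im * y by apply: ler_pM; lra.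
    lra.
  have /= := congr1 (fun u => u * y) hs; clear; lra.
have := slope_inv s (1 / 2) y0.
have -> : (1 / 2) ^+ 2 = 1 / 4 :> R by rewrite expr2; lra.
by move=> <-; exact: slope_horiz.
Qed.

(** If the sign is negative at the hexagonal point, the slope decreases up to
    it. A point t slightly above has an inverse image t1 slightly below with
    slope(t) >= slope(t1) >= slope(h). Were the sign still negative at t, the
    slope would be decreasing on [t1, t], a contradiction; so it is
    nonnegative from t on. *)
Lemma slope_half_min s y : 1 <= s -> s <= 19 / 10 -> hex_im <= y -> slope s (1 / 2) hex_im <= slope s (1 / 2) y.
Proof.
move=> s1 s2; rewrite le_eqVlt => /orP[/eqP <-//|hy].
have /andP[b1 b2] := hex_im_bnd; have p1 := pi_gt31 R.
have ph : 67 / 25 <= pi * hex_im.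
  have : 31 / 10 * (84 / 97) <= pi * hex_im by apply: ler_pM; lra.
  lra.
have [g0|g0] := leP 0 (vsign (s ^+ 2) (pi * hex_im / s)); first by case: (slope_vert s1 s2 ph hy) => + _; exact.
pose t := Num.min y (13 / 15).
have ht : hex_im < t by rewrite lt_min hy; lra.
have ty : t <= y by rewrite ge_min lexx.
have t1 : t <= 13 / 15 by rewrite ge_min lexx orbT.
have [k1 [k2 k3]] := slope_star s1 s2 ht t1.
set t' := t / _ in k1 k2 k3.
have k4 := (slope_vert s1 s2 k2 k3).2 g0.
have t't : t' < t by lra.
have pt : 67 / 25 <= pi * t.
  by apply: (le_trans ph); rewrite ler_wpM2l//; lra.
have [g1|g1] := leP 0 (vsign (s ^+ 2) (pi * t / s)).
  apply: (le_trans (ltW k4)); apply: (le_trans k1).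
  move: ty; rewrite le_eqVlt => /orP[/eqP <-//|ty].
  by case: (slope_vert s1 s2 pt ty) => + _; exact.
have := (slope_vert s1 s2 k2 t't).2 g1; lra.
Qed.

Lemma slope_min s x y : 1 <= s -> 0 <= x -> x <= 1 / 2 -> 1 <= x ^+ 2 + y ^+ 2 -> 0 < y ->
  slope s (1 / 2) hex_im <= slope s x y.
Proof.
move=> s1 x0 x1 zz y0; have [sl|sg] := leP s (19 / 10); last by apply: slope_min_large => //; exact: ltW.
have hy : hex_im <= y.
  rewrite leNgt; apply/negP => yh; have : y * y < hex_im * hex_im by rewrite ltr_pM// ltW.
  by have := hex_im_sq; rewrite !expr2 in zz *; have : x * x <= 1 / 2 * (1 / 2) by [apply: ler_pM]; lra.
apply: (le_trans (slope_half_min s1 sl hy)); apply: slope_horiz => //.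
have /andP[b1 b2] := hex_im_bnd; have p1 := pi_gt31 R.
have : 31 / 10 * (84 / 97) <= pi * y by apply: ler_pM; lra.
lra.
Qed.

Definition hexgap s x y : R := ntheta s x y - ntheta s (1 / 2) hex_im.

Lemma hex_im_gt0 : 0 < hex_im. Proof. by have := hex_im_bnd; lra. Qed.

Lemma hexgap_anti x y (s t : R) : 0 <= x -> x <= 1 / 2 -> 1 <= x ^+ 2 + y ^+ 2 -> 0 < y ->
  1 <= s -> s <= t -> hexgap t x y <= hexgap s x y.
Proof.
move=> x0 x1 zz y0 s1 st; rewrite -lerN2.
have D u : s <= u <= t -> is_derive u 1 (fun u => - hexgap u x y) (- (- (slope u x y / u) + - - (slope u (1 / 2) hex_im / u))).
  move=> /andP[u1 u2]; have u0 : 0 < u by lra.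
  apply: dopp; apply: dadd; first exact: derive_ntheta.
  by apply: dopp; apply: derive_ntheta => //; exact: hex_im_gt0.
apply: (derive_ge0_le st D) => u /andP[u1 u2].
have u0 : 0 < u by lra.
rewrite (_ : - _ = (slope u x y - slope u (1 / 2) hex_im) / u); last by ring.
rewrite divr_ge0 ?subr_ge0//; last exact: ltW.
by apply: slope_min => //; lra.
Qed.

Lemma ntheta_ge_sqrt s x y : 0 < s -> 0 < y -> Num.sqrt s <= ntheta s x y.
Proof.
move=> s0 y0; rewrite /ntheta -[leLHS]mulr1 ler_wpM2l ?sqrtr_ge0//.
have ps : 0 < pi * s by rewrite mulr_gt0// pi_gt0.
have := @asum_ge_seq _ _ (fun p => expR (- (pi * s * qform x y p))) [:: (0, 0)] (fun p => expR_ge0 _) (asummable_qform x ps y0) isT.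
rewrite big_cons big_nil addr0; apply: le_trans.
by rewrite /qform /= !mul0r addr0 expr0n /= addr0 mul0r mulr0 oppr0 expR0.
Qed.

Lemma ntheta_hex_le : exists2 C : R, 0 <= C & forall s, 1 <= s ->
  ntheta s (1 / 2) hex_im <= Num.sqrt s * (1 + C * expR (- (s - 1))).
Proof.
have p0 := pi_gt0 R; have hg := hex_im_gt0.
have sQ := asummable_qform (1 / 2) p0 hg.
exists (asum (fun p => expR (- (pi * qform (1 / 2) hex_im p)))).
  by apply: asum_ge0 => // p; exact: expR_ge0.
move=> s s1; rewrite /ntheta ler_wpM2l ?sqrtr_ge0//.
have ps : 0 < pi * s by rewrite mulr_gt0//; lra.
have sd : asummable (fun p : int * int => (p == (0, 0))%:R : R).
  by apply: (@asummable_fin _ _ _ [:: (0, 0)]) => p; rewrite inE => /negPf ->.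
have oE : asum (fun p : int * int => (p == (0, 0))%:R : R) = 1.
  rewrite (@asum_fin _ _ _ [:: (0, 0)])//; last by move=> p; rewrite inE => /negPf ->.
  by rewrite big_cons big_nil eqxx addr0.
rewrite -[X in _ <= X + _]oE [X in _ <= _ + X]mulrC -asumZ// -asumD//; last exact: asummableZ.
apply: ler_asum; first exact: asummable_qform.
  by apply: asummableD => //; exact: asummableZ.
move=> p; have [->|p0'] := eqVneq p (0, 0).
  rewrite /qform /= !mul0r addr0 expr0n /= addr0 mul0r !mulr0 oppr0 expR0 lerDl mulr1.
  exact: expR_ge0.
rewrite add0r -expRD ler_expR.
have n1 := @hex_norm_ge1 R p p0'; have /andP[hb _] := hex_scale_bnd R; have p1 := pi_gt31 R.
have Q1 : 1 <= qform (1 / 2) hex_im p by rewrite qform_hex; have : 1 * 1 <= hex_scale R * hex_norm R p by [apply: ler_pM; lra]; lra.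
have : 1 * 1 <= pi * qform (1 / 2) hex_im p by apply: ler_pM; lra.
move=> k; have : (s - 1) * 1 <= (s - 1) * (pi * qform (1 / 2) hex_im p) by rewrite ler_wpM2l//; lra.
lra.
Qed.

(** The gap at s is at least the gap at any later time, which is bounded below
    by minus the nonconstant part of the hexagonal sum, of order (1 + u)
    e^(-u). *)
Lemma hexgap_ge0 s x y : 1 <= s -> 0 <= x -> x <= 1 / 2 -> 1 <= x ^+ 2 + y ^+ 2 -> 0 < y -> 0 <= hexgap s x y.
Proof.
move=> s1 x0 x1 zz y0; rewrite leNgt; apply/negP => Dn.
have [C C0 HC] := ntheta_hex_le.
pose e := - hexgap s x y; have e0 : 0 < e by rewrite oppr_gt0.
pose u := s + 4 * (C + 1) / e.
have w0 : 0 < 4 * (C + 1) / e by rewrite divr_gt0//; lra.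
have us : s <= 1 + u by rewrite /u; lra.
have := hexgap_anti x0 x1 zz y0 s1 us.
have u1 : 1 <= u by rewrite /u; lra.
have ue : 4 * (C + 1) / e <= u by rewrite /u; lra.
rewrite {1}/hexgap; have t1 : 1 <= 1 + u by lra.
have f1 := HC _ t1; have tp : 0 < 1 + u by lra.
have f2 := ntheta_ge_sqrt x tp y0.
rewrite (_ : 1 + u - 1 = u) in f1; last by ring.
have sq : Num.sqrt (1 + u) <= 1 + u.
  rewrite -[leRHS]ger0_norm; last by lra.
  by rewrite -sqrtr_sqr ler_sqrt ?sqr_ge0// expr2; nra.
have q0 := sqrtr_ge0 (1 + u).
have ex := @expR_ge_quad R u; have {}ex : 1 + u + u ^+ 2 / 2 <= expR u by apply: ex; lra.
have k : (1 + u) * expR (- u) <= 4 / u.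
  rewrite expRN ler_pdivrMr ?expR_gt0// mulrAC ler_pdivlMr; last by lra.
  rewrite expr2 in ex; nra.
have Ck : Num.sqrt (1 + u) * (C * expR (- u)) <= C * (4 / u).
  rewrite mulrCA; apply: ler_wpM2l => //.
  by apply: le_trans k; rewrite ler_wpM2r ?expR_ge0.
have : C * (4 / u) < e.
  rewrite mulrA ltr_pdivrMr; last by lra.
  move: ue; rewrite ler_pdivrMr//; lra.
rewrite /e; lra.
Qed.
End hexmin.

(** * Reduction to the fundamental domain and behaviour at the cusp *)

Section reduction.
Variable R : realType.
Implicit Types (s x y a z r : R) (p : int * int).

(** The lattice contains the multiples of a vector of squared length 1/y;
    those of length at most 1 are at least sqrt y in number. *)
Lemma Im_bound x y : 0 < y -> y <= (ntheta 1 x y * expR pi) ^+ 2.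
Proof.
move=> y0; have p0 := pi_gt0 R.
set n := Num.truncn (Num.sqrt y).
have sy := sqrtr_ge0 y.
have n1 : n%:R <= Num.sqrt y by rewrite truncn_le.
have n2 : Num.sqrt y < n.+1%:R by rewrite truncnS_gt.
have pp : 0 < pi * 1 :> R by rewrite mulr1.
pose L := [seq (0 : int, Posz k) | k <- index_iota 0 n.+1].
have uL : uniq L by rewrite map_inj_uniq ?iota_uniq// => i j [].
have := @asum_ge_seq _ _ (fun p => expR (- (pi * 1 * qform x y p))) L (fun p => expR_ge0 _) (asummable_qform x pp y0) uL.
have t (k : nat) : (0 <= k < n.+1)%N -> expR (- pi) <= expR (- (pi * 1 * qform x y (0 : int, Posz k))).
  move=> kn; rewrite ler_expR lerN2 mulr1 -[leRHS]mulr1 ler_wpM2l//; first exact: ltW.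
  rewrite /qform /= !mul0r add0r expr0n /= addr0 ler_pdivrMr// mul1r.
  have k1 : k%:R <= Num.sqrt y by apply: le_trans n1; rewrite ler_nat -ltnS.
  rewrite -[leRHS]sqr_sqrtr; last exact: ltW.
  by rewrite lerXn2r ?nnegrE.
rewrite big_map => h.
have {}h : n.+1%:R * expR (- pi) <= ntheta 1 x y.
  rewrite /ntheta sqrtr1 mul1r; apply: le_trans h; rewrite mulr_natl -[n.+1 in leLHS]subn0 -sumr_const_nat.
  exact: ler_sum_nat.
have k : n.+1%:R <= ntheta 1 x y * expR pi.
  have := ler_wpM2r (expR_ge0 pi) h; rewrite -mulrA -expRD addNr expR0 mulr1; exact.
rewrite -[leLHS]sqr_sqrtr; last exact: ltW.
by rewrite lerXn2r ?nnegrE//; [apply: le_trans k|apply: (le_trans (ltW n2))].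
Qed.

(** Take a point whose imaginary part is at least 9/10 of the supremum over
    all points with the same theta values, and move it to the strip |x| <=
    1/2. If it is inside the unit circle, the inversion raises the imaginary
    part by a factor of at most 10/9, so the image is close to the circle and
    can be reflected into the domain. *)
Lemma reduce x y : 0 < y -> exists x' y', [/\ 0 < y', 0 <= x', x' <= 1 / 2, 1 <= x' ^+ 2 + y' ^+ 2 &
  forall s, ntheta s x' y' = ntheta s x y].
Proof.
move=> y0.
pose A : set R := [set v | 0 < v /\ exists u, forall s, ntheta s u v = ntheta s x y].
have Ay : A y by split=> //; exists x.
have ub : ubound A ((ntheta 1 x y * expR pi) ^+ 2).
  by move=> v [v0 [u Hu]]; rewrite -(Hu 1); exact: Im_bound.
have hs : has_sup A by split; [exists y|exists ((ntheta 1 x y * expR pi) ^+ 2)].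
have Y0 : y <= sup A by apply: ub_le_sup => //; case: hs.
have [|v [v0 [u Hu]] vs] := @sup_adherent _ A (sup A / 10) _ hs; first by lra.
(* translation into |x| <= 1/2, then reflection *)
have [u' [u0 u1 Hu']] : exists u', [/\ 0 <= u', u' <= 1 / 2 & forall s, ntheta s u' v = ntheta s x y].
  pose k := Num.floor (u + 1 / 2); have := floor_itv (u + 1 / 2); rewrite -/k intrD => /andP[k1 k2].
  have Hk s : ntheta s (u - k%:~R) v = ntheta s x y by rewrite -rmorphN /= ntheta_shift.
  have [w0|w0] := leP 0 (u - k%:~R).
    by exists (u - k%:~R); split=> //; lra.
  by exists (- (u - k%:~R)); split=> [||s]; [lra|lra|rewrite ntheta_opp].
have vY w c : 0 < w -> (forall s, ntheta s c w = ntheta s x y) -> w <= sup A.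
  by move=> w0 Hc; apply: ub_le_sup; [case: hs|split=> //; exists c].
have [r1|r1] := leP 1 (u' ^+ 2 + v ^+ 2); first by exists u', v.
set r := u' ^+ 2 + v ^+ 2 in r1.
have r0 : 0 < r by rewrite ltr_wpDl ?sqr_ge0// exprn_gt0.
have Hinv s : ntheta s (u' / r) (v / r) = ntheta s x y by rewrite ntheta_inversion.
have vr : 0 < v / r by exact: divr_gt0.
have := vY _ _ vr Hinv; rewrite ler_pdivrMr// => vsr.
have r9 : 9 / 10 < r by nra.
have rn : r != 0 by rewrite gt_eqF.
have nr : (u' / r) ^+ 2 + (v / r) ^+ 2 = r^-1.
  by rewrite !expr_div_n -mulrDl -/r; field.
have ri : 1 <= r^-1 by rewrite -[leLHS]invr1 lef_pV2 ?posrE// ltW.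
have ur0 : 0 <= u' / r by rewrite divr_ge0// ltW.
have [c|c] := leP (u' / r) (1 / 2); first by exists (u' / r), (v / r); split=> //; rewrite nr.
exists (1 - u' / r), (v / r); split=> //.
- rewrite subr_ge0 ler_pdivrMr//; lra.
- lra.
- have -> : (1 - u' / r) ^+ 2 + (v / r) ^+ 2 = 1 - 2 * (u' / r) + ((u' / r) ^+ 2 + (v / r) ^+ 2) by ring.
  rewrite nr; have : 2 * (u' / r) <= r^-1.
    by rewrite mulrA -[leRHS]mul1r ler_pM2r ?invr_gt0//; lra.
  lra.
- by move=> s; rewrite addrC -[1]/(1%:~R) ntheta_shift ntheta_opp.
Qed.

Lemma hexgap_all x y : 0 < y ->
  (forall s, 1 <= s -> 0 <= hexgap s x y) /\ (forall s t, 1 <= s -> s <= t -> hexgap t x y <= hexgap s x y).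
Proof.
move=> y0; have [x' [y' [y'0 x0 x1 zz H]]] := reduce x y0.
have E s : hexgap s x y = hexgap s x' y' by rewrite /hexgap H.
split=> [s s1|s t s1 st]; rewrite ?E; first exact: hexgap_ge0.
exact: hexgap_anti.
Qed.

Lemma hexgap_inv s x y : 0 < s -> 0 < y -> hexgap s^-1 x y = hexgap s x y.
Proof. by move=> s0 y0; rewrite /hexgap !ntheta_inv//; exact: hex_im_gt0. Qed.

(** D(l) >= D(be l) >= 0 and c <= 1. *)
Lemma comb_min (l be c : R) x y : 0 < l -> l <= 1 -> 0 < be -> be < 1 -> c <= 1 -> 0 < y ->
  ntheta l (1 / 2) (hex_im R) - c * ntheta (be * l) (1 / 2) (hex_im R) <= ntheta l x y - c * ntheta (be * l) x y.
Proof.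
move=> l0 l1 be0 be1 c1 y0; have [P M] := hexgap_all x y0.
have bl0 : 0 < be * l by exact: mulr_gt0.
have i1 : 1 <= l^-1 by rewrite invf_ge1.
have i2 : l^-1 <= (be * l)^-1 by rewrite lef_pV2 ?posrE// ler_piMl// ltW.
have d2 := P _ (le_trans i1 i2); have d12 := M _ _ i1 i2.
rewrite !hexgap_inv// in d2 d12.
have : 0 <= (1 - c) * hexgap (be * l) x y by rewrite mulr_ge0// subr_ge0.
rewrite /hexgap in d2 d12 *; lra.
Qed.

Lemma ntheta_theta s x y : 0 < s -> 0 < y -> ntheta s x y = Num.sqrt s * theta s (Complex x y).
Proof. by move=> s0 y0; rewrite theta_asum. Qed.

Lemma ntheta_theta_comb (l be b : R) x y : 0 < l -> 0 < be -> 0 < y ->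
  Num.sqrt l * (theta l (Complex x y) - b * theta (be * l) (Complex x y)) =
  ntheta l x y - b / Num.sqrt be * ntheta (be * l) x y.
Proof.
move=> l0 be0 y0; rewrite !ntheta_theta ?mulr_gt0// sqrtrM; last exact: ltW.
have sb : Num.sqrt be != 0 by rewrite gt_eqF// sqrtr_gt0.
by move: (theta l _) (theta (be * l) _) (Num.sqrt l) (Num.sqrt be) sb => u v w r r0; field.
Qed.

Lemma dual0_ge1 s y : 0 < s -> 0 < y -> 1 <= asum (dual s 0 y).
Proof.
move=> s0 y0; have d0 p : 0 <= dual s 0 y p.
  by rewrite /dual mulr0 mul0r cos0 mulr1 expR_ge0.
have := @asum_ge_seq _ _ (dual s 0 y) [:: (0, 0)] d0 (asummable_dual 0 s0 y0) isT.
rewrite big_cons big_nil addr0; apply: le_trans.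
by rewrite /dual /= mulr0 mul0r cos0 mulr1 expr0n /= mulr0 mul0r addr0 mulr0 oppr0 expR0.
Qed.

(** The nonconstant terms decay uniformly: e^(- y q) <= e^(- (y - 1)) e^(- q)
    for q >= 1. *)
Lemma dual0_le s : 0 < s -> s <= 1 -> exists2 C : R, 0 <= C & forall y, 1 <= y ->
  asum (dual s 0 y) <= 1 + C * expR (- (s * (y - 1))).
Proof.
move=> s0 s1; have p0 := pi_gt31 R.
have ps : 0 < s by [].
have sQ := asummable_sqnorm s0.
exists (asum (fun p => expR (- (s * sqnorm R p)))).
  by apply: asum_ge0 => // p; exact: expR_ge0.
move=> y y1; have y0 : 0 < y by lra.
have sd : asummable (fun p : int * int => (p == (0, 0))%:R : R).
  by apply: (@asummable_fin _ _ _ [:: (0, 0)]) => p; rewrite inE => /negPf ->.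
have oE : asum (fun p : int * int => (p == (0, 0))%:R : R) = 1.
  rewrite (@asum_fin _ _ _ [:: (0, 0)])//; last by move=> p; rewrite inE => /negPf ->.
  by rewrite big_cons big_nil eqxx addr0.
rewrite -[X in _ <= X + _]oE [X in _ <= _ + X]mulrC -asumZ// -asumD//; last exact: asummableZ.
apply: ler_asum; first exact: asummable_dual.
  by apply: asummableD => //; exact: asummableZ.
move=> p; have [->|p0'] := eqVneq p (0, 0).
  rewrite /dual /= mulr0 mul0r cos0 mulr1 expr0n /= mulr0 mul0r addr0 mulr0 oppr0 expR0 lerDl.
  by rewrite mulr_ge0 ?expR_ge0.
rewrite add0r -expRD /dual mulr0 mul0r cos0 mulr1 ler_expR.
have n1 := sqnorm_ge1 R p0'.
have m0 := sqr_ge0 (p.1%:~R : R); have k0 := sqr_ge0 (p.2%:~R : R).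
have si : 1 <= s^-1 by rewrite invf_ge1.
have T : s * sqnorm R p <= s * p.1%:~R ^+ 2 + p.2%:~R ^+ 2 / s.
  rewrite /sqnorm mulrDr lerD2l [leRHS]mulrC ler_wpM2r//; lra.
have sN : 0 < s * sqnorm R p by rewrite mulr_gt0//; lra.
have k1 : y * (s * sqnorm R p) <= pi * y * (s * p.1%:~R ^+ 2 + p.2%:~R ^+ 2 / s).
  apply: ler_pM => //; [lra|exact: ltW|].
  by rewrite -[leLHS]mul1r ler_wpM2r//; lra.
have k2 : (y - 1) * (s * 1) <= (y - 1) * (s * sqnorm R p) by rewrite ler_wpM2l ?ler_pM2l//; lra.
lra.
Qed.

(** On the imaginary axis all dual terms are positive and only the constant
    term survives for large y. *)
Lemma comb_unbounded (l be c V : R) : 0 < l -> l <= 1 -> 0 < be -> 1 < c ->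
  exists2 y, 0 < y & ntheta l 0 y - c * ntheta (be * l) 0 y < V.
Proof.
move=> l0 l1 be0 c1; have [C C0 HC] := dual0_le l0 l1.
have bl0 : 0 < be * l by exact: mulr_gt0.
pose e := (c - 1) / 2; have e0 : 0 < e by rewrite divr_gt0// subr_gt0.
(* so that C e^(- l (y - 1)) <= e and sqrt y * e > |V| *)
pose y := 1 + C / (e * l) + (`|V| / e + 1) ^+ 2.
have w1 : 0 <= C / (e * l) by apply: divr_ge0 => //; apply: mulr_ge0; exact: ltW.
have w2 : 0 <= `|V| / e by apply: divr_ge0; [exact: normr_ge0|exact: ltW].
have w3 : 0 <= (`|V| / e + 1) ^+ 2 by exact: sqr_ge0.
have y1 : 1 <= y by rewrite /y; lra.
have y0 : 0 < y by lra.
exists y => //; rewrite !ntheta_dual//.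
have d1 := HC _ y1; have d2 := dual0_ge1 bl0 y0.
have ex : C * expR (- (l * (y - 1))) <= e.
  rewrite expRN ler_pdivrMr ?expR_gt0//.
  have h := expR_ge1Dx (l * (y - 1)).
  have : C <= e * (l * (y - 1)).
    have : C / (e * l) * (e * l) <= (y - 1) * (e * l) by rewrite ler_wpM2r ?mulr_ge0 ?(ltW e0) ?(ltW l0)// /y; lra.
    rewrite mulfVK; first by lra.
    by rewrite mulf_neq0// gt_eqF.
  have : e * (l * (y - 1)) <= e * expR (l * (y - 1)) by rewrite ler_pM2l//; lra.
  lra.
have sy : `|V| / e + 1 <= Num.sqrt y.
  rewrite -[leLHS]ger0_norm; last by lra.
  by rewrite -sqrtr_sqr ler_sqrt ?sqr_ge0// /y; lra.
have s0 := sqrtr_ge0 y.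
have k1 : `|V| < Num.sqrt y * e.
  by rewrite -ltr_pdivrMr//; lra.
have k2 : Num.sqrt y * asum (dual l 0 y) <= Num.sqrt y * (1 + e) by rewrite ler_wpM2l//; lra.
have k3 : Num.sqrt y * c <= c * (Num.sqrt y * asum (dual (be * l) 0 y)).
  rewrite mulrCA ler_wpM2l// -[leLHS]mulr1 ler_wpM2l//; lra.
have ee : c = 1 + 2 * e by rewrite /e; field.
have nV : - `|V| <= V by rewrite lerNl -normrN ler_norm.
have k4 : Num.sqrt y * c = Num.sqrt y + 2 * (Num.sqrt y * e) by rewrite ee; ring.
lra.
Qed.
End reduction.

Theorem corollary1p2 (R : realType) (lambda beta b : R)
    (lambda_gt0 : 0 < lambda) (lambda_le1 : lambda <= 1)
    (beta_gt0 : 0 < beta) (beta_lt1 : beta < 1) :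
  (b <= Num.sqrt beta ->
     is_minimizer (@upper_half_plane R)
       (fun z => theta lambda z - b * theta (beta * lambda) z)
       (expi (pi / 3))) /\
  (Num.sqrt beta < b ->
     ~ exists z0 : R[i],
         is_minimizer (@upper_half_plane R)
           (fun z => theta lambda z - b * theta (beta * lambda) z) z0).
Proof.
have sl : 0 < Num.sqrt lambda by rewrite sqrtr_gt0.
have sb : 0 < Num.sqrt beta by rewrite sqrtr_gt0.
split=> [bb|bb [[x0 y0] [H M]]].
  have hg : 0 < Num.sqrt 3 / 2 :> R := hex_im_gt0 R.
  rewrite /expi cos_pi3 sin_pi3; split=> [//|[x y] /= y0].
  rewrite -(ler_pM2l sl) !ntheta_theta_comb//.
  by apply: comb_min => //; rewrite ler_pdivrMr// mul1r.
have c1 : 1 < b / Num.sqrt beta by rewrite ltr_pdivlMr// mul1r.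
have [y yp] := comb_unbounded (Num.sqrt lambda * (theta lambda (Complex x0 y0) - b * theta (beta * lambda) (Complex x0 y0))) lambda_gt0 lambda_le1 beta_gt0 c1.
rewrite -ntheta_theta_comb// ltr_pM2l// ltNge.
by move/negP; apply; exact: (M (Complex 0 y) yp).
Qed.
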